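(* Let $R$ be a valuation domain. Then there is a bijection between: (i) subchains $\mathcal{I}$ of $(\operatorname{Inter} R,\le)$ which satisfy conditions (C1)--(C3) (stated in the context), and (ii) equivalence classes of homological ring epimorphisms $f\colon R \to S$. The bijection is given by assigning to a non-empty $\mathcal{I}$ from (i) the ring homomorphism $f_{(\mathcal{I})}\colon R \to R_{(\mathcal{I})}$ (constructed in the context), and by assigning $R\to 0$ to $\mathcal{I}=\emptyset$. The inverse is given by sending $f\colon R \to S$ to $\mathcal{I}(f)$ (defined in the context).
   Context: A valuation domain is a commutative domain whose ideals are totally ordered by inclusion. A ring homomorphism $f\colon R\to S$ is a homological epimorphism if it is an epimorphism of rings (equivalently, the multiplication $S\otimes_R S\to S$ is an isomorphism) and $\operatorname{Tor}_i^R(S,S)=0$ for all $i\ge1$; two such, $f\colon R\to S$ and $f'\colon R\to S'$, are equivalent if $f'=\varphi f$ for a ring isomorphism $\varphi\colon S\to S'$. If $\mathfrak{p}\subseteq\mathfrak{q}$ are primes of $R$, then $\mathfrak{p}_\mathfrak{q}=\mathfrak{p}$, and $R_\mathfrak{q}/\mathfrak{p}$ denotes $R_\mathfrak{q}/\mathfrak{p}_\mathfrak{q}=(R/\mathfrak{p})_\mathfrak{q}$. Intervals. An admissible interval $[\mathfrak{i},\mathfrak{p}]$ is an interval in $(\operatorname{Spec}R,\subseteq)$ with end points primes $\mathfrak{i}\subseteq\mathfrak{p}$ such that $\mathfrak{i}^2=\mathfrak{i}$. $\operatorname{Inter}R$ is the set of all admissible intervals, partially ordered by: $[\mathfrak{i},\mathfrak{p}]<[\mathfrak{i}',\mathfrak{p}']$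 if $\mathfrak{p}\subsetneq\mathfrak{i}'$. A subchain is a totally ordered subset (possibly empty). The set $\mathcal{I}(f)$. Let $f\colon R\to S$ be a homological epimorphism ($S$ is then commutative). For every maximal ideal $\mathfrak{n}$ of $S$, the composition $R\to S\to S_\mathfrak{n}$ is a homological epimorphism equivalent to the canonical map $R\to R_\mathfrak{q}/\mathfrak{j}$ where $\mathfrak{q}=f^{-1}(\mathfrak{n})$ and $\mathfrak{j}=\operatorname{Ker}(R\to S_\mathfrak{n})\subseteq\mathfrak{q}$ is an idempotent prime. $\mathcal{I}(f)\subseteq\operatorname{Inter}R$ is the set of all admissible intervals $[\mathfrak{j},\mathfrak{q}]$ arising in this way from maximal ideals $\mathfrak{n}$ of $S$. Conditions on a subchain $\mathcal{I}$ of $\operatorname{Inter}R$: (C1) If $\{[\mathfrak{j}_\ell,\mathfrak{q}_\ell]\mid \ell\in\Lambda\}$ is a non-empty subset of $\mathcal{I}$ with no minimal element, then $\mathcal{I}$ contains an element of the form $[\mathfrak{j},\bigcap_{\ell\in\Lambda}\mathfrak{q}_\ell]$. (C2) If $\{[\mathfrak{j}_\ell,\mathfrak{q}_\ell]\mid \ell\in\Lambda\}$ is a non-empty subset of $\mathcal{I}$ with no maximal element, then $\mathcal{I}$ contains an element of the form $[\bigcup_{\ell\in\Lambda}\mathfrak{j}_\ell,\mathfrak{q}]$. (C3) Given any $[\mathfrak{j}_0,\mathfrak{q}_0]<[\mathfrak{j}_1,\mathfrak{q}_1]$ in $\mathcal{I}$, there are elements $[\mathfrak{j},\mathfrak{q}],[\mathfrak{j}',\mathfrak{q}']$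 of $\mathcal{I}$ such that $[\mathfrak{j}_0,\mathfrak{q}_0]\le[\mathfrak{j},\mathfrak{q}]<[\mathfrak{j}',\mathfrak{q}']\le[\mathfrak{j}_1,\mathfrak{q}_1]$ and there is no other interval in $\mathcal{I}$ between $[\mathfrak{j},\mathfrak{q}]$ and $[\mathfrak{j}',\mathfrak{q}']$. Construction of $f_{(\mathcal{I})}$. Let $\mathcal{I}\neq\emptyset$ be a subchain satisfying (C1)--(C3). It has a unique minimal element $[\mathfrak{i},\mathfrak{p}]$ and a unique maximal element $[\mathfrak{i}',\mathfrak{n}]$. Let $R_{\mathcal{I}}=\prod_{[\mathfrak{j},\mathfrak{q}]\in\mathcal{I}}R_\mathfrak{q}/\mathfrak{j}$ and let $g_{\mathcal{I}}\colon R_\mathfrak{n}/\mathfrak{i}\to R_{\mathcal{I}}$ be the canonical ring homomorphism (an embedding). Consider finite partitions $\mathcal{I}=\mathcal{I}_0\cup\dots\cup\mathcal{I}_n$ into disjoint subchains such that (a) each $\mathcal{I}_\ell$ has a minimal element $[\mathfrak{i}_\ell,\mathfrak{p}_\ell]$ and a maximal element $[\mathfrak{i}'_\ell,\mathfrak{n}_\ell]$, and (b) if $j<\ell$, then every element of $\mathcal{I}_j$ is $<$ every element of $\mathcal{I}_\ell$. For such a partition, let $g_{(\mathcal{I}_0,\dots,\mathcal{I}_n)}\colon\prod_{\ell=0}^nR_{\mathfrak{n}_\ell}/\mathfrak{i}_\ell\to R_{\mathcal{I}}$ be the composition of the product of the canonical maps $g_{\mathcal{I}_\ell}\colon R_{\mathfrak{n}_\ell}/\mathfrak{i}_\ell\to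 R_{\mathcal{I}_\ell}=\prod_{[\mathfrak{j},\mathfrak{q}]\in\mathcal{I}_\ell}R_\mathfrak{q}/\mathfrak{j}$ with the obvious isomorphism $\prod_{\ell=0}^nR_{\mathcal{I}_\ell}\cong R_{\mathcal{I}}$. The images of the maps $g_{(\mathcal{I}_0,\dots,\mathcal{I}_n)}$, over all partitions satisfying (a) and (b), form a direct system of subrings of $R_{\mathcal{I}}$; $R_{(\mathcal{I})}$ is the direct union of all these images, and $f_{(\mathcal{I})}\colon R\to R_{(\mathcal{I})}$ is the ring homomorphism induced by the composition $R\to R_\mathfrak{n}/\mathfrak{i}\xrightarrow{g_{\mathcal{I}}}R_{\mathcal{I}}$. *)

(* Defs.v *)
From HB Require Import structures.
From mathcomp Require Import all_boot all_order all_algebra.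
From mathcomp Require Import boolp classical_sets.
From mathcomp Require Import ring.

Set Implicit Arguments.
Unset Strict Implicit.
Unset Printing Implicit Defensive.

Import GRing.Theory.
Local Open Scope ring_scope.
Local Open Scope quotient_scope.
Local Open Scope classical_set_scope.

(* Rings are associative and unital, possibly noncommutative and possibly zero
   (pzRingType); the zero ring must be allowed as the target of R -> 0.       *)

Definition is_ideal (A : comPzRingType) (I : set A) : Prop :=
  [/\ I 0, (forall x y, I x -> I y -> I (x + y)) &
      (forall a x, I x -> I (a * x))].

Definition is_maximal_ideal (A : comPzRingType) (I : set A) : Prop :=
  [/\ is_ideal I, I <> setT &
      forall J : set A, is_ideal J -> I `<=` J -> J = I \/ J = setT].

Definition ideal_mul (A : comPzRingType) (I J : set A) : set A :=
  [set x | exists (n : nat) (a b : 'I_n -> A),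
     [/\ forall k, I (a k), forall k, J (b k) & x = \sum_k a k * b k]].

Definition valuation_domain (R : idomainType) : Prop :=
  forall I J : set R, is_ideal I -> is_ideal J -> I `<=` J \/ J `<=` I.

Record multset (A : comPzRingType) := MultSet {
  mset :> A -> Prop;
  mset1 : mset 1;
  msetM : forall x y, mset x -> mset y -> mset (x * y) }.

Section Localization.
Variables (A : comPzRingType) (T : multset A).

Notation Tt := (set_type (mset T)).

Lemma msetP (s : Tt) : T (\val s). Proof. exact: set_valP. Qed.

Definition mk_den (s : A) (hs : T s) : Tt := SigSub (mem_set hs).
Definition den1 : Tt := mk_den (mset1 T).
Definition denM (s t : Tt) : Tt := mk_den (msetM (msetP s) (msetP t)).

Lemma val_mk_den s hs : \val (@mk_den s hs) = s. Proof. by []. Qed.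
Lemma val_den1 : \val den1 = 1. Proof. by []. Qed.
Lemma val_denM s t : \val (denM s t) = \val s * \val t. Proof. by []. Qed.

Definition denE := (val_denM, val_den1, val_mk_den).

Definition loc_rel (x y : A * Tt) : bool :=
  `[< exists2 u, T u & u * (x.1 * \val y.2) = u * (y.1 * \val x.2) >].

Lemma loc_rel_refl : reflexive loc_rel.
Proof. by move=> x; apply/asboolP; exists 1 => //; exact: mset1. Qed.

Lemma loc_rel_sym : symmetric loc_rel.
Proof.
by move=> x y; apply/asboolP/asboolP => -[u Tu e]; exists u.
Qed.

Lemma loc_rel_trans : transitive loc_rel.
Proof.
move=> y x z /asboolP[u Tu e] /asboolP[v Tv e']; apply/asboolP.
exists (u * v * \val y.2).
  by apply: msetM (msetP _); exact: msetM.
transitivity (v * \val z.2 * (u * (x.1 * \val y.2))); first by ring.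
rewrite e; transitivity (u * \val x.2 * (v * (y.1 * \val z.2))); first by ring.
by rewrite e'; ring.
Qed.

Canonical loc_equiv := EquivRel loc_rel loc_rel_refl loc_rel_sym loc_rel_trans.

Definition loc := {eq_quot loc_rel}.
HB.instance Definition _ := Choice.on loc.
HB.instance Definition _ := EqQuotient.on loc.

Definition frac (a : A) (s : Tt) : loc := \pi_loc (a, s).

Lemma frac_eq a s b t :
  frac a s = frac b t <->
  exists2 u, T u & u * (a * \val t) = u * (b * \val s).
Proof.
split=> [/eqmodP/asboolP//|h]; apply/eqmodP; exact/asboolP.
Qed.

Lemma fracP (z : loc) : exists a s, z = frac a s.
Proof. by exists (repr z).1, (repr z).2; rewrite /frac -surjective_pairing reprK. Qed.

Definition num (z : loc) : A := (repr z).1.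
Definition den (z : loc) : Tt := (repr z).2.

Lemma num_den z : frac (num z) (den z) = z.
Proof. by rewrite /frac -surjective_pairing reprK. Qed.

Lemma frac_num_den a s :
  exists2 u, T u &
    u * (num (frac a s) * \val s) = u * (a * \val (den (frac a s))).
Proof. by apply/frac_eq; rewrite num_den. Qed.

Definition loc_add (x y : loc) : loc :=
  frac (num x * \val (den y) + num y * \val (den x)) (denM (den x) (den y)).
Definition loc_mul (x y : loc) : loc :=
  frac (num x * num y) (denM (den x) (den y)).
Definition loc_opp (x : loc) : loc := frac (- num x) (den x).

Lemma loc_addE a s b t :
  loc_add (frac a s) (frac b t) = frac (a * \val t + b * \val s) (denM s t).
Proof.
apply/frac_eq; rewrite ?denE.
have [u Tu eu] := frac_num_den a s; have [v Tv ev] := frac_num_den b t.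
exists (u * v); first exact: msetM.
set a' := num _ in eu *; set s' := den _ in eu *.
set b' := num _ in ev *; set t' := den _ in ev *.
transitivity (v * \val t * \val t' * (u * (a' * \val s)) +
              u * \val s * \val s' * (v * (b' * \val t))); first by ring.
by rewrite eu ev; ring.
Qed.

Lemma loc_mulE a s b t :
  loc_mul (frac a s) (frac b t) = frac (a * b) (denM s t).
Proof.
apply/frac_eq; rewrite ?denE.
have [u Tu eu] := frac_num_den a s; have [v Tv ev] := frac_num_den b t.
exists (u * v); first exact: msetM.
set a' := num _ in eu *; set s' := den _ in eu *.
set b' := num _ in ev *; set t' := den _ in ev *.
transitivity ((u * (a' * \val s)) * (v * (b' * \val t))); first by ring.
by rewrite eu ev; ring.
Qed.

Lemma loc_oppE a s : loc_opp (frac a s) = frac (- a) s.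
Proof.
apply/frac_eq; rewrite ?denE.
have [u Tu eu] := frac_num_den a s.
by exists u => //; rewrite !mulNr !mulrN eu.
Qed.

Lemma loc_addA : associative loc_add.
Proof.
move=> x y z; have [a [s ->]] := fracP x; have [b [t ->]] := fracP y.
have [c [w ->]] := fracP z; rewrite !loc_addE; apply/frac_eq; rewrite ?denE.
by exists 1; [exact: mset1 | ring].
Qed.

Lemma loc_addC : commutative loc_add.
Proof.
move=> x y; have [a [s ->]] := fracP x; have [b [t ->]] := fracP y.
by rewrite !loc_addE; apply/frac_eq; exists 1; rewrite ?denE; [exact: mset1 | ring].
Qed.

Lemma loc_add0 : left_id (frac 0 den1) loc_add.
Proof.
move=> x; have [a [s ->]] := fracP x.
by rewrite !loc_addE; apply/frac_eq; exists 1; rewrite ?denE; [exact: mset1 | ring].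
Qed.

Lemma loc_addN : left_inverse (frac 0 den1) loc_opp loc_add.
Proof.
move=> x; have [a [s ->]] := fracP x.
by rewrite loc_oppE loc_addE; apply/frac_eq; exists 1; rewrite ?denE; [exact: mset1 | ring].
Qed.

HB.instance Definition _ :=
  GRing.isZmodule.Build loc loc_addA loc_addC loc_add0 loc_addN.

Lemma loc_mulA : associative loc_mul.
Proof.
move=> x y z; have [a [s ->]] := fracP x; have [b [t ->]] := fracP y.
have [c [w ->]] := fracP z; rewrite !loc_mulE; apply/frac_eq; rewrite ?denE.
by exists 1; [exact: mset1 | ring].
Qed.

Lemma loc_mulC : commutative loc_mul.
Proof.
move=> x y; have [a [s ->]] := fracP x; have [b [t ->]] := fracP y.
by rewrite !loc_mulE; apply/frac_eq; exists 1; rewrite ?denE; [exact: mset1 | ring].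
Qed.

Lemma loc_mul1 : left_id (frac 1 den1) loc_mul.
Proof.
move=> x; have [a [s ->]] := fracP x.
by rewrite !loc_mulE; apply/frac_eq; exists 1; rewrite ?denE; [exact: mset1 | ring].
Qed.

Lemma loc_mulDl : left_distributive loc_mul +%R.
Proof.
move=> x y z; have [a [s ->]] := fracP x; have [b [t ->]] := fracP y.
have [c [w ->]] := fracP z.
have addE u v : u + v = loc_add u v by [].
rewrite !addE !(loc_mulE, loc_addE); apply/frac_eq; rewrite ?denE.
by exists 1; [exact: mset1 | ring].
Qed.

HB.instance Definition _ :=
  GRing.Zmodule_isComPzRing.Build loc loc_mulA loc_mulC loc_mul1 loc_mulDl.

Lemma fracD a s b t :
  frac a s + frac b t = frac (a * \val t + b * \val s) (denM s t).
Proof. exact: loc_addE. Qed.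

Lemma fracM a s b t : frac a s * frac b t = frac (a * b) (denM s t).
Proof. exact: loc_mulE. Qed.

Lemma fracN a s : - frac a s = frac (- a) s.
Proof. exact: loc_oppE. Qed.

Definition to_loc (a : A) : loc := frac a den1.

Lemma to_loc_zmod_morphism : zmod_morphism to_loc.
Proof.
move=> a b; rewrite /to_loc fracN fracD; apply/frac_eq.
by exists 1; rewrite ?denE; [exact: mset1 | ring].
Qed.

Lemma to_loc_monoid_morphism : monoid_morphism to_loc.
Proof.
split=> // a b; rewrite /to_loc fracM; apply/frac_eq.
by exists 1; rewrite ?denE; [exact: mset1 | ring].
Qed.

HB.instance Definition _ :=
  GRing.isZmodMorphism.Build A loc to_loc to_loc_zmod_morphism.
HB.instance Definition _ :=
  GRing.isMonoidMorphism.Build A loc to_loc to_loc_monoid_morphism.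

End Localization.

Section LocMap.
Variables (A B : comPzRingType) (T : multset A) (U : multset B).
Variables (h : {rmorphism A -> B}) (hTU : forall s, T s -> U (h s)).

Definition map_den (s : set_type (mset T)) : set_type (mset U) :=
  mk_den (hTU (msetP s)).

Lemma val_map_den s : \val (map_den s) = h (\val s). Proof. by []. Qed.

Definition loc_map (z : loc T) : loc U := frac (h (num z)) (map_den (den z)).

Lemma loc_mapE a s : loc_map (frac a s) = frac (h a) (map_den s).
Proof.
apply/frac_eq; rewrite ?denE ?val_map_den ?denE; have [u Tu eu] := frac_num_den a s.
by exists (h u); [exact: hTU | rewrite -!rmorphM eu].
Qed.

Lemma loc_map_zmod_morphism : zmod_morphism loc_map.
Proof.
move=> x y; have [a [s ->]] := fracP x; have [b [t ->]] := fracP y.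
rewrite fracN fracD !loc_mapE fracN fracD; apply/frac_eq; rewrite ?denE ?val_map_den ?denE.
by exists 1; [exact: mset1 | rewrite !(rmorphD, rmorphM, rmorphN)].
Qed.

Lemma loc_map_monoid_morphism : monoid_morphism loc_map.
Proof.
split=> [|x y].
  rewrite loc_mapE; apply/frac_eq; rewrite ?denE ?val_map_den ?denE.
  by exists 1; [exact: mset1 | rewrite !rmorph1].
have [a [s ->]] := fracP x; have [b [t ->]] := fracP y.
rewrite fracM !loc_mapE fracM; apply/frac_eq; rewrite ?denE ?val_map_den ?denE.
by exists 1; [exact: mset1 | rewrite !rmorphM].
Qed.

HB.instance Definition _ :=
  GRing.isZmodMorphism.Build (loc T) (loc U) loc_map loc_map_zmod_morphism.
HB.instance Definition _ :=
  GRing.isMonoidMorphism.Build (loc T) (loc U) loc_map loc_map_monoid_morphism.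

End LocMap.

Section Tensor.
Variables (R : comPzRingType) (M N : lmodType R).

(* A list of pairs stands for the formal sum of the corresponding pure tensors;
   [tens_rel] is the congruence generated by bilinearity.                     *)
Inductive tens_rel : seq (M * N) -> seq (M * N) -> Prop :=
| tens_refl s : tens_rel s s
| tens_sym s t : tens_rel s t -> tens_rel t s
| tens_trans s t u : tens_rel s t -> tens_rel t u -> tens_rel s u
| tens_cat s s' t t' :
    tens_rel s s' -> tens_rel t t' -> tens_rel (s ++ t) (s' ++ t')
| tens_catC s t : tens_rel (s ++ t) (t ++ s)
| tens_0l n : tens_rel [:: (0, n)] [::]
| tens_Dl m m' n : tens_rel [:: (m + m', n)] [:: (m, n); (m', n)]
| tens_Dr m n n' : tens_rel [:: (m, n + n')] [:: (m, n); (m, n')]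
| tens_Z a m n : tens_rel [:: (a *: m, n)] [:: (m, a *: n)].

Definition tens_relb (s t : seq (M * N)) : bool := `[< tens_rel s t >].

Lemma tens_relb_refl : reflexive tens_relb.
Proof. by move=> s; apply/asboolP; exact: tens_refl. Qed.

Lemma tens_relb_sym : symmetric tens_relb.
Proof. by move=> s t; apply/asboolP/asboolP; exact: tens_sym. Qed.

Lemma tens_relb_trans : transitive tens_relb.
Proof.
by move=> t s u /asboolP st /asboolP tu; apply/asboolP; exact: tens_trans st tu.
Qed.

Canonical tens_equiv :=
  EquivRel tens_relb tens_relb_refl tens_relb_sym tens_relb_trans.

Definition tensor := {eq_quot tens_relb}.
HB.instance Definition _ := Choice.on tensor.
HB.instance Definition _ := EqQuotient.on tensor.

Definition tens_sum (s : seq (M * N)) : tensor := \pi_tensor s.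
Definition tens (m : M) (n : N) : tensor := tens_sum [:: (m, n)].

Lemma tens_sum_eq s t : tens_sum s = tens_sum t <-> tens_rel s t.
Proof. by split=> [/eqmodP/asboolP//|h]; apply/eqmodP/asboolP. Qed.

Lemma tens_sumP (z : tensor) : exists s, z = tens_sum s.
Proof. by exists (repr z); rewrite /tens_sum reprK. Qed.

Lemma repr_tens_sum s : tens_rel (repr (tens_sum s)) s.
Proof. by apply/tens_sum_eq; rewrite /tens_sum reprK. Qed.

Definition tens_add (x y : tensor) : tensor := tens_sum (repr x ++ repr y).
Definition tens_opp (x : tensor) : tensor :=
  tens_sum [seq (- p.1, p.2) | p <- repr x].

Lemma tens_addE s t : tens_add (tens_sum s) (tens_sum t) = tens_sum (s ++ t).
Proof. by apply/tens_sum_eq/tens_cat; exact: repr_tens_sum. Qed.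

Lemma tens_addA : associative tens_add.
Proof.
move=> x y z; have [s ->] := tens_sumP x; have [t ->] := tens_sumP y.
by have [u ->] := tens_sumP z; rewrite !tens_addE catA.
Qed.

Lemma tens_addC : commutative tens_add.
Proof.
move=> x y; have [s ->] := tens_sumP x; have [t ->] := tens_sumP y.
by rewrite !tens_addE; apply/tens_sum_eq/tens_catC.
Qed.

Lemma tens_add0 : left_id (tens_sum [::]) tens_add.
Proof. by move=> x; have [s ->] := tens_sumP x; rewrite tens_addE. Qed.

Lemma tens_addN : left_inverse (tens_sum [::]) tens_opp tens_add.
Proof.
move=> x; rewrite -[x in tens_add _ x]reprK -/(tens_sum _) /tens_opp.
elim: (repr x) => [|[m n] s IH] /=; first by rewrite tens_add0.
rewrite -cat1s -[(m, n) :: s]cat1s -!tens_addE.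
have mN : tens_add (tens_sum [:: (- m, n)]) (tens_sum [:: (m, n)]) =
    tens_sum [::].
  rewrite tens_addE; apply/tens_sum_eq; apply: tens_trans (tens_0l n).
  by rewrite -(addNr m); apply: tens_sym; exact: tens_Dl.
rewrite tens_addA -[tens_add (tens_add _ _) (tens_sum [:: _])]tens_addA.
by rewrite [tens_add _ (tens_sum [:: _])]tens_addC tens_addA mN tens_add0.
Qed.

HB.instance Definition _ :=
  GRing.isZmodule.Build tensor tens_addA tens_addC tens_add0 tens_addN.

End Tensor.

Arguments tens {R M N} m n.

Section TensorMap.
Variables (R : comPzRingType) (M M' N : lmodType R) (d : {linear M -> M'}).

(* d \otimes id_N *)
Definition tens_map (z : tensor M N) : tensor M' N :=
  tens_sum [seq (d p.1, p.2) | p <- repr z].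

Lemma tens_mapE s :
  tens_map (tens_sum s) = tens_sum [seq (d p.1, p.2) | p <- s].
Proof.
apply/tens_sum_eq; have := repr_tens_sum s.
move: (repr _) => t; elim=> {s t} /=; try by move=> *; constructor.
- by move=> s t u _ ? _; exact: tens_trans.
- by move=> s s' t t' _ ? _ ?; rewrite !map_cat; exact: tens_cat.
- by move=> s t; rewrite !map_cat; exact: tens_catC.
- by move=> n; rewrite raddf0; exact: tens_0l.
- by move=> m m' n; rewrite raddfD; exact: tens_Dl.
- by move=> a m n; rewrite linearZ; exact: tens_Z.
Qed.

Lemma tens_map_zmod_morphism : zmod_morphism tens_map.
Proof.
have hD : {morph tens_map : x y / x + y}.
  move=> x y; have [s ->] := tens_sumP x; have [t ->] := tens_sumP y.
  rewrite [tens_sum s + _]tens_addE !tens_mapE map_cat.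
  exact/esym/tens_addE.
move=> x y; apply/eqP; rewrite eq_sym subr_eq; apply/eqP.
by rewrite -hD subrK.
Qed.

HB.instance Definition _ :=
  GRing.isZmodMorphism.Build (tensor M N) (tensor M' N) tens_map
    tens_map_zmod_morphism.

End TensorMap.

Arguments tens_map {R M M'} N d z.

Definition projective (R : comPzRingType) (P : lmodType R) : Prop :=
  forall (M N : lmodType R) (p : {linear M -> N}) (g : {linear P -> N}),
    (forall y, exists x, p x = y) -> exists h : {linear P -> M}, p \o h =1 g.

(* A projective resolution ... -> F_2 -> F_1 -> F_0 -> M -> 0; [res_d n] is the
   differential F_{n+1} -> F_n.                                               *)
Record resolution (R : comPzRingType) (M : lmodType R) := Resolution {
  res_mod :> nat -> lmodType R;
  res_d : forall n, {linear res_mod n.+1 -> res_mod n};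
  res_aug : {linear res_mod 0%N -> M};
  res_proj : forall n, projective (res_mod n);
  res_aug_onto : forall y, exists x, res_aug x = y;
  res_exact0 : forall x, res_aug x = 0 <-> exists y, x = res_d 0%N y;
  res_exactS : forall n x, res_d n x = 0 <-> exists y, x = res_d n.+1 y }.

(* Tor_i(M, N) for i >= 1 is the homology at F_i \otimes N of F \otimes N; it
   does not depend on the projective resolution F of M.                       *)
Definition Tor_zero (R : comPzRingType) (i : nat) (M N : lmodType R) : Prop :=
  if i is i'.+1 then
    forall (F : resolution M) (z : tensor (F i'.+1) N),
      tens_map N (res_d F i') z = 0 ->
      exists w, z = tens_map N (res_d F i'.+1) w
  else forall z : tensor M N, z = 0.

(* The target S of f : R -> S as a right R-module and as a left R-module, both
   written as lmodType's since R is commutative.                              *)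
Definition right_res (R : comPzRingType) (S : pzRingType)
  (f : {rmorphism R -> S}) : Type := S.
Definition left_res (R : comPzRingType) (S : pzRingType)
  (f : {rmorphism R -> S}) : Type := S.

Section Restriction.
Variables (R : comPzRingType) (S : pzRingType) (f : {rmorphism R -> S}).

Notation right_res := (right_res f).
Notation left_res := (left_res f).

HB.instance Definition _ := GRing.Zmodule.copy right_res S.
HB.instance Definition _ := GRing.Zmodule.copy left_res S.

Definition right_scale (r : R) (s : right_res) : right_res := (s : S) * f r.
Definition left_scale (r : R) (s : left_res) : left_res := f r * (s : S).

Lemma right_scaleA a b v :
  right_scale a (right_scale b v) = right_scale (a * b) v.
Proof. by rewrite /right_scale -mulrA -rmorphM mulrC. Qed.
Lemma right_scale1 : left_id 1 right_scale.
Proof. by move=> v; rewrite /right_scale rmorph1 mulr1. Qed.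
Lemma right_scaleDr : right_distributive right_scale +%R.
Proof. by move=> a u v; rewrite /right_scale -mulrDl. Qed.
Lemma right_scaleDl v : {morph right_scale^~ v : a b / a + b}.
Proof. by move=> a b; rewrite /right_scale rmorphD mulrDr. Qed.
HB.instance Definition _ := GRing.Zmodule_isLmodule.Build R right_res
  right_scaleA right_scale1 right_scaleDr right_scaleDl.

Lemma left_scaleA a b v : left_scale a (left_scale b v) = left_scale (a * b) v.
Proof. by rewrite /left_scale mulrA -rmorphM. Qed.
Lemma left_scale1 : left_id 1 left_scale.
Proof. by move=> v; rewrite /left_scale rmorph1 mul1r. Qed.
Lemma left_scaleDr : right_distributive left_scale +%R.
Proof. by move=> a u v; rewrite /left_scale -mulrDr. Qed.
Lemma left_scaleDl v : {morph left_scale^~ v : a b / a + b}.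
Proof. by move=> a b; rewrite /left_scale rmorphD mulrDl. Qed.
HB.instance Definition _ := GRing.Zmodule_isLmodule.Build R left_res
  left_scaleA left_scale1 left_scaleDr left_scaleDl.

End Restriction.

Definition ring_epi (R S : pzRingType) (f : {rmorphism R -> S}) : Prop :=
  forall (T : pzRingType) (g h : {rmorphism S -> T}), g \o f =1 h \o f -> g =1 h.

Definition homological_epi (R : comPzRingType) (S : pzRingType)
    (f : {rmorphism R -> S}) : Prop :=
  ring_epi f /\
  forall i, (1 <= i)%N -> Tor_zero i (right_res f) (left_res f).

Record homEpi (R : comPzRingType) := HomEpi {
  he_ring : pzRingType;
  he_map :> {rmorphism R -> he_ring};
  heP : homological_epi he_map }.

Definition he_equiv (R : comPzRingType) (f g : homEpi R) : Prop :=
  exists phi : {rmorphism he_ring f -> he_ring g},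
    bijective phi /\ phi \o f =1 g.

Definition he_class (R : comPzRingType) (f : homEpi R) : homEpi R -> Prop :=
  fun g => he_equiv f g.

Record homEpiClass (R : comPzRingType) := HomEpiClass {
  hec_pred :> homEpi R -> Prop;
  hecP : exists f, hec_pred = he_class f }.

Definition hec (R : comPzRingType) (f : homEpi R) : homEpiClass R :=
  HomEpiClass (ex_intro _ f erefl).

Section EpiCommutative.
Variables (S : pzRingType) (m : S).

(* s |-> (s, s m - m s) into the trivial extension, inside 2 x 2 matrices *)
Definition conj_mx (s : S) : 'M[S]_2 :=
  \matrix_(i, j) (if i == j then s else if (i < j)%N then s * m - m * s else 0).

Lemma conj_mx_zmod_morphism : zmod_morphism conj_mx.
Proof.
move=> a b; apply/matrixP => i j; rewrite !mxE.
case: (i == j) => //; case: (i < j)%N; last by rewrite subr0.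
by rewrite mulrBl mulrBr !opprD !opprK addrACA.
Qed.

Lemma conj_mx_monoid_morphism : monoid_morphism conj_mx.
Proof.
split=> [|a b]; apply/matrixP => i j; rewrite !mxE.
  by rewrite mul1r mulr1 subrr; case: (i == j); case: (i < j)%N.
rewrite !big_ord_recl big_ord0 !mxE.
case: i => [[|[|//]] hi]; case: j => [[|[|//]] hj]; rewrite -!val_eqE /=
  ?mulr0 ?mul0r ?addr0 ?add0r //.
by rewrite mulrBr mulrBl !mulrA addrA subrK.
Qed.

HB.instance Definition _ :=
  GRing.isZmodMorphism.Build S 'M[S]_2 conj_mx conj_mx_zmod_morphism.
HB.instance Definition _ :=
  GRing.isMonoidMorphism.Build S 'M[S]_2 conj_mx conj_mx_monoid_morphism.

End EpiCommutative.

Lemma epi_centralizer (R S : pzRingType) (f : {rmorphism R -> S}) (m : S) :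
  ring_epi f -> (forall r, f r * m = m * f r) -> forall s, s * m = m * s.
Proof.
move=> fE fm s.
have /(_ s)/matrixP/(_ ord0 ord_max) : conj_mx m =1 conj_mx (0 : S).
  by apply: fE => r /=; apply/matrixP => i j; rewrite !mxE fm subrr mulr0 mul0r
    subrr.
by rewrite !mxE /= mulr0 mul0r subrr => /eqP; rewrite subr_eq0 => /eqP.
Qed.

Lemma epi_mulrC (R : comPzRingType) (S : pzRingType) (f : {rmorphism R -> S}) :
  ring_epi f -> commutative (@GRing.mul S).
Proof.
move=> fE x y; apply: (epi_centralizer fE) => r.
apply/esym; apply: (epi_centralizer fE) => r'.
by rewrite -!rmorphM mulrC.
Qed.

(* An epimorphism out of a commutative ring has a commutative target;
   cod f is the target of f with that commutative ring structure.            *)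
Section Cod.
Variables (R : comPzRingType) (f : homEpi R).
Definition cod : Type := he_ring f.
HB.instance Definition _ := GRing.PzRing.copy cod (he_ring f).
Lemma cod_mulrC : commutative (@GRing.mul cod).
Proof. exact: epi_mulrC (heP f).1. Qed.
HB.instance Definition _ := GRing.PzRing_hasCommutativeMul.Build cod cod_mulrC.
End Cod.

Section MaxCompl.
Variables (A : comPzRingType) (n : set A) (nmax : is_maximal_ideal n).

Lemma max_compl1 : (~` n) 1.
Proof.
case: nmax => -[_ _ nM] nT _ n1; apply: nT.
by apply/seteqP; split=> // x _; rewrite -[x]mulr1; exact: nM.
Qed.

Lemma max_complM x y : (~` n) x -> (~` n) y -> (~` n) (x * y).
Proof.
case: nmax => -[n0 nD nM] nT nX nx ny nxy.
pose J : set A := [set z | exists a b, n b /\ z = a * x + b].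
have JI : is_ideal J.
  split.
  - by exists 0, 0; split=> //; rewrite mul0r addr0.
  - move=> _ _ [a [b [nb ->]]] [a' [b' [nb' ->]]].
    by exists (a + a'), (b + b'); split; [exact: nD | ring].
  - move=> c _ [a [b [nb ->]]].
    by exists (c * a), (c * b); split; [exact: nM | ring].
have [|eJ|eJ] := nX J JI.
- by move=> z nz; exists 0, z; split=> //; rewrite mul0r add0r.
- by apply: nx; rewrite -eJ; exists 1, 0; split=> //; rewrite mul1r addr0.
have [a [b [nb e1]]] : J 1 by rewrite eJ.
apply: ny; rewrite -[y]mul1r e1.
have -> : (a * x + b) * y = a * (x * y) + y * b by ring.
by apply: nD; exact: nM.
Qed.

Definition max_compl : multset A := MultSet max_compl1 max_complM.

End MaxCompl.

Definition is_prime (R : comPzRingType) (p : set R) : Prop :=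
  [/\ is_ideal p, ~ p 1 & forall x y, p (x * y) -> p x \/ p y].

Section Intervals.
Variable R : idomainType.

Record primeIdeal := Prime { pset : set R; psetP : is_prime pset }.
Implicit Types p q : primeIdeal.

Lemma prime_ext p q : pset p = pset q -> p = q.
Proof.
case: p q => [P hP] [Q hQ] /= e; case: _ / e in hQ *.
by rewrite (Prop_irrelevance hP hQ).
Qed.

Record admInterval := Interval {
  lo : primeIdeal;
  hi : primeIdeal;
  lo_hi : pset lo `<=` pset hi;
  lo_idem : ideal_mul (pset lo) (pset lo) = pset lo }.

Lemma interval_ext D E : lo D = lo E -> hi D = hi E -> D = E.
Proof.
case: D E => [i p h e] [i' p' h' e'] /= ei ep; case: _ / ei in h' e' *.
case: _ / ep in h' *.
by rewrite (Prop_irrelevance h h') (Prop_irrelevance e e').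
Qed.

Definition interval_lt (D E : admInterval) : Prop := pset (hi D) `<` pset (lo E).
Definition interval_le (D E : admInterval) : Prop := D = E \/ interval_lt D E.

Lemma interval_ltxx D : ~ interval_lt D D.
Proof. by case=> _; apply; exact: lo_hi. Qed.

Lemma interval_lt_trans D E F :
  interval_lt D E -> interval_lt E F -> interval_lt D F.
Proof.
move=> [h n] [h' n']; split.
  exact: subset_trans h (subset_trans (@lo_hi E) h').
by move=> h2; apply: n; apply: subset_trans (subset_trans h' h2); exact: lo_hi.
Qed.

Lemma interval_le_trans D E F :
  interval_le D E -> interval_le E F -> interval_le D F.
Proof.
move=> [->//|h] [<-|h']; first by right.
by right; exact: interval_lt_trans h h'.
Qed.

Lemma interval_le_lt D E : interval_le D E -> ~ interval_lt E D.
Proof.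
by move=> [->|h h']; [|move: (interval_lt_trans h h')]; exact: interval_ltxx.
Qed.

Lemma interval_le_lo D E : interval_le D E -> pset (lo D) `<=` pset (lo E).
Proof. by move=> [->//|[h _]]; apply: subset_trans h; exact: lo_hi. Qed.

Lemma interval_le_hi D E : interval_le D E -> pset (hi D) `<=` pset (hi E).
Proof. by move=> [->//|[h _]]; apply: subset_trans h _; exact: lo_hi. Qed.

Definition subchain (I : set admInterval) : Prop :=
  forall D E, I D -> I E -> interval_le D E \/ interval_le E D.

Definition minimal_in (A : set admInterval) (D : admInterval) : Prop :=
  A D /\ forall E, A E -> ~ interval_lt E D.
Definition maximal_in (A : set admInterval) (D : admInterval) : Prop :=
  A D /\ forall E, A E -> ~ interval_lt D E.

Definition C1 (I : set admInterval) : Prop :=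
  forall A : set admInterval, A `<=` I -> A !=set0 ->
    (~ exists D, minimal_in A D) ->
    exists2 D, I D & pset (hi D) = \bigcap_(E in A) pset (hi E).

Definition C2 (I : set admInterval) : Prop :=
  forall A : set admInterval, A `<=` I -> A !=set0 ->
    (~ exists D, maximal_in A D) ->
    exists2 D, I D & pset (lo D) = \bigcup_(E in A) pset (lo E).

Definition C3 (I : set admInterval) : Prop :=
  forall D0 D1, I D0 -> I D1 -> interval_lt D0 D1 ->
    exists D D', [/\ I D, I D', interval_le D0 D, interval_lt D D' &
      interval_le D' D1 /\
      ~ exists E, [/\ I E, interval_lt D E & interval_lt E D']].

Record goodChain := GoodChain {
  gc_set :> set admInterval;
  gc_chain : subchain gc_set;
  gc_C1 : C1 gc_set;
  gc_C2 : C2 gc_set;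
  gc_C3 : C3 gc_set }.

Definition prime_pred (p : primeIdeal) : {pred R} := fun x => `[< pset p x >].

Lemma prime_predE p x : (x \in prime_pred p) = `[< pset p x >].
Proof. by []. Qed.

Section PrimePred.
Variable p : primeIdeal.

Lemma prime_pred_idealr : idealr_closed (prime_pred p).
Proof.
case: (psetP p) => -[p0 pD pM] p1 _; split; rewrite ?prime_predE.
- exact/asboolP.
- exact/asboolPn.
move=> a x y; rewrite !prime_predE => /asboolP px /asboolP py; apply/asboolP.
by apply: pD => //; exact: pM.
Qed.

Lemma prime_pred_prime : prime_idealr_closed (prime_pred p).
Proof.
case: (psetP p) => _ _ pP x y; rewrite !prime_predE => /asboolP /pP[] h.
  by apply/orP; left; apply/asboolP.
by apply/orP; right; apply/asboolP.
Qed.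

HB.instance Definition _ := isIdealr.Build R (prime_pred p) prime_pred_idealr.
HB.instance Definition _ :=
  isPrimeIdealrClosed.Build R (prime_pred p) prime_pred_prime.

End PrimePred.

Definition prime_quot (p : primeIdeal) : comNzRingType := {ideal_quot (prime_pred p)}.

Definition to_quot (p : primeIdeal) : {rmorphism R -> prime_quot p} :=
  \pi_{ideal_quot (prime_pred p)}.

Lemma to_quot_eq0 p x : to_quot p x = 0 <-> pset p x.
Proof.
rewrite -(rmorph0 (to_quot p)); split=> [/eqP|px].
  by rewrite -Quotient.idealrBE subr0 prime_predE => /asboolP.
by apply/eqP; rewrite -Quotient.idealrBE subr0 prime_predE; apply/asboolP.
Qed.

Lemma to_quot_eq p x y : to_quot p x = to_quot p y <-> pset p (x - y).
Proof.
rewrite -to_quot_eq0 rmorphB.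
by split=> [->|/eqP]; [rewrite subrr | rewrite subr_eq0 => /eqP].
Qed.

Lemma to_quot_repr p (x : prime_quot p) : to_quot p (repr x) = x.
Proof. exact: reprK. Qed.

Section LocQuot.
Variables j q : primeIdeal.

Let T : set (prime_quot j) :=
  [set x | exists2 s, ~ pset q s & x = to_quot j s].

Let T1 : T 1.
Proof. by exists 1; [case: (psetP q) | rewrite rmorph1]. Qed.

Let TM x y : T x -> T y -> T (x * y).
Proof.
move=> [s sq ->] [t tq ->]; exists (s * t); last by rewrite rmorphM.
by case: (psetP q) => _ _ qP /qP[].
Qed.

Definition prime_compl : multset (prime_quot j) := MultSet T1 TM.

(* R_q / j, in the form (R / j)_q; used for j \subseteq q. *)
Definition RQ : comPzRingType := loc prime_compl.

Definition to_RQ : {rmorphism R -> RQ} := to_loc prime_compl \o to_quot j.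

End LocQuot.

Definition quot_map (i j : primeIdeal) (ij : pset i `<=` pset j) (x : prime_quot i) :
  prime_quot j := to_quot j (repr x).

Section QuotMap.
Variables (i j : primeIdeal) (ij : pset i `<=` pset j).

Notation quot_map := (quot_map ij).

Lemma quot_mapE r : quot_map (to_quot i r) = to_quot j r.
Proof. by apply/to_quot_eq/ij/to_quot_eq; rewrite to_quot_repr. Qed.

Lemma quot_map_zmod_morphism : zmod_morphism quot_map.
Proof.
move=> x y; rewrite -[x]to_quot_repr -[y]to_quot_repr -rmorphB !quot_mapE.
exact: rmorphB.
Qed.

Lemma quot_map_monoid_morphism : monoid_morphism quot_map.
Proof.
split=> [|x y]; first by rewrite -(rmorph1 (to_quot i)) quot_mapE rmorph1.
rewrite -[x]to_quot_repr -[y]to_quot_repr -rmorphM !quot_mapE.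
exact: rmorphM.
Qed.

HB.instance Definition _ := GRing.isZmodMorphism.Build
  (prime_quot i) (prime_quot j) quot_map quot_map_zmod_morphism.
HB.instance Definition _ := GRing.isMonoidMorphism.Build
  (prime_quot i) (prime_quot j) quot_map quot_map_monoid_morphism.

End QuotMap.

Section Canonical.
Variables (i n j q : primeIdeal).
Variables (ij : pset i `<=` pset j) (qn : pset q `<=` pset n).

Lemma quot_map_compl s : prime_compl i n s -> prime_compl j q (quot_map ij s).
Proof.
by move=> [r rn ->]; exists r; [move/qn | rewrite quot_mapE].
Qed.

(* The canonical map R_n / i -> R_q / j for i \subseteq j and q \subseteq n *)
Definition RQ_map : {rmorphism RQ i n -> RQ j q} := loc_map quot_map_compl.

Lemma RQ_map_to_RQ r : RQ_map (to_RQ i n r) = to_RQ j q r.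
Proof.
rewrite /= /to_loc loc_mapE; apply/frac_eq; exists 1; first exact: mset1.
by rewrite !denE /= !quot_mapE !rmorph1.
Qed.

End Canonical.

Lemma RQ_map_comp (i n j q k m : primeIdeal)
    (ij : pset i `<=` pset j) (qn : pset q `<=` pset n)
    (jk : pset j `<=` pset k) (mq : pset m `<=` pset q)
    (ik : pset i `<=` pset k) (mn : pset m `<=` pset n) (z : RQ i n) :
  RQ_map jk mq (RQ_map ij qn z) = RQ_map ik mn z.
Proof.
have [a [s ->]] := fracP z; rewrite /= !loc_mapE; apply/frac_eq.
have E x : quot_map jk (quot_map ij x) = quot_map ik x.
  by rewrite -[x]to_quot_repr !quot_mapE.
by exists 1; [exact: mset1 | rewrite !val_map_den /= !E].
Qed.

Section DProd.
Variables (X : Type) (A : X -> comPzRingType).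

Definition dprod : Type := forall x, A x.

HB.instance Definition _ := gen_eqMixin dprod.
HB.instance Definition _ := gen_choiceMixin dprod.

Definition dprod_add (u v : dprod) : dprod := fun x => u x + v x.
Definition dprod_opp (u : dprod) : dprod := fun x => - u x.
Definition dprod_zero : dprod := fun x => 0.
Definition dprod_mul (u v : dprod) : dprod := fun x => u x * v x.
Definition dprod_one : dprod := fun x => 1.

Lemma dprod_ext (u v : dprod) : (forall x, u x = v x) -> u = v.
Proof. exact: functional_extensionality_dep. Qed.

Lemma dprod_addA : associative dprod_add.
Proof. by move=> u v w; apply: dprod_ext => x; exact: addrA. Qed.
Lemma dprod_addC : commutative dprod_add.
Proof. by move=> u v; apply: dprod_ext => x; exact: addrC. Qed.
Lemma dprod_add0 : left_id dprod_zero dprod_add.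
Proof. by move=> u; apply: dprod_ext => x; exact: add0r. Qed.
Lemma dprod_addN : left_inverse dprod_zero dprod_opp dprod_add.
Proof. by move=> u; apply: dprod_ext => x; exact: addNr. Qed.
HB.instance Definition _ :=
  GRing.isZmodule.Build dprod dprod_addA dprod_addC dprod_add0 dprod_addN.

Lemma dprod_mulA : associative dprod_mul.
Proof. by move=> u v w; apply: dprod_ext => x; exact: mulrA. Qed.
Lemma dprod_mulC : commutative dprod_mul.
Proof. by move=> u v; apply: dprod_ext => x; exact: mulrC. Qed.
Lemma dprod_mul1 : left_id dprod_one dprod_mul.
Proof. by move=> u; apply: dprod_ext => x; exact: mul1r. Qed.
Lemma dprod_mulDl : left_distributive dprod_mul +%R.
Proof. by move=> u v w; apply: dprod_ext => x; exact: mulrDl. Qed.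
HB.instance Definition _ := GRing.Zmodule_isComPzRing.Build dprod
  dprod_mulA dprod_mulC dprod_mul1 dprod_mulDl.

End DProd.

(* The product of the rings R_q / j over the intervals [j, q] in I *)
Definition RI (I : set admInterval) : comPzRingType :=
  dprod (fun D : set_type I => RQ (lo (\val D)) (hi (\val D))).

Definition sub_index (I J : set admInterval) (JI : J `<=` I) (D : set_type J) :
  set_type I := SigSub (mem_set (JI _ (set_valP D))).

Lemma RI_irr (I : set admInterval) (x : RI I) D (h h' : D \in I) :
  x (SigSub h) = x (SigSub h').
Proof. by rewrite (Prop_irrelevance h h'). Qed.

Definition RI_restr (I J : set admInterval) (JI : J `<=` I) (x : RI I) : RI J :=
  fun D => x (sub_index JI D).

(* A subchain with a minimal and a maximal element *)
Record bchain := BChain {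
  bc_set :> set admInterval;
  bc_chain : subchain bc_set;
  bc_min : admInterval;
  bc_max : admInterval;
  bc_minP : minimal_in bc_set bc_min;
  bc_maxP : maximal_in bc_set bc_max }.

Lemma bc_min_le (B : bchain) D : bc_set B D -> interval_le (bc_min B) D.
Proof.
move=> BD; have [Bm mP] := bc_minP B.
case: (bc_chain Bm BD) => [//|[->|h]]; first by left.
by case: (mP D BD).
Qed.

Lemma bc_max_ge (B : bchain) D : bc_set B D -> interval_le D (bc_max B).
Proof.
move=> BD; have [Bm mP] := bc_maxP B.
case: (bc_chain BD Bm) => [//|[->|h]]; first by left.
by case: (mP D BD).
Qed.

Section GMap.
Variable B : bchain.

(* R_n / i for i the lower end of the minimal element of B and n the upper end
   of its maximal element                                                     *)
Definition hullR : comPzRingType := RQ (lo (bc_min B)) (hi (bc_max B)).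

Lemma hull_lo (D : set_type (bc_set B)) :
  pset (lo (bc_min B)) `<=` pset (lo (\val D)).
Proof. exact/interval_le_lo/bc_min_le/set_valP. Qed.

Lemma hull_hi (D : set_type (bc_set B)) :
  pset (hi (\val D)) `<=` pset (hi (bc_max B)).
Proof. exact/interval_le_hi/bc_max_ge/set_valP. Qed.

Definition gmap (y : hullR) : RI (bc_set B) :=
  fun D => RQ_map (@hull_lo D) (@hull_hi D) y.

Lemma gmap_zmod_morphism : zmod_morphism gmap.
Proof. by move=> x y; apply: dprod_ext => D; exact: rmorphB. Qed.

Lemma gmap_monoid_morphism : monoid_morphism gmap.
Proof.
split=> [|x y]; apply: dprod_ext => D; first exact: rmorph1.
exact: rmorphM.
Qed.

HB.instance Definition _ :=
  GRing.isZmodMorphism.Build hullR (RI (bc_set B)) gmap gmap_zmod_morphism.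
HB.instance Definition _ :=
  GRing.isMonoidMorphism.Build hullR (RI (bc_set B)) gmap gmap_monoid_morphism.

End GMap.

Record chainPartition (B : bchain) := Partition {
  pt_n : nat;
  pt_block : 'I_pt_n.+1 -> bchain;
  pt_cover : bc_set B = \bigcup_l bc_set (pt_block l);
  pt_disj : trivIset setT (fun l => bc_set (pt_block l));
  pt_lt : forall j l : 'I_pt_n.+1, (j < l)%N -> forall D E,
    bc_set (pt_block j) D -> bc_set (pt_block l) E -> interval_lt D E }.

#[global] Arguments pt_block {B} P l : rename.

Lemma pt_sub (B : bchain) (P : chainPartition B) l :
  bc_set (pt_block P l) `<=` bc_set B.
Proof. by rewrite (pt_cover P) => D ?; exists l. Qed.

(* The image of g_(I_0, ..., I_n): the obvious isomorphism from the product of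
   the R_(I_l) to R_I is inverse to x |-> (RI_restr x)_l.                     *)
Definition im_partition (B : bchain) (P : chainPartition B) : set (RI (bc_set B)) :=
  [set x | exists y : forall l, hullR (pt_block P l),
     forall l, RI_restr (@pt_sub B P l) x = gmap (y l)].

Definition dunion (B : bchain) : set (RI (bc_set B)) :=
  [set x | exists P : chainPartition B, im_partition P x].

Lemma pt_convex (B : bchain) (P : chainPartition B) l D E F :
  bc_set (pt_block P l) D -> bc_set (pt_block P l) F -> bc_set B E ->
  interval_le D E -> interval_le E F -> bc_set (pt_block P l) E.
Proof.
move=> lD lF + DE EF; rewrite (pt_cover P) => -[k _ kE].
case: (ltngtP k l) => [kl|lk|/val_inj <- //].
  by case: (interval_le_lt DE (pt_lt kl kE lD)).
by case: (interval_le_lt EF (pt_lt lk lF kE)).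
Qed.

Lemma pt_meet (B : bchain) (P Q : chainPartition B) l m D :
  bc_set (pt_block P l) D -> bc_set (pt_block Q m) D ->
  exists C : bchain,
    bc_set C = bc_set (pt_block P l) `&` bc_set (pt_block Q m).
Proof.
move=> lD mD; set p := pt_block P l; set q := pt_block Q m.
have pB : bc_set p `<=` bc_set B by exact: pt_sub.
have qB : bc_set q `<=` bc_set B by exact: pt_sub.
pose M := bc_set p `&` bc_set q.
have Mc : subchain M by move=> E F [pE _] [pF _]; exact: (bc_chain pE pF).
have [pm _] := bc_minP p; have [qm _] := bc_minP q.
have [pM _] := bc_maxP p; have [qM _] := bc_maxP q.
have [m0 m0P] : exists E, minimal_in M E.
  have := bc_chain (pB _ pm) (qB _ qm); case=> h.
    exists (bc_min q); split; last by move=> E [_ /bc_min_le/interval_le_lt].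
    split=> //; apply: (pt_convex pm lD (qB _ qm) h); exact: bc_min_le.
  exists (bc_min p); split; last by move=> E [/bc_min_le/interval_le_lt].
  split=> //; apply: (pt_convex qm mD (pB _ pm) h); exact: bc_min_le.
have [m1 m1P] : exists E, maximal_in M E.
  have := bc_chain (pB _ pM) (qB _ qM); case=> h.
    exists (bc_max p); split; last by move=> E [/bc_max_ge/interval_le_lt].
    split=> //; apply: (pt_convex mD qM (pB _ pM) _ h); exact: bc_max_ge.
  exists (bc_max q); split; last by move=> E [_ /bc_max_ge/interval_le_lt].
  split=> //; apply: (pt_convex lD pM (qB _ qM) _ h); exact: bc_max_ge.
by exists (BChain Mc m0P m1P).
Qed.

Lemma pt_refine (B : bchain) (P Q : chainPartition B) :
  exists C : chainPartition B, forall k, exists l m,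
    bc_set (pt_block C k) `<=` bc_set (pt_block P l) /\
    bc_set (pt_block C k) `<=` bc_set (pt_block Q m).
Proof.
set a := (pt_n P).+1; set b := (pt_n Q).+1.
pose l_ k : 'I_a := inord (k %/ b); pose m_ k : 'I_b := inord (k %% b).
pose M k := bc_set (pt_block P (l_ k)) `&` bc_set (pt_block Q (m_ k)).
pose s := [seq k <- iota 0 (a * b) | `[< M k !=set0 >]].
have l_val k : (k < a * b)%N -> l_ k = (k %/ b)%N :> nat.
  by move=> h; rewrite /l_ inordK // ltn_divLR.
have m_val k : m_ k = (k %% b)%N :> nat by rewrite /m_ inordK // ltn_pmod.
have M_lt j k D E : (j < k < a * b)%N -> M j D -> M k E -> interval_lt D E.
  move=> /andP[jk kab] [lD mD] [lE mE].
  have jab := ltn_trans jk kab.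
  have : (j %/ b <= k %/ b)%N by rewrite leq_div2r // ltnW.
  rewrite leq_eqVlt => /orP[/eqP e|lt]; last first.
    by apply: (pt_lt (j:=l_ j) (l:=l_ k)) lD lE; rewrite !l_val.
  apply: (pt_lt (j:=m_ j) (l:=m_ k)) mD mE; rewrite !m_val.
  by move: jk; rewrite {1}(divn_eq j b) {1}(divn_eq k b) e ltn_add2l.
have M_cover D : bc_set B D -> exists2 k, k \in s & M k D.
  rewrite {1}(pt_cover P) => -[l _ lD].
  have : bc_set B D by rewrite (pt_cover P); exists l.
  rewrite (pt_cover Q) => -[m _ mD].
  pose k := (l * b + m)%N.
  have kb : (k < a * b)%N.
    apply: (@leq_trans (l.+1 * b)); first by rewrite mulSnr ltn_add2l.
    by rewrite leq_mul2r ltn_ord orbT.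
  have lk : l_ k = l.
    by apply/val_inj; rewrite /= l_val // /k divnMDl // divn_small ?addn0.
  have mk : m_ k = m by apply/val_inj; rewrite /= m_val /k modnMDl modn_small.
  have kD : M k D by rewrite /M lk mk.
  exists k => //; rewrite mem_filter mem_iota add0n leq0n kb !andbT.
  by apply/asboolP; exists D.
have s_gt0 : (0 < size s)%N.
  have [k] := M_cover _ (bc_minP B).1; case: (s) => //.
have s_nth k : (k < size s)%N -> nth 0%N s k \in s by exact: mem_nth.
have ss : (size s).-1.+1 = size s by rewrite prednK.
have ord_s (k : 'I_(size s).-1.+1) : (k < size s)%N.
  exact: leq_trans (ltn_ord k) (eq_leq ss).
have blk (k : 'I_(size s).-1.+1) : {C : bchain | bc_set C = M (nth 0%N s k)}.
  apply: cid; have := s_nth k (ord_s k).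
  by rewrite mem_filter => /andP[/asboolP[D [lD mD]] _]; exact: pt_meet lD mD.
have s_lt (j k : 'I_(size s).-1.+1) : (j < k)%N ->
    (nth 0 s j < nth 0 s k < a * b)%N.
  move=> jk; have := s_nth k (ord_s k).
  rewrite mem_filter mem_iota add0n => /andP[_ /andP[_ ->]]; rewrite andbT.
  have ss_lt : sorted ltn s.
    by apply: sorted_filter (iota_ltn_sorted _ _); exact: ltn_trans.
  by apply: (sorted_ltn_nth ltn_trans 0%N ss_lt) jk; rewrite inE ord_s.
have lt (j k : 'I_(size s).-1.+1) : (j < k)%N -> forall D E,
    bc_set (sval (blk j)) D -> bc_set (sval (blk k)) E -> interval_lt D E.
  move=> jk D E; rewrite (svalP (blk j)) (svalP (blk k)).
  exact: M_lt (s_lt j k jk).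
have disj : trivIset setT (fun k => bc_set (sval (blk k))).
  move=> j k _ _ [D [jD kD]]; case: (ltngtP j k) => [jk|kj|/val_inj //].
    by case: (interval_ltxx (lt _ _ jk _ _ jD kD)).
  by case: (interval_ltxx (lt _ _ kj _ _ kD jD)).
have cover : bc_set B = \bigcup_k bc_set (sval (blk k)).
  apply/seteqP; split=> [D /M_cover[k ks kD]|D [k _]]; last first.
    by rewrite (svalP (blk k)) => -[/pt_sub].
  have hk : (index k s < (size s).-1.+1)%N by rewrite ss index_mem.
  by exists (Ordinal hk) => //; rewrite (svalP (blk _)) /= nth_index.
exists (Partition cover disj lt) => k /=.
exists (l_ (nth 0%N s k)), (m_ (nth 0%N s k)).
by rewrite (svalP (blk k)); split=> D [].
Qed.

Lemma im_refine (B : bchain) (P C : chainPartition B) (x : RI (bc_set B)) :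
  (forall k, exists l, bc_set (pt_block C k) `<=` bc_set (pt_block P l)) ->
  im_partition P x -> im_partition C x.
Proof.
move=> CP [y yP].
suff h k : {z : hullR (pt_block C k) | RI_restr (@pt_sub B C k) x = gmap z}.
  by exists (fun k => sval (h k)) => k; exact: (svalP (h k)).
apply: cid; have [l kl] := CP k.
set c := pt_block C k in kl *; set p := pt_block P l in kl.
have lo_pc : pset (lo (bc_min p)) `<=` pset (lo (bc_min c)).
  by apply/interval_le_lo/bc_min_le; apply: kl; exact: (bc_minP c).1.
have hi_cp : pset (hi (bc_max c)) `<=` pset (hi (bc_max p)).
  by apply/interval_le_hi/bc_max_ge; apply: kl; exact: (bc_maxP c).1.
exists (RQ_map lo_pc hi_cp (y l)); apply: dprod_ext => D.
have := congr1 (fun z : RI (bc_set p) => z (sub_index kl D)) (yP l).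
rewrite /RI_restr /gmap => e.
rewrite (RQ_map_comp _ _ _ _ (@hull_lo p (sub_index kl D))
  (@hull_hi p (sub_index kl D))) -e.
exact: RI_irr.
Qed.

Lemma trivial_partition_proof (B : bchain) :
  [/\ bc_set B = \bigcup_(l : 'I_1) bc_set B,
      trivIset setT (fun _ : 'I_1 => bc_set B) &
      forall j l : 'I_1, (j < l)%N -> forall D E,
        bc_set B D -> bc_set B E -> interval_lt D E].
Proof.
split=> [|j l _ _ _|j l]; last by rewrite (ord1 j) (ord1 l).
  by apply/seteqP; split=> [D BD|D []//]; exists ord0.
by rewrite (ord1 j) (ord1 l).
Qed.

Definition trivial_partition (B : bchain) : chainPartition B :=
  let: And3 c d l := trivial_partition_proof B in Partition c d l.

Lemma im_gmap (B : bchain) (y : hullR B) : dunion (gmap y).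
Proof.
exists (trivial_partition B); rewrite /trivial_partition.
case: (trivial_partition_proof B) => c d l.
exists (fun _ => y) => k; apply: dprod_ext => D; rewrite /RI_restr /=.
by congr (RQ_map _ _ y); exact: Prop_irrelevance.
Qed.

Definition dunion_pred (B : bchain) : {pred RI (bc_set B)} :=
  fun x => `[< dunion x >].

Lemma dunion_common (B : bchain) (x y : RI (bc_set B)) :
  dunion x -> dunion y ->
  exists C : chainPartition B, im_partition C x /\ im_partition C y.
Proof.
move=> [P Px] [Q Qy]; have [C CP] := pt_refine P Q; exists C; split.
  by apply: im_refine Px => k; have [l [m [h _]]] := CP k; exists l.
by apply: im_refine Qy => k; have [l [m [_ h]]] := CP k; exists m.
Qed.

Lemma dunion_subring_closed (B : bchain) : subring_closed (@dunion_pred B).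
Proof.
split=> [|x y /asboolP xB /asboolP yB|x y /asboolP xB /asboolP yB];
  apply/asboolP.
- by rewrite -(rmorph1 (@gmap B)); exact: im_gmap.
- have [C [[u uP] [v vP]]] := dunion_common xB yB; exists C.
  exists (fun l => u l - v l) => l; rewrite rmorphB /=.
  set r := @RI_restr _ _ (@pt_sub B C l).
  by apply: (@etrans _ _ (r x - r y)); [exact: dprod_ext | rewrite /r uP vP].
- have [C [[u uP] [v vP]]] := dunion_common xB yB; exists C.
  exists (fun l => u l * v l) => l; rewrite rmorphM /=.
  set r := @RI_restr _ _ (@pt_sub B C l).
  by apply: (@etrans _ _ (r x * r y)); [exact: dprod_ext | rewrite /r uP vP].
Qed.

(* dlim is the ring R_(I), fI the map f_(I), gmap the map g_I. *)
Record dlim (B : bchain) := DLim {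
  dlim_val : RI (bc_set B);
  dlimP : dlim_val \in @dunion_pred B }.

HB.instance Definition _ (B : bchain) := [isSub for @dlim_val B].
HB.instance Definition _ (B : bchain) := [Choice of dlim B by <:].
HB.instance Definition _ (B : bchain) :=
  GRing.SubChoice_isSubComPzRing.Build (RI (bc_set B)) (@dunion_pred B) (dlim B)
    (dunion_subring_closed B).

Section FI.
Variable B : bchain.

Lemma fI_subproof (r : R) :
  gmap (to_RQ (lo (bc_min B)) (hi (bc_max B)) r) \in @dunion_pred B.
Proof. by apply/asboolP; exact: im_gmap. Qed.

Definition fI (r : R) : dlim B := DLim (fI_subproof r).

Lemma fI_zmod_morphism : zmod_morphism fI.
Proof. by move=> x y; apply/val_inj; rewrite /= !rmorphB. Qed.

Lemma fI_monoid_morphism : monoid_morphism fI.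
Proof. by split=> [|x y]; apply/val_inj; rewrite /= ?rmorph1 ?rmorphM. Qed.

HB.instance Definition _ :=
  GRing.isZmodMorphism.Build R (dlim B) fI fI_zmod_morphism.
HB.instance Definition _ :=
  GRing.isMonoidMorphism.Build R (dlim B) fI fI_monoid_morphism.

End FI.

Lemma gc_min (I : goodChain) : I !=set0 -> exists D, minimal_in I D.
Proof.
move=> I0; apply: contrapT => noD; apply: (noD).
have [D ID De] := gc_C1 (@subset_refl _ _) I0 noD.
exists D; split=> // E IE [_]; apply; apply: subset_trans (@lo_hi D) _.
by rewrite De => x /(_ E IE).
Qed.

Lemma gc_max (I : goodChain) : I !=set0 -> exists D, maximal_in I D.
Proof.
move=> I0; apply: contrapT => noD; apply: (noD).
have [D ID De] := gc_C2 (@subset_refl _ _) I0 noD.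
exists D; split=> // E IE [_]; apply; apply: subset_trans _ (@lo_hi D).
by rewrite De => x Ex; exists E.
Qed.

Definition gc_bchain (I : goodChain) (I0 : I !=set0) : bchain :=
  BChain (@gc_chain I) (svalP (cid (gc_min I0))) (svalP (cid (gc_max I0))).

(* The kernel of R -> S -> S_n, where S_n = loc (max_compl nmax) *)
Definition ker_loc (f : homEpi R) (n : set (cod f)) (nmax : is_maximal_ideal n) :
  set R := [set r | to_loc (max_compl nmax) (f r : cod f) = 0].

(* The set I(f) *)
Definition intervals_of (f : homEpi R) : set admInterval :=
  [set D | exists (n : set (cod f)) (nmax : is_maximal_ideal n),
     pset (hi D) = [set r | n (f r)] /\ pset (lo D) = ker_loc nmax].

End Intervals.

Section ZeroRing.
Variable R : comPzRingType.

Definition zero_ring : comPzRingType := dprod (fun _ : Empty_set => R).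

Definition to_zero (r : R) : zero_ring := 0.

Lemma zero_ringE (x y : zero_ring) : x = y.
Proof. by apply: dprod_ext; case. Qed.

Lemma to_zero_zmod_morphism : zmod_morphism to_zero.
Proof. by move=> x y; exact: zero_ringE. Qed.

Lemma to_zero_monoid_morphism : monoid_morphism to_zero.
Proof. by split=> [|x y]; exact: zero_ringE. Qed.

HB.instance Definition _ :=
  GRing.isZmodMorphism.Build R zero_ring to_zero to_zero_zmod_morphism.
HB.instance Definition _ :=
  GRing.isMonoidMorphism.Build R zero_ring to_zero to_zero_monoid_morphism.

End ZeroRing.

(* Main.v *)
(** Call [f : R -> S] good if it is a ring epimorphism and the annihilator in
    [R] of every element of [S] is an idempotent ideal. Over a valuation domain
    the homological epimorphisms are exactly the good ones: for [Tor_1] one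
    eliminates with pivots, any finite set of coordinates having an element
    that divides the others, and idempotency of the annihilators splits the
    pivot; for higher [Tor] the syzygies are torsion-free.

    For a good [f] and a maximal ideal [n] of [S], the kernel [j] of
    [R -> S_n] is an idempotent prime. An injectivity argument gives an
    [R]-linear map [S_n -> Frac(R/j)] fixing 1; since [f] is an epimorphism,
    [R]-linear maps between [S]-modules are [S]-linear, so this map is a ring
    homomorphism, and [S_n = R_q/j]. Hence [S] embeds in the product of the
    [R_q/j]. The order conditions on [I(f)] follow by producing suitable ideals
    of [S] and the maximal ideals above them. The image of [S] is [R_(I)]: the
    elements of [R_(I)] are generated from [R] by quasi-inverses of elements of
    [R], which exist in [S] because they exist locally; conversely an element of
    [S] is a fraction on a block around each interval, and the idempotents of
    these blocks generate the unit ideal of [S].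

    Conversely [R -> R_(I)] is good, and an interval of [I(f_(I))] outside [I]
    would lie in a gap of [I], contradicting (C1), (C2) or the cut idempotent at
    that gap. *)

Require Import Defs.
From HB Require Import structures.
From mathcomp Require Import all_boot all_order all_algebra.
From mathcomp Require Import boolp classical_sets functions.
From mathcomp Require Import ring.
From mathcomp Require Import freeg.

Set Implicit Arguments.
Unset Strict Implicit.
Unset Printing Implicit Defensive.

Import GRing.Theory.
Local Open Scope ring_scope.
Local Open Scope classical_set_scope.

(** * Valuation domains *)

(** Tor is quantified over all projective resolutions. Its vanishing must therefore be shown for
    arbitrary projective terms, whose coordinates come from a section of a free cover; the converse
    may choose the free resolution on the underlying set of [M] and compare coefficients.

    The test rings of [ring_epi] may be noncommutative. This is what turns linearity into a
    statement on centralizers: an [R]-linear map is an element of an endomorphism ring that commutes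
    with the image of [R].

    The map [S_n -> Frac(R/j)] is not visibly injective. Each of its values is also the value of a
    genuine fraction [f a / f b] of [S_n]; replacing elements by these fractions is an [R]-linear,
    hence [S_n]-linear, map fixing 1, so it is the identity and every element is such a fraction.

    Passage from local to global always has the same shape: the elements of [S] that admit a
    solution form an ideal, and an ideal contained in no maximal ideal contains 1. *)

Lemma valuation_dvd (R : idomainType) (hR : valuation_domain R) (a b : R) :
  (exists c, a = c * b) \/ (exists c, b = c * a).
Proof.
pose I (x : R) : set R := [set y | exists c, y = c * x].
have II x : is_ideal (I x).
  split; first by exists 0; rewrite mul0r.
    by move=> _ _ [c ->] [d ->]; exists (c + d); rewrite mulrDl.
  by move=> d _ [c ->]; exists (d * c); rewrite mulrA.
have mem x : I x x by exists 1; rewrite mul1r.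
by case: (hR _ _ (II a) (II b)) => h; [left | right]; exact: h (mem _).
Qed.

Lemma valuation_gcd (R : idomainType) (hR : valuation_domain R) (T : eqType)
    (f : T -> R) (l : seq T) :
  l != [::] ->
  exists2 x, x \in l & forall y, y \in l -> exists k, f y = k * f x.
Proof.
elim: l => [//|x l IH] _; have [->|/IH [z zl hz]] := eqVneq l [::].
  by exists x; rewrite ?mem_head // => y; rewrite inE => /eqP->; exists 1;
    rewrite mul1r.
have [[c e]|[c e]] := valuation_dvd hR (f x) (f z).
  exists z => [|y]; rewrite inE ?zl ?orbT // => /orP[/eqP->|/hz //].
  by exists c.
exists x => [|y]; rewrite inE ?eqxx // => /orP[/eqP->|/hz [k ->]].
  by exists 1; rewrite mul1r.
by exists (k * c); rewrite e mulrA.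
Qed.

(** In a finite sum of products one left factor divides all the others, so the sum collapses to a
    single product. *)
Lemma ideal_mul_self (R : idomainType) (hR : valuation_domain R) (I : set R) :
  is_ideal I ->
  (ideal_mul I I = I <-> forall a, I a -> exists b c, [/\ I b, I c & a = b * c]).
Proof.
move=> [I0 ID IM]; split=> [e a|h].
  rewrite -{1}e => -[n [x [y [Ix Iy ->]]]].
  have [->|n0] := eqVneq (index_enum 'I_n) [::].
    by rewrite big_nil; exists 0, 0; rewrite mul0r.
  have [k _ hk] := valuation_gcd hR x n0.
  have /choice[z hz] : forall i, exists z, x i = z * x k.
    by move=> i; apply: hk; rewrite mem_index_enum.
  exists (x k), (\sum_i z i * y i); split=> //.
    by apply: (big_ind I) => // i _; exact: IM.
  by rewrite mulr_sumr; apply: eq_bigr => i _; rewrite {1}hz; ring.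
apply/seteqP; split=> [_ [n [x [y [Ix Iy ->]]]]|a /h[b [c [Ib Ic ->]]]].
  by apply: (big_ind I) => // i _; exact: IM.
by exists 1%N, (fun=> b), (fun=> c); split=> //; rewrite big_ord1.
Qed.

(** If [x * y = b * c] with [b], [c] in [I] and [x], [y] outside, then [x] divides [b] and [y]
    divides [c]. Cancelling [x * y] makes the two quotients inverse to each other, so [x] is a
    multiple of [b]. *)
Lemma idempotent_prime (R : idomainType) (hR : valuation_domain R) (I : set R) :
  is_ideal I -> ~ I 1 ->
  (forall a, I a -> exists b c, [/\ I b, I c & a = b * c]) -> is_prime I.
Proof.
move=> [I0 ID IM] I1 hI; split=> // x y Ixy; apply: contrapT => nI.
have [nx ny] : ~ I x /\ ~ I y by split=> h; apply: nI; [left | right].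
have div z w : ~ I z -> I w -> exists c, w = c * z.
  move=> nz Iw; case: (valuation_dvd hR w z) => // -[c e].
  by case: nz; rewrite e; exact: IM.
have [b [c [Ib Ic e]]] := hI _ Ixy.
have [b' eb] := div _ _ nx Ib; have [c' ec] := div _ _ ny Ic.
have [e0|xy0] := eqVneq (x * y) 0.
  by move/eqP: e0; rewrite mulf_eq0 => /orP[/eqP e0|/eqP e0]; [apply: nx|apply: ny];
    rewrite e0.
have bc1 : b' * c' = 1.
  apply: (mulIf xy0); rewrite mul1r {2}e eb ec; ring.
by apply: nx; rewrite -[x]mul1r -bc1 [b' * c']mulrC -mulrA -eb; exact: IM.
Qed.

(** * Tor over a valuation domain *)

Section Free.
Variables (R : idomainType) (X : choiceType).

Lemma fglift_zmod_morphism (M : lmodType R) (f : X -> M) :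
  zmod_morphism (fglift f : {freeg X / R} -> M).
Proof. exact: lift_is_additive. Qed.

HB.instance Definition _ (M : lmodType R) (f : X -> M) :=
  GRing.isZmodMorphism.Build {freeg X / R} M (fglift f) (fglift_zmod_morphism f).

Lemma freeg_liftE (M : lmodType R) (f : X -> M) (D : {freeg X / R}) :
  fglift f D = \sum_(x <- dom D) coeff x D *: f x.
Proof.
rewrite -{1}[D]freeg_sumE raddf_sum /=.
by apply: eq_bigr => x _; rewrite liftU.
Qed.

Lemma fglift_scalable (M : lmodType R) (f : X -> M) :
  scalable (fglift f : {freeg X / R} -> M).
Proof.
move=> a D; rewrite -{1}[D]freeg_sumE scaler_sumr raddf_sum freeg_liftE scaler_sumr.
apply: eq_bigr => x _; rewrite scalerA -(liftU f (a * _) x); congr fglift.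
by apply/eqP/freeg_eqP => y; rewrite coeffZ !coeffU mulrA.
Qed.

HB.instance Definition _ (M : lmodType R) (f : X -> M) :=
  GRing.isScalable.Build R {freeg X / R} M *:%R (fglift f) (fglift_scalable f).

Lemma coeff_scalable (x : X) :
  scalable (coeff x : {freeg X / R} -> R^o).
Proof. by move=> a D; rewrite coeffZ. Qed.

HB.instance Definition _ (x : X) :=
  GRing.isZmodMorphism.Build {freeg X / R} R^o (coeff x) (@coeff_is_additive R X x).
HB.instance Definition _ (x : X) :=
  GRing.isScalable.Build R {freeg X / R} R^o *:%R (coeff x) (coeff_scalable x).

Lemma free_projective : projective {freeg X / R}.
Proof.
move=> M N p g ponto.
have /choice[s hs] : forall x : X, exists m, p m = g << x >>.
  by move=> x; exact: ponto.
exists (fglift s : {linear {freeg X / R} -> M}) => D /=.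
rewrite freeg_liftE -{3}[D]freeg_sumE !raddf_sum /=.
apply: eq_bigr => x _; rewrite linearZ /= hs -linearZ; congr (g _).
by apply/eqP/freeg_eqP => y; rewrite coeffZ !coeffU mul1r.
Qed.

End Free.

(** A section [s] of the free cover gives the elements of [l] finitely many nonzero coordinates, one
    of which divides all the others. It is a coordinate of some [x0]; dividing the coordinates of
    [x0] by it and mapping back to [P] yields [e]. *)
Lemma projective_pivot (R : idomainType) (hR : valuation_domain R)
    (P : lmodType R) (l : seq P) :
  projective P -> (exists2 x, x \in l & x != 0) ->
  exists (x0 : P) (c : {linear P -> R^o}) (e : P),
    [/\ x0 \in l, x0 = (c x0 : R) *: e, c x0 != 0 &
        forall x, x \in l -> exists k : R, c x = k * c x0].
Proof.
move=> Pproj [z zl z0]; pose p : {linear {freeg P / R} -> P} := fglift (id : P -> P).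
have ponto y : exists D, p D = y by exists << y >>; rewrite /p /= liftU scale1r.
have [s hs] := Pproj _ _ p (idfun : {linear P -> P}) ponto.
have {}hs x : p (s x) = x by exact: hs.
pose L := [seq (x, b) | x <- l, b <- dom (s x)].
have memL x b : ((x, b) \in L) = (x \in l) && (coeff b (s x) != 0).
  apply/allpairsPdep/andP => [[x' [b' [xl + [-> ->]]]]|[xl xb]].
    by rewrite mem_dom.
  by exists x, b; rewrite mem_dom.
have L0 : L != [::].
  have [e|] := eqVneq (dom (s z)) [::].
    case/eqP: z0; rewrite -(hs z); move/eqP: e; rewrite dom_eq0 => /eqP->.
    exact: raddf0.
  case e: (dom (s z)) => [//|b t] _.
  by have := memL z b; rewrite zl -mem_dom e mem_head; case: (L).
have [[x0 b0]] := valuation_gcd hR (fun q => coeff q.2 (s q.1)) L0.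
rewrite memL => /andP[x0l cx0] /= hL.
have /choice[k hk] : forall b, exists k, coeff b (s x0) = k * coeff b0 (s x0).
  move=> b; have [->|nb] := eqVneq (coeff b (s x0)) 0.
    by exists 0; rewrite mul0r.
  by apply: (hL (x0, b)); rewrite memL x0l.
exists x0, (@coeff R P b0 \o s), (\sum_(b <- dom (s x0)) k b *: b); split=> //.
  rewrite -{1}(hs x0) /p /= freeg_liftE scaler_sumr.
  by apply: eq_bigr => b _; rewrite hk scalerA mulrC.
move=> x xl /=; have [->|nb] := eqVneq (coeff b0 (s x)) 0.
  by exists 0; rewrite mul0r.
by apply: (hL (x, b0)); rewrite memL xl.
Qed.

Section TensorTheory.
Variables (R : comPzRingType) (M N : lmodType R).
Implicit Types (m : M) (n : N).

Lemma tens_cat_sum (s t : seq (M * N)) :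
  tens_sum (s ++ t) = tens_sum s + tens_sum t.
Proof. by rewrite [RHS]tens_addE. Qed.

Lemma tens_sumE (s : seq (M * N)) : tens_sum s = \sum_(p <- s) tens p.1 p.2.
Proof.
elim: s => [|[m n] s IH]; first by rewrite big_nil.
by rewrite big_cons -IH -tens_cat_sum.
Qed.

Lemma tensDl m m' n : tens (m + m') n = tens m n + tens m' n.
Proof. by rewrite /tens -tens_cat_sum; apply/tens_sum_eq; exact: tens_Dl. Qed.

Lemma tensDr m n n' : tens m (n + n') = tens m n + tens m n'.
Proof. by rewrite /tens -tens_cat_sum; apply/tens_sum_eq; exact: tens_Dr. Qed.

Lemma tensZ a m n : tens (a *: m) n = tens m (a *: n).
Proof. by apply/tens_sum_eq; exact: tens_Z. Qed.

Lemma tens0l n : tens (0 : M) n = 0.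
Proof. by apply/tens_sum_eq; exact: tens_0l. Qed.

Lemma tens0r m : tens m (0 : N) = 0.
Proof. by rewrite -(scale0r (0 : N)) -tensZ scale0r tens0l. Qed.

Lemma tensNl m n : tens (- m) n = - tens m n.
Proof. by apply/eqP; rewrite -addr_eq0 -tensDl addNr tens0l. Qed.

Lemma tens_sumr (T : Type) (r : seq T) m (F : T -> N) :
  tens m (\sum_(i <- r) F i) = \sum_(i <- r) tens m (F i).
Proof.
by elim/big_rec2: _ => [|i y z _ <-]; rewrite ?tens0r ?tensDr.
Qed.

(** The functional [c] induces a map from the tensor product to [N]; compatibility is checked on the
    generators of [tens_rel]. *)
Lemma tens_form (c : {linear M -> R^o}) (s : seq (M * N)) :
  tens_sum s = 0 -> \sum_(p <- s) (c p.1 : R) *: p.2 = 0.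
Proof.
suff h (t u : seq (M * N)) : tens_rel t u ->
    \sum_(p <- t) (c p.1 : R) *: p.2 = \sum_(p <- u) (c p.1 : R) *: p.2.
  by move=> /tens_sum_eq/h ->; rewrite big_nil.
elim=> {t u} //.
- by move=> s' t u _ -> _.
- by move=> s' s1 t t' _ e _ e'; rewrite !big_cat /= e e'.
- by move=> s' t; rewrite !big_cat /= addrC.
- by move=> n; rewrite big_seq1 big_nil raddf0 scale0r.
- by move=> m m' n; rewrite !big_cons !big_nil !addr0 raddfD scalerDl.
- by move=> m n n'; rewrite !big_cons !big_nil !addr0 scalerDr.
- by move=> a m n; rewrite !big_seq1 linearZ scalerA mulrC.
Qed.

End TensorTheory.

Lemma tens_map_tens (R : comPzRingType) (M M' N : lmodType R)
    (d : {linear M -> M'}) (m : M) (n : N) :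
  tens_map N d (tens m n) = tens (d m) n.
Proof. exact: tens_mapE. Qed.

(* One elimination step against the pivot [(x0, n0)]. *)
Lemma tens_eliminate (R : comPzRingType) (P N : lmodType R) (T : eqType)
    (s : seq T) (x : T -> P) (n : T -> N) (k : T -> R) t0 :
  t0 \in s -> k t0 = 1 ->
  \sum_(t <- s) tens (x t) (n t) =
  \sum_(t <- rem t0 s) tens (x t - k t *: x t0) (n t) +
    tens (x t0) (\sum_(t <- s) k t *: n t).
Proof.
move=> t0s k1; rewrite [LHS](big_rem _ t0s) /= [in RHS](big_rem _ t0s (F := fun t => k t *: n t)) /=.
rewrite k1 scale1r tensDr tens_sumr addrCA -big_split /=; congr (_ + _).
by apply: eq_bigr => t _; rewrite tensDl tensNl tensZ subrK.
Qed.

Section TorVanishing.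
Variables (R : idomainType) (hR : valuation_domain R).

(** Induction on the number of pure tensors, eliminating against a pivot among the images under
    [d1]. The pivot leaves one tensor [tens p0.1 n'] with [n'] killed by [c (d1 p0.1)], and [hMN] is
    what moves it into the image of [d2]. *)
Lemma tens_homology_zero (P2 P1 P M N : lmodType R)
    (d2 : {linear P2 -> P1}) (d1 : {linear P1 -> P}) (d0 : {linear P -> M}) :
  projective P ->
  (forall x, d0 x = 0 <-> exists y, x = d1 y) ->
  (forall x, d1 x = 0 <-> exists y, x = d2 y) ->
  (forall (r : R) (m : M) (n : N), r *: m = 0 -> r *: n = 0 ->
     exists b b', [/\ r = b * b', b *: m = 0 & b' *: n = 0]) ->
  forall z : tensor P1 N, tens_map N d1 z = 0 ->
    exists w, z = tens_map N d2 w.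
Proof.
move=> Pproj ex0 ex1 hMN z; have [s ->] := tens_sumP z => {z}.
have [k] := ubnP (size s); elim: k => // k IH in s *; rewrite ltnS => sk.
rewrite tens_mapE => s0.
have imD z z' : (exists w, z = tens_map N d2 w) ->
    (exists w, z' = tens_map N d2 w) -> exists w, z + z' = tens_map N d2 w.
  by move=> [w ->] [w' ->]; exists (w + w'); rewrite raddfD.
have im_ker y n : d1 y = 0 -> exists w, tens y n = tens_map N d2 w.
  by move=> /ex1[w ->]; exists (tens w n); rewrite tens_map_tens.
have [h|nh] := pselect (exists2 x, x \in [seq d1 p.1 | p <- s] & x != 0); last first.
  rewrite tens_sumE big_seq; apply: (big_ind (fun z => exists w, z = tens_map N d2 w)).
  - by exists 0; rewrite raddf0.
  - exact: imD.
  move=> p ps; apply: im_ker; apply: contrapT => /eqP p0; apply: nh.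
  by exists (d1 p.1) => //; apply: map_f.
have [_ [c [e [/mapP[p0 p0s ->] e0 c0 hc]]]] := projective_pivot hR Pproj h.
have /choice[f hf] : forall p : P1 * N, exists f : R, p \in s ->
    c (d1 p.1) = f * c (d1 p0.1).
  move=> p; have [ps|nps] := boolP (p \in s); last by exists 0.
  by have [f hf] := hc _ (map_f _ ps); exists f.
have f1 : f p0 = 1 by apply: (mulIf c0); rewrite mul1r -hf.
pose n' := \sum_(p <- s) f p *: p.2.
(* The map induced by the functional [c] is applied to the relation [s0]. *)
have dn' : (c (d1 p0.1) : R) *: n' = 0.
  have := tens_form c s0; rewrite big_map /= => <-.
  rewrite /n' scaler_sumr !big_seq; apply: eq_bigr => p ps.
  by rewrite scalerA (hf p) // mulrC.
rewrite tens_sumE (tens_eliminate _ _ p0s f1); apply: imD; last first.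
  have : (c (d1 p0.1) : R) *: d0 e = 0.
    by rewrite -linearZ -e0; apply/ex0; exists p0.1.
  move=> /hMN/(_ dn')[b [b' [eb bm bn]]].
  (* As [b *: e = d1 y], the element [p0.1 - b' *: y] is a cycle; subtracting [b' *: y] does not
     change the tensor because [b'] kills [n']. *)
  have : d0 (b *: e) = 0 by rewrite linearZ.
  move=> /ex0[y hy].
  have /(im_ker _ n')[w hw] : d1 (p0.1 - b' *: y) = 0.
    by rewrite linearB linearZ /= -hy e0 eb scalerA [b * b']mulrC subrr.
  by exists w; rewrite -hw tensDl tensNl tensZ bn tens0r oppr0 addr0.
pose s' := [seq (p.1 - f p *: p0.1, p.2) | p <- rem p0 s].
have -> : \sum_(t <- rem p0 s) tens (t.1 - f t *: p0.1) t.2 = tens_sum s'.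
  by rewrite tens_sumE big_map.
apply: IH.
  rewrite size_map size_rem // -ltnS; case: (s) p0s sk => //= a t _ sk.
move: s0; rewrite tens_mapE !tens_sumE !big_map /=.
rewrite (tens_eliminate (fun p => d1 p.1) _ p0s f1) e0 tensZ dn' tens0r addr0 -e0.
by under [X in _ -> X = _]eq_bigr => p _ do rewrite linearB linearZ /=.
Qed.

(** The kernel terms in [s] are removed one by one. A pivot [p0.1 = c p0.1 *: e] has [d e = 0]
    because [F] is torsion-free, so [y] may change by a multiple of [e] with [d y] unchanged. Once
    no nonzero kernel term remains, the pivot lemma for [y] alone gives [y = a *: k] with
    [a *: n = 0]. *)
Lemma tens_zero_divides (P F N : lmodType R) (d : {linear P -> F})
    (y : P) (n : N) (s : seq (P * N)) :
  projective P -> (forall (r : R) (x : F), r *: x = 0 -> r = 0 \/ x = 0) ->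
  (forall p, p \in s -> d p.1 = 0) -> tens y n + tens_sum s = 0 ->
  exists (a : R) (k : P), a *: n = 0 /\ d y = a *: d k.
Proof.
move=> Pproj Ftf; have [k] := ubnP (size s); elim: k => // k IH in s y *.
rewrite ltnS => sk hs ys0.
have [h|nh] := pselect (exists2 x, x \in [seq p.1 | p <- s] & x != 0); last first.
  have {}ys0 : tens_sum [:: (y, n)] = 0.
    have e0 : tens_sum s = 0.
      rewrite tens_sumE big_seq big1 // => p ps.
      suff -> : p.1 = 0 by rewrite tens0l.
      apply: contrapT => /eqP p0; apply: nh.
      by exists p.1 => //; apply: map_f.
    by move: ys0; rewrite e0 addr0.
  have [->|y0] := eqVneq y 0.
    by exists 0, 0; rewrite scale0r raddf0 scale0r.
  have [|_ [c [e [/[!inE]/eqP-> e0 _ _]]]] := projective_pivot (l := [:: y]) hR Pproj.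
    by exists y; rewrite ?mem_head.
  exists (c y), e; split; last by rewrite {1}e0 linearZ.
  by have := tens_form c ys0; rewrite big_seq1.
have [_ [c [e [/mapP[p0 p0s ->] e0 c0 hc]]]] := projective_pivot hR Pproj h.
have /choice[f hf] : forall p : P * N, exists f : R, p \in s ->
    c p.1 = f * c p0.1.
  move=> p; have [ps|nps] := boolP (p \in s); last by exists 0.
  by have [f hf] := hc _ (map_f _ ps); exists f.
have f1 : f p0 = 1 by apply: (mulIf c0); rewrite mul1r -hf.
have de : d e = 0.
  have : (c p0.1 : R) *: d e = 0 by rewrite -linearZ -e0 hs.
  by move=> /Ftf[e1|//]; rewrite e1 eqxx in c0.
pose s' := [seq (p.1 - f p *: p0.1, p.2) | p <- rem p0 s].
have [|||a [x [an ha]]] := IH s' (y - (c y : R) *: e).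
- rewrite size_map size_rem // -ltnS; case: (s) p0s sk => //= q t _ sk.
- move=> _ /mapP[p /mem_rem ps ->] /=.
  by rewrite linearB linearZ /= !hs // scaler0 subrr.
(* By this relation the leftover pivot term is [- tens e (c y *: n)], which the passage from [y] to
   [y - c y *: e] absorbs. *)
- have /(tens_form c) : tens_sum ((y, n) :: s) = 0.
    by rewrite tens_sumE big_cons -tens_sumE.
  rewrite big_cons /= => cyn.
  move: ys0; rewrite !tens_sumE (tens_eliminate _ _ p0s f1) {2}e0 tensZ.
  have -> : (c p0.1 : R) *: (\sum_(t <- s) f t *: t.2) = - ((c y : R) *: n).
    apply/eqP; rewrite -addr_eq0 addrC -[X in _ == X]cyn; apply/eqP.
    congr (_ + _); rewrite scaler_sumr !big_seq; apply: eq_bigr => p ps.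
    by rewrite scalerA (hf p) // mulrC.
  move=> ys1; rewrite -[RHS]ys1 big_map tensDl tensNl tensZ -addrA; congr (_ + _).
  rewrite addrC; congr (_ + _); apply/eqP.
  by rewrite eq_sym -addr_eq0 -tensDr addNr tens0r.
by exists a, x; split=> //; rewrite -ha linearB linearZ /= de scaler0 subr0.
Qed.

End TorVanishing.

(** * Free resolutions, the first Tor, and homological epimorphisms *)

Section FreeResolution.
Variable R : idomainType.

(** A map is bundled with its two modules because the recursion needs the previous map to form the
    free module on its kernel. *)
Record stage := Stage {
  stage_dom : lmodType R;
  stage_cod : lmodType R;
  stage_map : {linear stage_dom -> stage_cod} }.

Definition next_stage (s : stage) : stage :=
  @Stage {freeg {x : stage_dom s | stage_map s x == 0} / R} (stage_dom s)
    (fglift (val : {x : stage_dom s | stage_map s x == 0} -> stage_dom s)).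

Fixpoint free_stage (M : lmodType R) (n : nat) : stage :=
  if n is n'.+1 then next_stage (free_stage M n')
  else @Stage {freeg M / R} M (fglift (id : M -> M)).

Lemma next_stage_exact (s : stage) (x : stage_dom s) :
  stage_map s x = 0 <-> exists y, x = stage_map (next_stage s) y.
Proof.
split=> [/eqP x0|[y ->]].
  by exists << Sub x x0 >>; rewrite /= liftU scale1r.
rewrite /= freeg_liftE raddf_sum big1 //= => z _.
by rewrite linearZ /= (eqP (valP z)) scaler0.
Qed.

Lemma free_stage_projective (M : lmodType R) n :
  projective (stage_dom (free_stage M n)).
Proof. by case: n => [|n]; exact: free_projective. Qed.

(** Transparent, so that its degree zero term computes to the free module on [M], where coefficients
    can be compared. *)
Definition free_resolution (M : lmodType R) : resolution M.
Proof.
apply: (@Resolution R M (fun n => stage_dom (free_stage M n))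
  (fun n => stage_map (free_stage M n.+1)) (stage_map (free_stage M 0))).
- exact: free_stage_projective.
- by move=> y; exists << y >>; rewrite /= liftU scale1r.
- exact: (next_stage_exact (s := free_stage M 0)).
- by move=> n; exact: (next_stage_exact (s := free_stage M n.+1)).
Defined.

Lemma freeg_torsion_free (X : choiceType) (r : R) (x : {freeg X / R}) :
  r *: x = 0 -> r = 0 \/ x = 0.
Proof.
move=> rx; have [->|r0] := eqVneq r 0; [by left | right].
apply/eqP/freeg_eqP => k; rewrite coeff0; apply: (mulfI r0).
by rewrite -coeffZ rx coeff0 mulr0.
Qed.

Lemma projective_torsion_free (P : lmodType R) (r : R) (x : P) :
  projective P -> r *: x = 0 -> r = 0 \/ x = 0.
Proof.
move=> Pproj rx; pose p : {linear {freeg P / R} -> P} := fglift (id : P -> P).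
have ponto y : exists D, p D = y by exists << y >>; rewrite /p /= liftU scale1r.
have [s hs] := Pproj _ _ p (idfun : {linear P -> P}) ponto.
have [|->|sx] := @freeg_torsion_free _ r (s x); first by rewrite -linearZ rx raddf0.
  by left.
by right; have := hs x; rewrite /= sx raddf0 => <-.
Qed.

End FreeResolution.

(** Writing [r *: << m >> = res_d F 0 y], the tensor of [y] and [n] is a cycle, hence a boundary.
    Then [tens_zero_divides] gives [r *: << m >> = a *: K] with [a *: n = 0] and [K] in the kernel
    of the augmentation. Comparing coefficients, [K] is a multiple of [<< m >>] and its coefficient
    is the other factor of [r]. *)
Lemma Tor1_zero_ann (R : idomainType) (hR : valuation_domain R)
    (M N : lmodType R) (r : R) (m : M) (n : N) :
  Tor_zero 1 M N -> r *: m = 0 -> r *: n = 0 ->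
  exists b b', [/\ r = b * b', b *: m = 0 & b' *: n = 0].
Proof.
move=> tor rm rn; set F := free_resolution M.
have d0K (x : {freeg M / R}) : fglift id x = 0 <-> exists y, x = res_d F 0 y.
  exact: (@res_exact0 R M F).
have [y hy] : exists y, r *: << m >> = res_d F 0 y.
  by apply/d0K; rewrite linearZ /= liftU scale1r.
have [|w hw] := tor F (tens y n).
  by rewrite tens_map_tens -hy tensZ rn tens0r.
have [l e] := tens_sumP w; rewrite {w}e tens_mapE in hw.
have [||||a [k [an hk]]] := @tens_zero_divides R hR (F 1) (F 0) N (res_d F 0) y n
    [seq (- res_d F 1 p.1, p.2) | p <- l].
- exact: free_projective.
- by move=> s x; exact: (@freeg_torsion_free R M).
- move=> _ /mapP[p _ ->] /=; rewrite raddfN; apply/eqP; rewrite oppr_eq0; apply/eqP.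
  by apply: (proj2 (@res_exactS R M F 0 _)); exists p.1.
- rewrite hw !tens_sumE !big_map /=.
  by under [X in _ + X]eq_bigr do rewrite tensNl; rewrite sumrN subrr.
rewrite -hy in hk.
set K : {freeg M / R} := res_d F 0 k in hk.
have K0 : fglift id K = 0 by apply/d0K; exists k.
have [a0|a0] := eqVneq a 0.
  have r0 : r = 0.
    have := congr1 (coeff m) hk; rewrite !coeffZ a0 mul0r coeffU eqxx !mulr1 //.
  by exists 0, 0; rewrite r0 mulr0 !scale0r.
have rE : r = a * coeff m K.
  by rewrite -coeffZ -hk coeffZ coeffU eqxx !mulr1.
exists (coeff m K), a; split; rewrite // 1?mulrC //.
suff KE : K = coeff m K *: << m >>.
  by rewrite -[RHS]K0 {2}KE linearZ /= liftU scale1r.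
apply/eqP/freeg_eqP => x; rewrite coeffZ coeffU mul1r; apply: (mulfI a0).
by rewrite -coeffZ -hk coeffZ coeffU mul1r mulrA -rE.
Qed.

(** Idempotency of the annihilator ideals in the elementwise form of [ideal_mul_self]. *)
Definition idempotent_annihilators (R S : pzRingType) (f : {rmorphism R -> S}) :=
  forall (s : S) (r : R), f r * s = 0 ->
    exists b c, [/\ r = b * c, f b * s = 0 & f c * s = 0].

Lemma homological_epiP (R : idomainType) (hR : valuation_domain R)
    (S : pzRingType) (f : {rmorphism R -> S}) :
  homological_epi f <-> ring_epi f /\ idempotent_annihilators f.
Proof.
split=> [[fE tor]|[fE hf]]; split=> //.
  move=> s r rs; have fC := epi_mulrC fE.
  have [||b [c [e bs cs]]] := Tor1_zero_ann hR (m := s : right_res f)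
    (n := s : left_res f) (r := r) (tor 1%N isT).
  - by rewrite -[LHS]/(s * f r) fC.
  - exact: rs.
  by exists b, c; split=> //; rewrite fC.
case=> [//|i] _ F; have [M [d0 [ex0 hM]]] : exists (M : lmodType R)
    (d0 : {linear F i -> M}),
    (forall x, d0 x = 0 <-> exists y, x = res_d F i y) /\
    (forall (r : R) (m : M) (n : left_res f), r *: m = 0 -> r *: n = 0 ->
     exists b b', [/\ r = b * b', b *: m = 0 & b' *: n = 0]).
  case: i => [|i].
    exists (right_res f), (res_aug F); split; first exact: res_exact0.
    move=> r m n rm rn; have fC := epi_mulrC fE.
    (* Idempotency factors [r] separately for [m] and for [n]. Of [b] and [b'] one divides the
       other, so the multiple kills both [m] and [n], and its cofactor kills the remaining one. *)
    have [|b [c [e bm cm]]] := hf m r; first by rewrite fC.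
    have [b' [c' [e' bn cn]]] := hf n r rn.
    have [[t et]|[t et]] := valuation_dvd hR b b'.
      exists c, b; rewrite mulrC; split=> //; first by rewrite -[LHS]/(m * f c) fC.
      by rewrite -[LHS]/(f b * n) et rmorphM -mulrA bn mulr0.
    exists b', c'; split=> //.
    by rewrite -[LHS]/(m * f b') fC et rmorphM -mulrA bm mulr0.
  (* In higher degrees [M] is a term of the resolution, hence torsion-free, and one factor of [r]
     can be 0 or 1. *)
  exists (F i), (res_d F i); split; first exact: res_exactS.
  move=> r m n /(projective_torsion_free (@res_proj R _ F i))[->|->] rn.
    by exists 0, 0; rewrite mulr0 !scale0r.
  by exists 1, r; rewrite mul1r scaler0.
exact: (tens_homology_zero hR (@res_proj R _ F i) ex0 (@res_exactS R _ F i) hM).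
Qed.
(** * Ring epimorphisms and linear maps *)

Section AdditiveMaps.
Variables U V : zmodType.

Definition additive_pred : {pred U -> V} := fun h => `[< zmod_morphism h >].

Lemma additive_pred_closed : zmod_closed additive_pred.
Proof.
split=> [|g h /asboolP ga /asboolP ha]; apply/asboolP => x y.
  by rewrite -[LHS]/0 -[RHS]/(0 - 0) subr0.
rewrite -[LHS]/(g (x - y) - h (x - y)) -[RHS]/(g x - h x - (g y - h y)).
by rewrite ga ha !opprD !opprK addrACA.
Qed.

HB.instance Definition _ :=
  GRing.isZmodClosed.Build (U -> V) additive_pred additive_pred_closed.

Record addmap := AddMap {
  addmap_fun :> U -> V;
  addmapP : addmap_fun \in additive_pred }.

HB.instance Definition _ := [isSub for addmap_fun].
HB.instance Definition _ := [Choice of addmap by <:].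
HB.instance Definition _ := [SubChoice_isSubZmodule of addmap by <:].

Definition mk_addmap (h : U -> V) (ha : zmod_morphism h) : addmap :=
  AddMap (asboolT ha).

Lemma addmap_ext (g h : addmap) : g =1 h -> g = h.
Proof. by move=> e; apply/val_inj/funext. Qed.

Lemma addmapB (g : addmap) : zmod_morphism g.
Proof. exact/asboolP/addmapP. Qed.

End AdditiveMaps.

Section EndRing.
Variable W : zmodType.
Notation T := (addmap W W).

Definition zend_one : T := @mk_addmap W W id (fun x y => erefl).

Lemma zend_mul_subproof (g h : T) : zmod_morphism (g \o h).
Proof. by move=> x y /=; rewrite !addmapB. Qed.
Definition zend_mul (g h : T) : T := mk_addmap (zend_mul_subproof g h).

Lemma zend_mulA : associative zend_mul.
Proof. by move=> g h k; apply: addmap_ext. Qed.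
Lemma zend_mul1l : left_id zend_one zend_mul.
Proof. by move=> g; apply: addmap_ext. Qed.
Lemma zend_mul1r : right_id zend_one zend_mul.
Proof. by move=> g; apply: addmap_ext. Qed.
Lemma zend_mulDl : left_distributive zend_mul +%R.
Proof. by move=> g h k; apply: addmap_ext. Qed.
Lemma zend_mulDr : right_distributive zend_mul +%R.
Proof.
move=> g h k; apply: addmap_ext => x.
rewrite -[LHS]/(g (h x + k x)) -[RHS]/(g (h x) + g (k x)).
have g0 : g 0 = 0 by rewrite -{1}(subrr 0) addmapB subrr.
have gN y : g (- y) = - g y by rewrite -sub0r addmapB g0 sub0r.
by rewrite -[k x in LHS]opprK addmapB gN opprK.
Qed.

HB.instance Definition _ := GRing.Zmodule_isPzRing.Build T
  zend_mulA zend_mul1l zend_mul1r zend_mulDl zend_mulDr.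

End EndRing.

(** The homomorphisms [conj_mx m] and [conj_mx 0], composed with [g], agree on the image of [R],
    hence on [S]; their corner entries are the commutator with [m] and 0. *)
Lemma epi_commute (R S T : pzRingType) (f : {rmorphism R -> S})
    (g : {rmorphism S -> T}) (m : T) :
  ring_epi f -> (forall r, g (f r) * m = m * g (f r)) ->
  forall s, g s * m = m * g s.
Proof.
move=> fE fm s.
have /(_ s)/matrixP/(_ ord0 ord_max) :
    (conj_mx m \o g : {rmorphism S -> 'M[T]_2}) =1
    (conj_mx (0 : T) \o g : {rmorphism S -> 'M[T]_2}).
  apply: fE => r /=; apply/matrixP => i j.
  by rewrite !mxE fm subrr mulr0 mul0r subrr.
by rewrite !mxE /= mulr0 mul0r subrr => /eqP; rewrite subr_eq0 => /eqP.
Qed.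

(* For a ring epimorphism [R -> S], every [R]-linear map between [S]-modules is
   [S]-linear; here for the map [S -> Hom(S, E)] given by [beta].             *)
Lemma epi_balanced (R S : comPzRingType) (f : {rmorphism R -> S}) (E : zmodType)
    (beta : S -> S -> E) :
  ring_epi f ->
  (forall y, zmod_morphism (beta^~ y)) -> (forall x, zmod_morphism (beta x)) ->
  (forall r x y, beta (f r * x) y = beta x (f r * y)) ->
  forall s x y, beta (s * x) y = beta x (s * y).
Proof.
move=> fE bl br bf s x y.
(* [S] acts on [W], the product of [S] and Hom(S, E). The endomorphism [psi], sending [(u, h)] to
   [(0, beta u)], commutes with the action of [R], hence with that of [S]. *)
pose H := addmap S E; pose W : zmodType := (S * H)%type.
have cAdd (t : S) (h : H) : zmod_morphism (fun z => h (t * z)).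
  by move=> u v; rewrite mulrBr addmapB.
pose act t (w : W) : W := (t * w.1, mk_addmap (cAdd t w.2)).
have actAdd t : zmod_morphism (act t).
  move=> [u h] [v k]; apply/eqP; rewrite xpair_eqE /= mulrBr eqxx /=.
  by apply/eqP/addmap_ext.
pose g t : addmap W W := mk_addmap (actAdd t).
have gB : zmod_morphism g.
  move=> t u; apply: addmap_ext => -[v h]; apply/eqP; rewrite xpair_eqE /= mulrBl eqxx /=.
  by apply/eqP/addmap_ext => z /=; rewrite mulrBl addmapB.
have gM : monoid_morphism g.
  split=> [|t u]; apply: addmap_ext => -[v h]; apply/eqP; rewrite xpair_eqE /=.
    by rewrite mul1r eqxx; apply/eqP/addmap_ext => z /=; rewrite mul1r.
  by rewrite mulrA eqxx; apply/eqP/addmap_ext => z /=; rewrite mulrA [u * t]mulrC.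
pose gr := HB.pack_for {rmorphism S -> addmap W W} g
  (GRing.isZmodMorphism.Build _ _ g gB) (GRing.isMonoidMorphism.Build _ _ g gM).
pose psi (w : W) : W := (0, mk_addmap (br w.1)).
have psiAdd : zmod_morphism psi.
  move=> [u h] [v k]; apply/eqP; rewrite xpair_eqE /= subr0 eqxx /=.
  by apply/eqP/addmap_ext => z /=; rewrite bl.
have h r : gr (f r) * mk_addmap psiAdd = mk_addmap psiAdd * gr (f r).
  apply: addmap_ext => -[v k]; apply/eqP; rewrite xpair_eqE /= mulr0 eqxx /=.
  by apply/eqP/addmap_ext => z /=; rewrite bf.
have := congr1 (fun m : addmap W W => (m (x, 0)).2 y) (epi_commute fE h s).
by [].
Qed.
(** * Local epimorphisms *)

Definition invertible (A : comPzRingType) (x : A) : Prop := exists y, x * y = 1.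

Lemma invertibleM (A : comPzRingType) (x y : A) :
  invertible (x * y) <-> invertible x /\ invertible y.
Proof.
split=> [[z e]|[[u eu] [v ev]]].
  split; first by exists (y * z); rewrite mulrA.
  by exists (x * z); rewrite mulrA [y * x]mulrC.
by exists (u * v); rewrite mulrACA eu ev mulr1.
Qed.

Lemma invertible1 (A : comPzRingType) : invertible (1 : A).
Proof. by exists 1; rewrite mulr1. Qed.

Lemma rmorph_invertible (A B : comPzRingType) (g : {rmorphism A -> B}) x :
  invertible x -> invertible (g x).
Proof. by move=> [y e]; exists (g y); rewrite -rmorphM e rmorph1. Qed.

Lemma invertible_inj (A : comPzRingType) (x y z : A) :
  invertible x -> x * y = x * z -> y = z.
Proof.
by move=> [u e] h; rewrite -[y]mul1r -e -mulrA [u * y]mulrC mulrA h mulrAC e mul1r.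
Qed.

Lemma invertible_mul_eq0 (A : comPzRingType) (x y : A) :
  invertible x -> x * y = 0 -> y = 0.
Proof. by move=> ix e; apply: (invertible_inj ix); rewrite mulr0. Qed.

Section PrimeTheory.
Variables (R : idomainType) (p : primeIdeal R).
Implicit Types x y : R.

Lemma prime0 : pset p 0. Proof. by case: (psetP p) => -[]. Qed.
Lemma prime1 : ~ pset p 1. Proof. by case: (psetP p). Qed.
Lemma primeD x y : pset p x -> pset p y -> pset p (x + y).
Proof. by case: (psetP p) => -[_ h _] _ _; exact: h. Qed.
Lemma primeMl x y : pset p y -> pset p (x * y).
Proof. by case: (psetP p) => -[_ _ h] _ _; exact: h. Qed.
Lemma primeMr x y : pset p x -> pset p (x * y).
Proof. by rewrite mulrC; exact: primeMl. Qed.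
Lemma primeM x y : pset p (x * y) -> pset p x \/ pset p y.
Proof. by case: (psetP p) => _ _; exact. Qed.
Lemma nprimeM x y : ~ pset p x -> ~ pset p y -> ~ pset p (x * y).
Proof. by move=> nx ny /primeM[]. Qed.

End PrimeTheory.

Section LocalQuotient.
Variables (R : idomainType) (j q : primeIdeal R).
Notation K := (RQ j q).
Implicit Types z : K.

Lemma RQ_fracE z : exists a b, ~ pset q b /\ to_RQ j q b * z = to_RQ j q a.
Proof.
have [a [s ->]] := fracP z; have [b bq sE] := msetP s.
exists (repr a), b; split=> //; rewrite /= /to_loc fracM; apply/frac_eq.
exists 1; first exact: mset1.
by rewrite !denE sE to_quot_repr; ring.
Qed.

Lemma to_RQ_invertible r : ~ pset q r -> invertible (to_RQ j q r).
Proof.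
move=> rq; have Tr : prime_compl j q (to_quot j r) by exists r.
exists (Defs.frac 1 (mk_den Tr)); rewrite /= /to_loc fracM; apply/frac_eq.
by exists 1; [exact: mset1 | rewrite !denE; ring].
Qed.

Hypothesis jq : pset j `<=` pset q.

Lemma to_RQ_eq0 r : to_RQ j q r = 0 <-> pset j r.
Proof.
split=> [/frac_eq[_ [u uq ->]]|rj].
  rewrite !denE mulr1 mul0r mulr0 -rmorphM => /to_quot_eq0/primeM[/jq|] //.
by rewrite /= (proj2 (to_quot_eq0 j r)) // rmorph0.
Qed.

Lemma RQ_mul_eq0 z z' : z * z' = 0 -> z = 0 \/ z' = 0.
Proof.
have [a [b [bq e]]] := RQ_fracE z; have [a' [b' [bq' e']]] := RQ_fracE z' => zz0.
have := to_RQ_eq0 (a * a'); rewrite rmorphM -e -e' mulrACA zz0 mulr0 => -[/(_ erefl) + _].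
move=> /primeM[] /to_RQ_eq0; [rewrite -e|rewrite -e'].
  by move=> /(invertible_mul_eq0 (to_RQ_invertible bq)); left.
by move=> /(invertible_mul_eq0 (to_RQ_invertible bq')); right.
Qed.

Lemma RQ_1_neq0 : (1 : K) <> 0.
Proof. by rewrite -(rmorph1 (to_RQ j q)) => /to_RQ_eq0/prime1. Qed.

Lemma to_RQ_invertibleE r : invertible (to_RQ j q r) <-> ~ pset q r.
Proof.
split=> [[z e] rq|]; last exact: to_RQ_invertible.
have [a [b [bq e']]] := RQ_fracE z.
have /to_RQ_eq0/jq : to_RQ j q (b - r * a) = 0.
  by rewrite rmorphB rmorphM -e' -[X in X - _]mulr1 -e; ring.
move=> h; apply: bq; rewrite -[b](subrK (r * a)).
by apply: primeD => //; exact: primeMr.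
Qed.

Lemma RQ_invertibleP a b z :
  ~ pset q b -> to_RQ j q b * z = to_RQ j q a -> invertible z <-> ~ pset q a.
Proof.
move=> bq e; rewrite -to_RQ_invertibleE -e; split=> [h|/invertibleM[]//].
by apply/invertibleM; split=> //; exact: to_RQ_invertible.
Qed.

Lemma RQ_nonunitD z z' :
  ~ invertible z -> ~ invertible z' -> ~ invertible (z + z').
Proof.
have [a [b [bq e]]] := RQ_fracE z; have [a' [b' [bq' e']]] := RQ_fracE z'.
move=> /(RQ_invertibleP bq e)/contrapT aq /(RQ_invertibleP bq' e')/contrapT aq'.
have es : to_RQ j q (b * b') * (z + z') = to_RQ j q (b' * a + b * a').
  by rewrite rmorphD !rmorphM -e -e'; ring.
apply/(RQ_invertibleP (nprimeM bq bq') es).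
by apply; apply: primeD; exact: primeMl.
Qed.

End LocalQuotient.

Section Extension.
Variables (R : idomainType) (S : comPzRingType) (f : {rmorphism R -> S}).
Variable j : primeIdeal R.
Hypothesis ker_f : forall r, f r = 0 <-> pset j r.
Notation K := (RQ j j).
Notation i := (to_RQ j j).

Let jj : pset j `<=` pset j. Proof. by []. Qed.

(* Graphs of partial [R]-linear maps [S -> Frac(R/j)] sending 1 to 1. *)
Let linear_graph (G : set (S * K)) : Prop :=
  [/\ forall u v, G u -> G v -> G (u.1 - v.1, u.2 - v.2),
      forall r u, G u -> G (f r * u.1, i r * u.2),
      forall z, G (0, z) -> z = 0 & G (1, 1)].

Let extend_graph (G : set (S * K)) x :
  linear_graph G -> exists2 G', linear_graph G' & G `<=` G' /\ exists z, G' (x, z).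
Proof.
move=> [GB GZ G0 G1].
(* [e] is the value assigned to [x]. If the domain contains a multiple of [x] by some [c] outside
   [j], it is forced by division by [c]. Otherwise any multiple of [x] in the domain has its
   coefficient in [j], hence is zero, and 0 will do. *)
have [e he] : exists e, forall r z, G (f r * x, z) -> z = i r * e.
  have [[c [z [cj cz]]]|nc] :=
      pselect (exists c z, ~ pset j c /\ G (f c * x, z)).
    have [c' hc'] := to_RQ_invertible j cj; exists (c' * z) => r z' rz'.
    apply: (invertible_inj (to_RQ_invertible j cj)).
    have -> : i c * (i r * (c' * z)) = i r * z by rewrite -[z in RHS]mul1r -hc'; ring.
    apply/eqP; rewrite -subr_eq0; apply/eqP/G0.
    have := GB _ _ (GZ c _ rz') (GZ r _ cz).
    by rewrite /= mulrCA subrr.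
  exists 0 => r z rz; rewrite mulr0.
  have rj : pset j r by apply: contrapT => rj; apply: nc; exists r, z.
  by apply: G0; move/ker_f: rj rz => ->; rewrite mul0r.
have G00 : G (0, 0) by have := GB _ _ G1 G1; rewrite /= !subrr.
exists [set w | exists r u, G u /\ w = (f r * x + u.1, i r * e + u.2)]; last first.
  split=> [[a b] Gab|].
    by exists 0, (a, b); rewrite !rmorph0 !mul0r !add0r.
  by exists e, 1, (0, 0); rewrite !rmorph1 !mul1r !addr0.
split.
- move=> _ _ [r [u [Gu ->]]] [r' [u' [Gu' ->]]]; exists (r - r'), (u.1 - u'.1, u.2 - u'.2).
  by split; [exact: GB | congr pair; rewrite /= rmorphB; ring].
- move=> s _ [r [u [Gu ->]]]; exists (s * r), (f s * u.1, i s * u.2).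
  by split; [exact: GZ | congr pair; rewrite /= rmorphM; ring].
- move=> z [r [u [Gu [e1 ->]]]].
  suff /he : G (f r * x, - u.2) by move=> h; rewrite -h addNr.
  have := GB _ _ G00 Gu; rewrite /= !sub0r; congr (G (_, _)).
  by apply/eqP; rewrite eq_sym -addr_eq0 -e1.
- by exists 0, (1, 1); rewrite !rmorph0 !mul0r !add0r.
Qed.

Lemma linear_extension : exists phi : S -> K,
  [/\ zmod_morphism phi, forall r x, phi (f r * x) = i r * phi x & phi 1 = 1].
Proof.
pose P G := G = set0 \/ linear_graph G.
have [F FP Ftot|A [PA Amax]] := @Zorn_bigcup (S * K)%type P.
  have [[X FX X0]|nX] := pselect (exists2 X, F X & X !=set0); last first.
    left; apply/seteqP; split=> // u [X FX Xu]; apply: nX.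
    by exists X => //; exists u.
  have lin Y u : F Y -> Y u -> linear_graph Y.
    by move=> FY Yu; case: (FP Y FY) => // Y0; rewrite Y0 in Yu.
  right; split.
  - move=> u v [Y FY Yu] [Z FZ Zv]; have [YZ|ZY] := Ftot _ _ FY FZ.
      by exists Z => //; case: (lin Z v FZ Zv) => h _ _ _; apply: h => //; exact: YZ.
    by exists Y => //; case: (lin Y u FY Yu) => h _ _ _; apply: h => //; exact: ZY.
  - by move=> r u [Y FY Yu]; exists Y => //; case: (lin Y u FY Yu) => _ h _ _; exact: h.
  - by move=> z [Y FY Yz]; case: (lin Y _ FY Yz) => _ _ h _; exact: h.
  by case: X0 => u Xu; exists X => //; case: (lin X u FX Xu).
have linA : linear_graph A.
  case: PA => // A0; exfalso.
  pose G : set (S * K) := [set u | exists r, u = (f r, i r)].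
  apply: (Amax G); last first.
    right; split.
    - by move=> _ _ [r ->] [s ->]; exists (r - s); rewrite !rmorphB.
    - by move=> s _ [r ->]; exists (s * r); rewrite !rmorphM.
    - by move=> z [r [/esym/ker_f e ->]]; apply/to_RQ_eq0.
    - by exists 1; rewrite !rmorph1.
  by rewrite A0; split=> // h; have /h : G (1, 1) by exists 1; rewrite !rmorph1.
have total x : exists z, A (x, z).
  have [G linG [AG [z Gz]]] := extend_graph x linA.
  apply: contrapT => nz; apply: (Amax G); last by right.
  by split=> // GA; apply: nz; exists z; exact: GA.
have [phi hphi] := choice total; case: linA => AB AZ A0 A1.
have uniq x z z' : A (x, z) -> A (x, z') -> z = z'.
  move=> h h'; apply/eqP; rewrite -subr_eq0; apply/eqP/A0.
  by have := AB _ _ h h'; rewrite /= subrr.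
exists phi; split.
- by move=> x y; apply: uniq (hphi _) (AB _ _ (hphi x) (hphi y)).
- by move=> r x; apply: uniq (hphi _) (AZ r _ (hphi x)).
- exact: uniq (hphi _) A1.
Qed.

End Extension.

(** [im] is the set of fractions in [S]; the ring map [phi] is injective on it and has the same
    values on it as on [S]. So [theta], the fraction with the same value, is well defined and
    [R]-linear. *)
Lemma local_epi_frac (R : idomainType) (hR : valuation_domain R)
    (S : comPzRingType) (f : {rmorphism R -> S}) (j : primeIdeal R) :
  ring_epi f -> (forall r, f r = 0 <-> pset j r) ->
  (forall x : S, invertible x \/ invertible (1 - x)) ->
  forall x, exists a b, invertible (f b) /\ f b * x = f a.
Proof.
move=> fE kf loc; have [phi [phiB phiZ phi1]] := linear_extension kf.
have phiM x y : phi (x * y) = phi x * phi y.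
  suff /(_ x 1 y) : forall s u v, phi (s * u) * phi v = phi u * phi (s * v).
    by rewrite mulr1 phi1 mul1r.
  apply: (epi_balanced (beta := fun u v => phi u * phi v) fE).
  - by move=> z u v; rewrite phiB mulrBl.
  - by move=> z u v; rewrite phiB mulrBr.
  - by move=> r u v; rewrite !phiZ; ring.
have phif r : phi (f r) = to_RQ j j r by rewrite -[f r]mulr1 phiZ phi1 mulr1.
pose im x := exists a b, invertible (f b) /\ f b * x = f a.
have imB x y : im x -> im y -> im (x - y).
  move=> [a [b [ib e]]] [a' [b' [ib' e']]]; exists (b' * a - b * a'), (b * b').
  split; first by rewrite rmorphM; apply/invertibleM.
  by rewrite rmorphB !rmorphM -e -e'; ring.
have imZ r x : im x -> im (f r * x).
  move=> [a [b [ib e]]]; exists (r * a), b; split=> //.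
  by rewrite rmorphM -e mulrCA.
have im_inj x : im x -> phi x = 0 -> x = 0.
  move=> [a [b [ib e]]] x0; apply: (invertible_inj ib); rewrite mulr0 e.
  by apply/kf; apply/(to_RQ_eq0 (q := j)) => //; rewrite -phif -e phiM x0 mulr0.
have im_phi x : exists y, im y /\ phi y = phi x.
  have [a [b [bj e]]] := RQ_fracE (phi x).
  have [[c ec]|[c ec]] := valuation_dvd hR a b.
    exists (f c); split.
      by exists c, 1; rewrite rmorph1 mul1r; split=> //; exact: invertible1.
    apply: (invertible_inj (to_RQ_invertible j bj)).
    by rewrite e phif ec rmorphM mulrC.
  have aj : ~ pset j a by move=> aj; apply: bj; rewrite ec; exact: primeMl.
  have cx1 : phi (f c * x) = 1.
    rewrite phiZ; apply: (invertible_inj (to_RQ_invertible j aj)).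
    by rewrite mulr1 -[RHS]e ec rmorphM; ring.
  (* [1 - f c * x] is in the kernel of [phi], hence no unit; as [S] is local, [f c * x] is one, and
     the inverse of [f c] is the required fraction. *)
  have /invertibleM[ic _] : invertible (f c * x).
    case: (loc (f c * x)) => // -[y ey]; have := congr1 phi ey.
    rewrite phiM phiB cx1 phi1 subrr mul0r => /esym h.
    by case: (@RQ_1_neq0 R j j).
  have [c' hc'] := ic; exists c'; split; first by exists 1, c; rewrite rmorph1.
  have := congr1 phi hc'; rewrite phiM phi1 -cx1 phiM => h.
  apply: (invertible_inj _ h); rewrite phif.
  by exists (phi x); rewrite -phif -phiM cx1.
have [theta htheta] := choice im_phi.
have uniq x y : im y -> phi y = phi x -> theta x = y.
  move=> iy e; have [ix ex] := htheta x; apply/eqP; rewrite -subr_eq0; apply/eqP.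
  by apply: im_inj; [exact: imB | rewrite phiB ex e subrr].
have thetaB : zmod_morphism theta.
  move=> x y; have [ix ex] := htheta x; have [iy ey] := htheta y.
  by apply: uniq; [exact: imB | rewrite !phiB ex ey].
have thetaZ r x : theta (f r * x) = f r * theta x.
  have [ix ex] := htheta x.
  by apply: uniq; [exact: imZ | rewrite !phiZ ex].
have theta1 : theta 1 = 1.
  apply: uniq => //; exists 1, 1; rewrite rmorph1 mul1r; split=> //.
  exact: invertible1.
(* Being [S]-linear with [theta 1 = 1], the map [theta] is the identity. *)
move=> x; suff /(_ x 1 1) : forall s u v, theta (s * u) * v = theta u * (s * v).
  by rewrite theta1 !mulr1 mul1r => <-; exact: (htheta x).1.
apply: (epi_balanced (beta := fun u v => theta u * v) fE).
- by move=> z u v; rewrite thetaB mulrBl.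
- by move=> z u v; rewrite mulrBr.
- by move=> r u v; rewrite thetaZ; ring.
Qed.
(** * Localization at maximal ideals *)

Section Zorn.
Variable S : comPzRingType.

Lemma ideal_avoiding (T : multset S) (a : set S) :
  is_ideal a -> (forall x, a x -> ~ T x) ->
  exists P, [/\ is_ideal P, a `<=` P, forall x, P x -> ~ T x &
    forall J, is_ideal J -> P `<=` J -> (forall x, J x -> ~ T x) -> J = P].
Proof.
move=> aI aT; pose good X := [/\ is_ideal X, a `<=` X & forall x, X x -> ~ T x].
(* The empty set is adjoined for the empty chain, as in [linear_extension]. *)
have [F FP Ftot|A [PA Amax]] := @Zorn_bigcup S (fun X => X = set0 \/ good X).
  have [[X FX [x0 Xx0]]|nX] := pselect (exists2 X, F X & X !=set0); last first.
    left; apply/seteqP; split=> // u [X FX Xu]; apply: nX.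
    by exists X => //; exists u.
  have FG Y u : F Y -> Y u -> good Y.
    by move=> FY Yu; case: (FP Y FY) => // Y0; rewrite Y0 in Yu.
  have [XI aX XT] := FG _ _ FX Xx0.
  right; split.
  - split; first by exists X => //; case: XI.
      move=> x y [Y FY Yx] [Z FZ Zy]; have [YZ|ZY] := Ftot _ _ FY FZ.
        by exists Z => //; case: (FG _ _ FZ Zy) => -[_ + _] _ _; apply => //; exact: YZ.
      by exists Y => //; case: (FG _ _ FY Yx) => -[_ + _] _ _; apply => //; exact: ZY.
    by move=> c x [Y FY Yx]; exists Y => //; case: (FG _ _ FY Yx) => -[_ _ +] _ _; exact.
  - by move=> x ax; exists X => //; exact: aX.
  - by move=> x [Y FY Yx]; case: (FG _ _ FY Yx) => _ _; exact.
have [AI aA AT] : good A.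
  case: PA => // A0; exfalso; apply: (Amax a); last by right; split.
  by rewrite A0; split=> // h; case: aI => a0 _ _; exact: h a0.
exists A; split=> // J JI AJ JT; apply: contrapT => JA; apply: (Amax J).
  by split=> // JA'; apply: JA; apply/seteqP.
by right; split=> // x ax; exact/AJ/aA.
Qed.

Definition adjoin (P : set S) (x : S) : set S :=
  [set z | exists p c, P p /\ z = p + c * x].

Lemma adjoin_ideal P x : is_ideal P -> is_ideal (adjoin P x).
Proof.
move=> [P0 PD PM]; split; first by exists 0, 0; rewrite mul0r addr0.
  move=> _ _ [p [c [Pp ->]]] [p' [c' [Pp' ->]]]; exists (p + p'), (c + c').
  by split; [exact: PD | ring].
move=> d _ [p [c [Pp ->]]]; exists (d * p), (d * c).
by split; [exact: PM | ring].
Qed.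

Lemma prime_avoiding (T : multset S) (a : set S) :
  is_ideal a -> (forall x, a x -> ~ T x) ->
  exists P, [/\ is_prime P, a `<=` P & forall x, P x -> ~ T x].
Proof.
move=> aI aT; have [P [PI aP PT Pmax]] := ideal_avoiding aI aT.
exists P; split=> //; have [P0 PD PM] := PI; split=> //.
  by move=> P1; apply: (PT 1 P1); exact: mset1.
have meets x : ~ P x -> exists p c, P p /\ T (p + c * x).
  move=> nx; apply: contrapT => h; apply: nx.
  rewrite -(Pmax (adjoin P x)).
  - by exists 0, 1; rewrite mul1r add0r.
  - exact: adjoin_ideal.
  - by move=> z Pz; exists z, 0; rewrite mul0r addr0.
  - by move=> _ [p [c [Pp ->]]] Tz; apply: h; exists p, c.
move=> x y Pxy; apply: contrapT => nxy.
have [p [c [Pp Tx]]] := meets x (fun h => nxy (or_introl h)).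
have [p' [c' [Pp' Ty]]] := meets y (fun h => nxy (or_intror h)).
apply: (PT _ _ (msetM Tx Ty)).
have -> : (p + c * x) * (p' + c' * y) =
    (p' + c' * y) * p + c * x * p' + c * c' * (x * y) by ring.
by apply: (PD); [apply: (PD) |]; exact: PM.
Qed.

Definition mult1 : multset S.
Proof. by exists [set x | x = 1] => // _ _ -> ->; rewrite mulr1. Defined.

Lemma maximal_over (a : set S) :
  is_ideal a -> ~ a 1 -> exists n, is_maximal_ideal n /\ a `<=` n.
Proof.
move=> aI a1; have [|P [PI aP PT Pmax]] := @ideal_avoiding mult1 a aI.
  by move=> x ax x1; apply: a1; rewrite -x1.
exists P; split=> //; split=> //.
  by move=> PE; apply: (PT 1) => //; rewrite PE.
move=> J JI PJ; have [J1|nJ1] := pselect (J 1).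
  right; apply/seteqP; split=> // x _; rewrite -[x]mulr1.
  by case: JI => _ _; apply.
by left; apply: Pmax => // x Jx x1; apply: nJ1; rewrite -x1.
Qed.

Section Maximal.
Variables (n : set S) (nmax : is_maximal_ideal n).

Lemma max0 : n 0. Proof. by case: nmax => -[]. Qed.
Lemma maxD x y : n x -> n y -> n (x + y).
Proof. by case: nmax => -[_ h _] _ _; exact: h. Qed.
Lemma maxMl x y : n y -> n (x * y).
Proof. by case: nmax => -[_ _ h] _ _; exact: h. Qed.
Lemma maxMr x y : n x -> n (x * y).
Proof. by rewrite mulrC; exact: maxMl. Qed.
Lemma maxB x y : n x -> n y -> n (x - y).
Proof. by move=> nx ny; apply: maxD => //; rewrite -mulN1r; exact: maxMl. Qed.
Lemma max1 : ~ n 1. Proof. exact: max_compl1. Qed.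
Lemma nmaxM x y : ~ n x -> ~ n y -> ~ n (x * y).
Proof. exact: max_complM. Qed.

Definition vanish (s : S) : Prop := exists2 t, ~ n t & t * s = 0.

Lemma to_loc_eq0 s : to_loc (max_compl nmax) s = 0 <-> vanish s.
Proof.
split=> [/frac_eq[t nt]|[t nt e]].
  by rewrite !denE !mulr1 mulr0 => e; exists t.
by apply/frac_eq; exists t => //; rewrite !denE !mulr1 mulr0.
Qed.

Lemma to_loc_invertible s : invertible (to_loc (max_compl nmax) s) <-> ~ n s.
Proof.
split=> [[z]|ns].
  have [a [t ->]] := fracP z; rewrite /to_loc fracM => /frac_eq[u nu].
  rewrite !denE !mulr1 !mul1r => e sn.
  have nt : ~ n (\val t) by exact: msetP t.
  by apply: (nmaxM nu nt); rewrite -e; apply: maxMl; exact: maxMr.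
exists (Defs.frac 1 (@mk_den _ (max_compl nmax) s ns)); rewrite /to_loc fracM.
by apply/frac_eq; exists 1; [exact: mset1 | rewrite !denE; ring].
Qed.

Lemma to_loc_frac z : exists a t, ~ n t /\
  to_loc (max_compl nmax) t * z = to_loc (max_compl nmax) a.
Proof.
have [a [t ->]] := fracP z; exists a, (\val t); split; first exact: msetP t.
rewrite /to_loc fracM; apply/frac_eq; exists 1; first exact: mset1.
by rewrite !denE; ring.
Qed.

Lemma loc_max_local (z : loc (max_compl nmax)) : invertible z \/ invertible (1 - z).
Proof.
have [a [t [nt e]]] := to_loc_frac z; have [na|na] := pselect (n a).
  right; apply: (proj2 (proj1 (invertibleM (to_loc (max_compl nmax) t) _) _)).
  rewrite mulrBr mulr1 e -rmorphB; apply/to_loc_invertible => nta.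
  by apply: nt; rewrite -[t](subrK a); exact: maxD.
left; apply: (proj2 (proj1 (invertibleM (to_loc (max_compl nmax) t) _) _)).
by rewrite e; apply/to_loc_invertible.
Qed.

Lemma loc_epi : ring_epi (to_loc (max_compl nmax)).
Proof.
move=> T g h gh z; have [a [t [nt e]]] := to_loc_frac z.
have [u hu] := proj2 (to_loc_invertible t) nt.
have gu : g u = h u.
  have ut : u * to_loc (max_compl nmax) t = 1 by rewrite mulrC.
  rewrite -[g u]mulr1 -(rmorph1 h) -hu rmorphM mulrA.
  by rewrite -[h (to_loc _ _)](gh t) -[g u * _](rmorphM g) ut rmorph1 mul1r.
have -> : z = u * to_loc (max_compl nmax) a.
  by rewrite -e mulrA [u * _]mulrC hu mul1r.
by rewrite !rmorphM gu; congr (_ * _); exact: gh.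
Qed.

End Maximal.
End Zorn.

Lemma ring_epi_comp (R S T : pzRingType) (f : {rmorphism R -> S})
    (g : {rmorphism S -> T}) : ring_epi f -> ring_epi g -> ring_epi (g \o f).
Proof. by move=> fE gE U h k hk; apply: gE => s; apply: (fE U (h \o g) (k \o g)). Qed.
(** * Cuts in chains of intervals *)

Section GoodChains.
Variable R : idomainType.
Implicit Types (D E F G A : admInterval R).

Lemma interval_le_anti D E : interval_le D E -> interval_le E D -> D = E.
Proof.
by move=> [//|DE] [//|ED]; case: (interval_ltxx (interval_lt_trans DE ED)).
Qed.

Lemma interval_lexx D : interval_le D D.
Proof. by left. Qed.

Lemma interval_le_lt_trans D E F :
  interval_le D E -> interval_lt E F -> interval_lt D F.
Proof. by move=> [->//|]; exact: interval_lt_trans. Qed.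

Lemma interval_lt_le_trans D E F :
  interval_lt D E -> interval_le E F -> interval_lt D F.
Proof. by move=> DE [<-//|]; exact: interval_lt_trans. Qed.

Lemma subchain_cmp (I : set (admInterval R)) D E :
  subchain I -> I D -> I E -> interval_le D E \/ interval_lt E D.
Proof.
move=> Ic ID IE; have [|[->|]] := Ic D E ID IE; by [left | left; left | right].
Qed.

Definition adjacent (I : set (admInterval R)) A F : Prop :=
  [/\ I A, I F, interval_lt A F &
      forall D, I D -> interval_le D A \/ interval_le F D].

(** The intervals at which a block of a partition can end; dually for [left_end]. *)
Definition right_end (I : set (admInterval R)) A : Prop :=
  I A /\ ((forall D, I D -> interval_le D A) \/ exists F, adjacent I A F).

Definition left_end (I : set (admInterval R)) F : Prop :=
  I F /\ ((forall D, I D -> interval_le F D) \/ exists A, adjacent I A F).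

Variable C : goodChain R.
Notation I := (gc_set C).
Let cmp D E := @subchain_cmp I D E (@gc_chain R C).

Lemma adjacent_between D0 D1 : I D0 -> I D1 -> interval_lt D0 D1 ->
  exists A F, [/\ adjacent I A F, interval_le D0 A & interval_le F D1].
Proof.
move=> I0 I1 lt01; have [A [F [IA IF DA AF [FD nE]]]] := gc_C3 I0 I1 lt01.
exists A, F; split=> //; split=> // E IE.
have [|AE] := cmp IE IA; first by left.
have [|EF] := cmp IF IE; first by right.
by case: nE; exists E.
Qed.

Lemma adjacent_left A F : adjacent I A F -> left_end I F.
Proof. by move=> h; have [_ IF _ _] := h; split=> //; right; exists A. Qed.

Lemma adjacent_right A F : adjacent I A F -> right_end I A.
Proof. by move=> h; have [IA _ _ _] := h; split=> //; right; exists F. Qed.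

Lemma left_end_approx D r : I D -> pset (lo D) r ->
  exists F, [/\ left_end I F, interval_le F D & pset (lo F) r].
Proof.
move=> ID rD; pose A := [set G | I G /\ interval_lt G D].
have AI : A `<=` I by move=> G [].
have [A0|nA] := pselect (A !=set0); last first.
  exists D; split; [split=> //; left | exact: interval_lexx | exact: rD].
  move=> E IE; have [//|ED] := cmp ID IE.
  by case: nA; exists E.
have [[M [[IM MD] Mmax]]|nmax] := pselect (exists M, maximal_in A M).
  have [A' [F [adj MA' FD]]] := adjacent_between IM ID MD.
  have [_ IF A'F _] := adj; case: FD => [e|FD].
    rewrite e in adj; exists D; split=> //; [exact: adjacent_left adj | by left].
  by case: (Mmax F); [split | exact: interval_le_lt_trans MA' A'F].
have [H IH loH] := gc_C2 AI A0 nmax.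
have DH : interval_le D H.
  have [//|HD] := cmp ID IH; case: nmax; exists H; split=> // G [IG GD] [_].
  by apply; apply: subset_trans (@lo_hi R H); rewrite loH => x Gx; exists G.
have := interval_le_lo DH rD; rewrite loH => -[G [IG GD] rG].
have [A' [F [adj GA' FD]]] := adjacent_between IG ID GD.
exists F; split=> //; first exact: adjacent_left adj.
apply: interval_le_lo rG; right; apply: interval_le_lt_trans GA' _.
by case: adj.
Qed.

(** Dual to [left_end_approx]: at a limit from above, (C1) makes [hi D] the intersection of the
    upper ends above it. *)
Lemma right_end_approx D r : I D -> ~ pset (hi D) r ->
  exists A, [/\ right_end I A, interval_le D A & ~ pset (hi A) r].
Proof.
move=> ID rD; pose U := [set G | I G /\ interval_lt D G].
have UI : U `<=` I by move=> G [].
have [U0|nU] := pselect (U !=set0); last first.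
  exists D; split; [split=> //; left | exact: interval_lexx | exact: rD].
  move=> E IE; have [//|DE] := cmp IE ID.
  by case: nU; exists E.
have [[M [[IM DM] Mmin]]|nmin] := pselect (exists M, minimal_in U M).
  have [A [F [adj DA FM]]] := adjacent_between ID IM DM.
  have [IA _ AF _] := adj; case: DA => [e|DA].
    rewrite -e in adj; exists D; split=> //; [exact: adjacent_right adj | by left].
  by case: (Mmin A); [split | exact: interval_lt_le_trans AF FM].
have [H IH hiH] := gc_C1 UI U0 nmin.
have HD : interval_le H D.
  have [//|DH] := cmp IH ID; case: nmin; exists H; split=> // G [IG DG] [_].
  by apply; apply: subset_trans (@lo_hi R H) _; rewrite hiH => x; apply.
have [G [IG DG] rG] : exists2 G, U G & ~ pset (hi G) r.
  apply: contrapT => nG; apply: rD; apply: (interval_le_hi HD).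
  rewrite hiH => G UG; apply: contrapT => rG; apply: nG.
  by exists G.
have [A [F [adj DA FG]]] := adjacent_between ID IG DG.
exists A; split=> //; first exact: adjacent_right adj.
move=> rA; apply: rG; apply: interval_le_hi rA.
by right; apply: interval_lt_le_trans FG; case: adj.
Qed.

End GoodChains.
(** * The chain of a homological epimorphism *)

Section Spectrum.
Variables (R : idomainType) (hR : valuation_domain R).
Variables (S : comPzRingType) (f : {rmorphism R -> S}).
Hypothesis fE : ring_epi f.
Hypothesis fA : idempotent_annihilators f.

(* [D] is the interval attached to the maximal ideal [n] of [S]. *)
Definition point (n : set S) (D : admInterval R) : Prop :=
  [/\ is_maximal_ideal n, forall r, pset (hi D) r <-> n (f r) &
      forall r, pset (lo D) r <-> vanish n (f r)].

Lemma vanish_ker_idempotent n : is_maximal_ideal n -> forall r, vanish n (f r) ->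
  exists b c, [/\ vanish n (f b), vanish n (f c) & r = b * c].
Proof.
move=> nmax r [t nt e]; rewrite mulrC in e; have [b [c [-> eb ec]]] := fA e.
by exists b, c; split=> //; exists t => //; rewrite mulrC.
Qed.

Lemma vanish_ideal n : is_maximal_ideal n ->
  is_ideal (fun r => vanish n (f r)) /\ ~ vanish n (f 1).
Proof.
move=> nmax; split; last first.
  rewrite rmorph1 => -[t nt]; rewrite mulr1 => t0; apply: nt; rewrite t0.
  exact: max0.
split.
- by exists 1; [exact: max1 | rewrite rmorph0 mulr0].
- move=> x y [t nt e] [u nu e']; exists (t * u); first exact: nmaxM.
  by rewrite rmorphD mulrDr {1}[t * u]mulrC -!mulrA e e' !mulr0 addr0.
- move=> a x [t nt e]; exists t => //.
  by rewrite rmorphM mulrCA e mulr0.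
Qed.

Lemma point_exists n : is_maximal_ideal n -> exists D, point n D.
Proof.
move=> nmax; have [vI v1] := vanish_ideal nmax.
have vid := vanish_ker_idempotent nmax.
have vP : is_prime (fun r => vanish n (f r)).
  by apply: (idempotent_prime hR vI v1) => a /vid[b [c [? ? ?]]]; exists b, c.
have qP : is_prime (fun r => n (f r)).
  split.
  - split; first by rewrite rmorph0; exact: max0.
      by move=> x y nx ny; rewrite rmorphD; exact: maxD.
    by move=> a x nx; rewrite rmorphM; exact: maxMl.
  - by rewrite rmorph1; exact: max1.
  - move=> x y; rewrite rmorphM => nxy; apply: contrapT => h.
    apply: (nmaxM nmax _ _ nxy) => h'; apply: h; [by left | by right].
have lh : pset (Prime vP) `<=` pset (Prime qP).
  move=> r [t nt e]; apply: contrapT => nr; apply: (nmaxM nmax nt nr).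
  by rewrite e; exact: max0.
have li : ideal_mul (pset (Prime vP)) (pset (Prime vP)) = pset (Prime vP).
  by apply/(ideal_mul_self hR vI) => a /vid[b [c [? ? ?]]]; exists b, c.
by exists (@Defs.Interval R (Prime vP) (Prime qP) lh li).
Qed.

Lemma point_frac n D : point n D -> forall s, exists a b t,
  [/\ ~ pset (hi D) b, ~ n t & t * (f b * s - f a) = 0].
Proof.
move=> [nmax hiD loD] s.
pose g : {rmorphism S -> loc (max_compl nmax)} := to_loc (max_compl nmax).
have gfE : ring_epi (g \o f) by apply: ring_epi_comp fE _; exact: loc_epi.
have [|a [b [ib e]]] := local_epi_frac hR (j := lo D) gfE _ (loc_max_local (nmax := nmax)) (g s).
  by move=> r; rewrite loD; exact: to_loc_eq0.
have /(to_loc_eq0 nmax)[t nt e'] : g (f b * s - f a) = 0.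
  by rewrite rmorphB rmorphM; apply/eqP; rewrite subr_eq0; apply/eqP.
exists a, b, t; split=> //.
by rewrite hiD; apply/(to_loc_invertible nmax).
Qed.

(** [s] goes to [a / b] whenever [f b * s = f a] in [S_n]. Numerators and denominators are not
    unique, so the map is built from its graph [G]. *)
Lemma point_map n D : point n D ->
  exists pi : {rmorphism S -> RQ (lo D) (hi D)},
    [/\ forall r, pi (f r) = to_RQ (lo D) (hi D) r,
        forall s, pi s = 0 <-> vanish n s &
        forall s, invertible (pi s) <-> ~ n s].
Proof.
move=> nD; have [nmax hiD loD] := nD; pose i : {rmorphism R -> _} := to_RQ (lo D) (hi D).
pose G s z := exists a b t,
  [/\ ~ pset (hi D) b, ~ n t, t * (f b * s - f a) = 0 & i b * z = i a].
have Guniq s z z' : G s z -> G s z' -> z = z'.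
  move=> [a [b [t [bq nt e ez]]]] [a' [b' [t' [bq' nt' e' ez']]]].
  have /loD/(to_RQ_eq0 (@lo_hi _ D)) : vanish n (f (b' * a - b * a')).
    exists (t * t'); first exact: nmaxM.
    have -> : t * t' * f (b' * a - b * a') =
       t * f b * (t' * (f b' * s - f a')) - t' * f b' * (t * (f b * s - f a)).
      by rewrite rmorphB !rmorphM; ring.
    by rewrite e e' !mulr0 subr0.
  move=> /eqP; rewrite rmorphB subr_eq0 => /eqP h.
  have /invertible_inj : invertible (i (b * b')).
    by apply: to_RQ_invertible; exact: nprimeM.
  by apply; rewrite [b * b']mulrC {1}rmorphM -mulrA ez -rmorphM h mulrC !rmorphM -ez' mulrA.
have Gtot s : exists z, G s z.
  have [a [b [t [bq nt e]]]] := point_frac nD s.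
  have [c hc] := to_RQ_invertible (lo D) bq.
  by exists (c * i a), a, b, t; split=> //; rewrite mulrA hc mul1r.
have GB s s' z z' : G s z -> G s' z' -> G (s - s') (z - z').
  move=> [a [b [t [bq nt e ez]]]] [a' [b' [t' [bq' nt' e' ez']]]].
  exists (b' * a - b * a'), (b * b'), (t * t'); split.
  - exact: nprimeM.
  - exact: nmaxM.
  - rewrite rmorphB !rmorphM.
    transitivity (t' * f b' * (t * (f b * s - f a)) - t * f b * (t' * (f b' * s' - f a'))).
      by ring.
    by rewrite e e' !mulr0 subr0.
  - by rewrite rmorphB !rmorphM -ez -ez'; ring.
have GM s s' z z' : G s z -> G s' z' -> G (s * s') (z * z').
  move=> [a [b [t [bq nt e ez]]]] [a' [b' [t' [bq' nt' e' ez']]]].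
  exists (a * a'), (b * b'), (t * t'); split.
  - exact: nprimeM.
  - exact: nmaxM.
  - rewrite !rmorphM.
    transitivity (t' * (f b' * s') * (t * (f b * s - f a)) + t * f a * (t' * (f b' * s' - f a'))).
      by ring.
    by rewrite e e' !mulr0 addr0.
  - by rewrite !rmorphM -ez -ez'; ring.
have Gf r : G (f r) (i r).
  exists r, 1, 1; split; [exact: prime1 | exact: max1 | | by rewrite rmorph1 mul1r].
  by rewrite rmorph1 !mul1r subrr.
have [pi hpi] := choice Gtot.
have piB : zmod_morphism pi by move=> x y; apply: Guniq (hpi _) (GB _ _ _ _ _ _).
have piM : monoid_morphism pi.
  split; last by move=> x y; apply: Guniq (hpi _) (GM _ _ _ _ _ _).
  apply: Guniq (hpi _) _; rewrite -(rmorph1 f) -(rmorph1 i); exact: Gf.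
pose p := HB.pack_for {rmorphism S -> RQ (lo D) (hi D)} pi
  (GRing.isZmodMorphism.Build _ _ pi piB) (GRing.isMonoidMorphism.Build _ _ pi piM).
exists p; split=> [r|s|s]; first exact: Guniq (hpi _) (Gf r).
  have [a [b [t [bq nt e ez]]]] := hpi s; split=> [s0|[u nu us]].
    have /(to_RQ_eq0 (@lo_hi _ D))/loD[u nu ua] : i a = 0.
      by rewrite -ez -[pi s]/(p s) s0 mulr0.
    exists (u * t * f b).
      by apply: nmaxM; [| exact: nmaxM | rewrite -hiD].
    transitivity (u * (t * (f b * s - f a)) + t * (u * f a)); first by ring.
    by rewrite e ua !mulr0 addr0.
  apply: (invertible_mul_eq0 (to_RQ_invertible (lo D) bq)).
  rewrite [LHS]ez; apply/(to_RQ_eq0 (@lo_hi _ D))/loD.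
  exists (u * t); first exact: nmaxM.
  transitivity (t * f b * (u * s) - u * (t * (f b * s - f a))); first by ring.
  by rewrite us e !mulr0 subr0.
have [a [b [t [bq nt e ez]]]] := hpi s.
rewrite (RQ_invertibleP (@lo_hi _ D) bq ez) hiD.
have nfb : ~ n (f b) by rewrite -hiD.
have nd : n (f b * s - f a).
  apply: contrapT => h; apply: (nmaxM nmax nt h); rewrite e; exact: max0.
split=> h ns; apply: h.
  by rewrite -[f a](subKr (f b * s)); apply: (maxB nmax) => //; exact: maxMl.
apply: contrapT => ns'; apply: (nmaxM nmax nfb ns').
by rewrite -[f b * s](subrK (f a)); exact: maxD.
Qed.

(** Both maximal ideals give maps from [S] to the same ring that agree on [R], hence coincide; each
    ideal consists of the elements with non-invertible image. *)
Lemma point_inj n n' D : point n D -> point n' D -> n = n'.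
Proof.
move=> /point_map[p [pf _ pn]] /point_map[p' [pf' _ pn']].
have e : p =1 p' by apply: fE => r /=; rewrite pf pf'.
apply/seteqP; split=> s ns; apply: contrapT => /[dup] ns'.
  by move=> /pn'; rewrite -e => /pn.
by move=> /pn; rewrite e => /pn'.
Qed.

Definition spec : set (admInterval R) := [set D | exists n, point n D].

Lemma spec_point : exists nn : admInterval R -> set S,
  forall D, spec D -> point (nn D) D.
Proof.
have /choice[g hg] : forall D, exists n, spec D -> point n D.
  move=> D; have [[n h]|h] := pselect (spec D); first by exists n.
  (* A dummy value outside [spec]. *)
  by exists setT.
by exists g.
Qed.

Definition nn : admInterval R -> set S := projT1 (cid spec_point).
Lemma nnP D : spec D -> point (nn D) D. Proof. exact: projT2 (cid spec_point) D. Qed.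
Lemma nn_max D : spec D -> is_maximal_ideal (nn D).
Proof. by move=> /nnP[]. Qed.

(* The component of [s] in [R_q/j] at [D = [j, q]] is zero. *)
Definition Z D s := vanish (nn D) s.

Section OnePoint.
Variable D : admInterval R.
Hypothesis ID : spec D.

Lemma hiE r : pset (hi D) r <-> nn D (f r). Proof. by case: (nnP ID). Qed.
Lemma loE r : pset (lo D) r <-> Z D (f r). Proof. by case: (nnP ID). Qed.

Lemma Z0 : Z D 0.
Proof. by exists 1; [exact/max1/nn_max | rewrite mulr0]. Qed.
Lemma ZMl s t : Z D t -> Z D (s * t).
Proof. by move=> [u nu e]; exists u => //; rewrite mulrCA e mulr0. Qed.
Lemma ZMr s t : Z D s -> Z D (s * t).
Proof. by rewrite mulrC; exact: ZMl. Qed.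
Lemma ZD s t : Z D s -> Z D t -> Z D (s + t).
Proof.
move=> [u nu e] [v nv e']; exists (u * v); first exact/nmaxM/nv/nu/nn_max.
by rewrite mulrDr {1}[u * v]mulrC -!mulrA e e' !mulr0 addr0.
Qed.
Lemma Z_unit s t : ~ nn D s -> Z D (s * t) -> Z D t.
Proof.
move=> ns [u nu e]; exists (u * s); first exact/nmaxM/ns/nu/nn_max.
by rewrite -mulrA.
Qed.
Lemma Z_nn s : Z D s -> nn D s.
Proof.
move=> [u nu e]; apply: contrapT => ns; apply: (nmaxM (nn_max ID) nu ns).
by rewrite e; exact: max0 (nn_max ID).
Qed.
Lemma nn_frac s : exists a b, ~ pset (hi D) b /\ Z D (f b * s - f a).
Proof.
have [a [b [t [hb ht e]]]] := point_frac (nnP ID) s.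
by exists a, b; split=> //; exists t.
Qed.
Lemma Z_prime s t : Z D (s * t) -> Z D s \/ Z D t.
Proof.
have [p [_ pZ _]] := point_map (nnP ID).
move=> /pZ; rewrite rmorphM => /(RQ_mul_eq0 (@lo_hi _ D))[/pZ h|/pZ h].
  by left.
by right.
Qed.

Lemma lo_nn r : pset (lo D) r -> nn D (f r).
Proof. by move=> /loE/Z_nn. Qed.

End OnePoint.

Lemma spec_cover (a : set S) : is_ideal a -> ~ a 1 ->
  exists2 D, spec D & a `<=` nn D.
Proof.
move=> aI a1; have [n [nmax an]] := maximal_over aI a1.
have [D nD] := point_exists nmax; have ID : spec D by exists n.
by exists D => //; rewrite (point_inj (nnP ID) nD).
Qed.

Lemma spec_all (a : set S) : is_ideal a ->
  (forall D, spec D -> exists2 s, a s & ~ nn D s) -> a 1.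
Proof.
move=> aI h; apply: contrapT => /(spec_cover aI)[D ID aD].
by have [s /aD] := h D ID.
Qed.

Lemma ann_ideal (u : S) : is_ideal (fun t => t * u = 0).
Proof.
split=> [|x y ex ey|a x ex]; first exact: mul0r.
  by rewrite mulrDl ex ey addr0.
by rewrite -mulrA ex mulr0.
Qed.

Lemma Z_all s : (forall D, spec D -> Z D s) -> s = 0.
Proof.
move=> h; rewrite -[s]mul1r; apply: (spec_all (ann_ideal s)) => D ID.
by have [t nt e] := h D ID; exists t.
Qed.

(** The source of all new points of the spectrum. A prime [P] of [S] containing [a] and contracting
    to [p] is chosen below the maximal ideal. It bounds [lo D] by [p]: an element killed by some [t]
    outside [nn D] lies in [P]. *)
Lemma spec_prime (a : set S) (p : primeIdeal R) : is_ideal a ->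
  (forall x, pset p x -> a (f x)) -> (forall x, a (f x) -> pset p x) ->
  exists D, [/\ spec D, pset (lo D) `<=` pset p, pset p `<=` pset (hi D),
    a `<=` nn D & forall u, (forall t, t * u = 0 -> a t) -> ~ Z D u].
Proof.
move=> aI pa ap.
have T1 : exists2 r, ~ pset p r & 1 = f r by exists 1; [exact: prime1 | rewrite rmorph1].
have TM x y : (exists2 r, ~ pset p r & x = f r) -> (exists2 r, ~ pset p r & y = f r) ->
    exists2 r, ~ pset p r & x * y = f r.
  by move=> [r nr ->] [s ns ->]; exists (r * s); [exact: nprimeM | rewrite rmorphM].
have [|P [PP aP PT]] := @prime_avoiding S
    (@MultSet S (fun s => exists2 r, ~ pset p r & s = f r) T1 TM) a aI.
  by move=> x ax [r nr e]; apply/nr/ap; rewrite -e.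
have [PI P1 Pprime] := PP; have [D ID PD] := spec_cover PI P1.
have fP x : P (f x) -> pset p x.
  by move=> Px; apply: contrapT => nx; apply: (PT _ Px); exists x.
have nnP' t s : ~ nn D t -> t * s = 0 -> P s.
  move=> nt e; have [|Pt|//] := Pprime t s; first by rewrite e; case: PI.
  by case: nt; exact: PD.
exists D; split=> //.
- by move=> r /(loE ID)[t nt e]; apply: fP; exact: nnP' nt e.
- by move=> r /pa/aP/PD/(hiE ID).
- by move=> s /aP/PD.
- by move=> u hu [t nt e]; apply/nt/PD/aP/hu.
Qed.

(** * Order and chain conditions of the spectrum *)

Lemma prime_total (p q : primeIdeal R) :
  pset p `<=` pset q \/ pset q `<=` pset p.
Proof. by case: (psetP p) (psetP q) => pI _ _ [qI _ _]; exact: hR. Qed.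

Lemma not_subset (T : Type) (A B : set T) :
  ~ (A `<=` B) -> exists2 x, A x & ~ B x.
Proof.
move=> h; apply: contrapT => nx; apply: h => x Ax.
by apply: contrapT => nB; apply: nx; exists x.
Qed.

Lemma lt_witness (D E : admInterval R) : interval_lt D E ->
  exists2 r, pset (lo E) r & ~ pset (hi D) r.
Proof. by move=> [_ /not_subset]. Qed.

(** The map for [D] factors through the one for [D'], since both agree on [R]. Units go to units, so
    [nn D] lies in [nn D'], and maximality gives equality. *)
Lemma spec_same_lo D D' : spec D -> spec D' -> pset (lo D') `<=` pset (lo D) ->
  pset (hi D) `<=` pset (hi D') -> pset (hi D') `<=` pset (hi D).
Proof.
move=> ID ID' jj qq.
have [p [pf _ pn]] := point_map (nnP ID).
have [p' [pf' _ pn']] := point_map (nnP ID').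
have e : RQ_map jj qq \o p' =1 p by apply: fE => r /=; rewrite pf' pf RQ_map_to_RQ.
have sub : nn D `<=` nn D'.
  move=> s ns; apply: contrapT => /pn'/(rmorph_invertible (RQ_map jj qq)).
  by rewrite [RQ_map _ _ _]e => /pn.
have [_ _ nX] := nn_max ID; have [DI DT _] := nn_max ID'.
by have [e'|//] := nX _ DI sub; move=> r /(hiE ID'); rewrite e' => /(hiE ID).
Qed.

Lemma spec_chain : subchain spec.
Proof.
suff half D D' : spec D -> spec D' -> pset (lo D) `<=` pset (lo D') ->
    interval_le D D'.
  move=> D D' ID ID'; have [h|h] := prime_total (lo D) (lo D').
    by left; exact: half.
  by right; exact: half.
move=> ID ID' jj; have [jq|jq] := pselect (pset (lo D') `<=` pset (hi D)); last first.
  by right; split=> //; have [/jq|] := prime_total (lo D') (hi D).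
left; have [p [pf pZ _]] := point_map (nnP ID).
have [p' [pf' _ pn']] := point_map (nnP ID').
have j'j : pset (lo D') `<=` pset (lo D).
  move=> a aj'; apply: contrapT => aj; have /(loE ID')[u nu ua] := aj'.
  have Zu : Z D u.
    have [//|/(loE ID)//] : Z D u \/ Z D (f a).
    by apply: (Z_prime ID); rewrite ua; exact: Z0.
  have sub : pset (lo D') `<=` pset (lo D') by [].
  (* Overlapping intervals both map to Frac(R/lo D'), and the two maps from [S] agree. There [u]
     would be zero through [D] and a unit through [D']. *)
  have e : RQ_map jj jq \o p =1 RQ_map sub (@lo_hi _ D') \o p'.
    by apply: fE => r /=; rewrite pf' pf !RQ_map_to_RQ.
  have := rmorph_invertible (RQ_map sub (@lo_hi _ D')) (proj2 (pn' u) nu).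
  rewrite -[RQ_map sub _ _]e /= (proj2 (pZ u) Zu) rmorph0 => -[y].
  by rewrite mul0r => /esym/(RQ_1_neq0 sub).
have loeq : lo D = lo D' by apply/prime_ext/seteqP.
apply: interval_ext => //; apply/prime_ext/seteqP.
have [qq|qq] := prime_total (hi D) (hi D'); split=> //; exact: spec_same_lo.
Qed.

Lemma spec_cmp D E : spec D -> spec E -> interval_le D E \/ interval_lt E D.
Proof.
move=> ID IE; have [|[->|]] := spec_chain ID IE; by [left | left; left | right].
Qed.

Lemma Z_unit_above D E r : spec D -> ~ pset (hi E) r -> interval_le D E ->
  ~ nn D (f r).
Proof. by move=> ID nr /interval_le_hi DE /(hiE ID)/DE. Qed.

(** Some [r] in [lo E] is a unit at all points up to [D], so an element [x] killing [f r] vanishes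
    there. *)
Lemma separate_above D E : spec D -> spec E -> interval_lt D E ->
  exists x r, [/\ ~ nn E x, forall G, spec G -> interval_le G D -> Z G x,
    ~ pset (hi D) r & f r * x = 0].
Proof.
move=> ID IE DE; have [r rE rD] := lt_witness DE.
have /(loE IE)[x nx xr] := rE; exists x, r; split=> //; last by rewrite mulrC.
move=> G IG GD; apply: (Z_unit IG (Z_unit_above IG rD GD)).
by rewrite mulrC xr; exact: Z0.
Qed.

(* [F] is the least interval of the support of some [u]. *)
Definition start F := exists u,
  (forall r, pset (lo F) r <-> f r * u = 0) /\ ~ Z F u.

(** The annihilator of [u] in [R] is proper and idempotent, hence prime, and [spec_prime] applies to
    the annihilator of [u] in [S]. As [u] does not vanish at [F], whatever kills [u] lies in
    [lo F]. *)
Lemma support_start u : u <> 0 -> exists F, [/\ spec F,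
  forall r, pset (lo F) r <-> f r * u = 0 & ~ Z F u].
Proof.
move=> u0; have pI : is_ideal (fun r => f r * u = 0).
  split; first by rewrite rmorph0 mul0r.
    by move=> x y ex ey; rewrite rmorphD mulrDl ex ey addr0.
  by move=> a x ex; rewrite rmorphM -mulrA ex mulr0.
have p1 : ~ f 1 * u = 0 by rewrite rmorph1 mul1r.
have pP : is_prime (fun r => f r * u = 0).
  by apply: (idempotent_prime hR pI p1) => a /fA[b [c [? ? ?]]]; exists b, c.
have [//|//|F [IF loF _ _ nZ]] := @spec_prime (fun t => t * u = 0) (Prime pP) (ann_ideal u).
have nZu : ~ Z F u by exact: nZ.
exists F; split=> // r; split=> [/loF //|ru].
apply/(loE IF); have [//|//] : Z F (f r) \/ Z F u.
by apply: (Z_prime IF); rewrite ru; exact: Z0.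
Qed.

(** [v] is a denominator witnessing [u = a / b] at [F]. Below [F] the element [u] vanishes, so
    [v * f a] does too; if [f a] vanished at such a point, then [a] would lie in [lo F] and [u]
    would vanish at [F]. *)
Lemma start_unit F : spec F -> start F -> exists v, ~ nn F v /\
  forall G, spec G -> interval_lt G F -> Z G v.
Proof.
move=> IF [u [annu nZ]]; have [a [b [nb [v nv e]]]] := nn_frac IF u.
exists v; split=> // G IG GF; have [r rF rG] := lt_witness GF.
have Zu : Z G u.
  have nr : ~ nn G (f r) by move/(hiE IG).
  by apply: (Z_unit IG nr); have /annu -> := rF; exact: Z0.
have : Z G (v * f a).
  have -> : v * f a = v * f b * u - v * (f b * u - f a) by ring.
  by rewrite e subr0; exact: ZMl.
move=> /(Z_prime IG)[//|/(loE IG) aG]; case: nZ.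
have nfb : ~ nn F (f b) by move/(hiE IF).
apply: (Z_unit IF nfb); rewrite -[f b * u](subrK (f a)); apply: (ZD IF).
  by exists v.
by apply/(loE IF); case: GF => + _; apply; exact: lo_hi.
Qed.

Definition ext_ideal (p : primeIdeal R) : set S :=
  [set x | exists r s, pset p r /\ x = f r * s].

Lemma ext_idealP p : is_ideal (ext_ideal p).
Proof.
split; first by exists 0, 0; rewrite mulr0; split=> //; exact: prime0.
  move=> _ _ [r [s [pr ->]]] [r' [s' [pr' ->]]].
  have [[c e]|[c e]] := valuation_dvd hR r r'.
    by exists r', (f c * s + s'); split=> //; rewrite e rmorphM; ring.
  by exists r, (s + f c * s'); split=> //; rewrite e rmorphM; ring.
by move=> a _ [r [s [pr ->]]]; exists r, (a * s); split=> //; ring.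
Qed.

Lemma ext_ideal_mem (p : primeIdeal R) r : pset p r -> ext_ideal p (f r).
Proof. by move=> pr; exists r, 1; rewrite mulr1. Qed.

Lemma start_gap F : spec F -> start F -> exists r s k,
  [/\ pset (lo F) r, forall G, spec G -> interval_lt G F -> Z G k &
      1 = f r * s + k].
Proof.
move=> IF sF; pose K k := forall G, spec G -> interval_lt G F -> Z G k.
pose a x := exists y k, [/\ ext_ideal (lo F) y, K k & x = y + k].
have [extI extD extM] := ext_idealP (lo F).
have K0 : K 0 by move=> G IG _; exact: Z0.
suff : a 1.
  by move=> [_ [k [[r [s [Fr ->]]] Kk e]]]; exists r, s, k.
apply: spec_all => [|H IH].
  split; first by exists 0, 0; rewrite addr0.
    move=> _ _ [y [k [ey Kk ->]]] [y' [k' [ey' Kk' ->]]].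
    exists (y + y'), (k + k'); split; [exact: extD | | by rewrite addrACA].
    by move=> G IG GF; apply: (ZD IG); [exact: Kk | exact: Kk'].
  move=> c _ [y [k [ey Kk ->]]]; exists (c * y), (c * k).
  split; [exact: extM | | exact: mulrDr].
  by move=> G IG GF; apply: ZMl; exact: Kk.
have aK k : K k -> a k by exists 0, k; rewrite add0r.
have [[->|HF]|FH] := spec_cmp IH IF.
- by have [v [nv Kv]] := start_unit IF sF; exists v => //; exact: aK.
- have [r rF rH] := lt_witness HF; exists (f r); last by move/(hiE IH).
  by exists (f r), 0; rewrite addr0; split=> //; exact: ext_ideal_mem.
have [x [_ [nx Kx _ _]]] := separate_above IF IH FH.
by exists x => //; apply: aK => G IG GF; apply: Kx => //; right.
Qed.

Lemma union_prime (A : set (admInterval R)) (p : admInterval R -> primeIdeal R) :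
  A !=set0 -> is_prime (\bigcup_(D in A) pset (p D)).
Proof.
move=> [D0 AD0]; split.
- split; first by exists D0 => //; exact: prime0.
    move=> x y [D AD Dx] [E AE Ey]; have [DE|ED] := prime_total (p D) (p E).
      by exists E => //; apply: primeD => //; exact: DE.
    by exists D => //; apply: primeD => //; exact: ED.
  by move=> a x [D AD Dx]; exists D => //; exact: primeMl.
- by move=> [D _ /prime1].
- by move=> x y [D AD /primeM[]]; [left | right]; exists D.
Qed.

(** Let [p] be the union of the upper ends below [F]. The ideal generated by [p] and [k] contracts
    to [p] because [k] vanishes below [F], so it lies in some [nn H] with [p] inside [hi H]. Since
    [k] is in [nn H], the identity [e1] keeps [H] below [F]. *)
Lemma start_pred F : spec F -> start F ->
  (exists2 G, spec G & interval_lt G F) ->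
  exists A, [/\ spec A, interval_lt A F &
    forall G, spec G -> interval_lt G F -> interval_le G A].
Proof.
move=> IF sF [G0 IG0 G0F]; have [r [s [k [rF Kk e1]]]] := start_gap IF sF.
have pP : is_prime (\bigcup_(G in spec `&` (fun G => interval_lt G F)) pset (hi G)).
  by apply: union_prime; exists G0.
set p := Prime pP.
have [x px|x|H [IH _ pH aH _]] := @spec_prime (adjoin (ext_ideal p) k) p
  (adjoin_ideal k (ext_idealP p)).
- by exists (f x), 0; rewrite mul0r addr0; split=> //; exact: ext_ideal_mem.
- move=> [_ [t [[x' [y [[G [IG GF] Gx'] ->]]] e]]]; exists G => //.
  have nnG := nn_max IG; apply/(hiE IG); rewrite e; apply: (maxD nnG).
    by apply: maxMr => //; apply/(hiE IG).
  by apply: maxMl => //; apply: Z_nn => //; exact: Kk.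
have nnH := nn_max IH.
have kH : nn H k.
  by apply: aH; exists 0, 1; rewrite add0r mul1r; split=> //; case: (ext_idealP p).
have HF : interval_lt H F.
  have [FH|//] := spec_cmp IF IH; case: (max1 nnH); rewrite e1.
  apply: (maxD nnH) => //; apply: maxMr => //; apply: lo_nn => //.
  exact: (interval_le_lo FH).
exists H; split=> // G IG GF; have [//|HG] := spec_cmp IG IH.
case: HG => _ []; apply: subset_trans pH => x /(@lo_hi _ G) Gx.
by exists G.
Qed.

(** Without a minimal element, [q] lies in every [lo G], so the extension of [q] to [S] vanishes at
    all points of [A] and contracts to [q]. The point [H] over it cannot lie above any [G] in [A],
    as [lo H] is inside [q]. *)
Lemma spec_C1 : C1 spec.
Proof.
move=> A AI A0 Amin; set q := \bigcap_(E in A) pset (hi E).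
have down G : A G -> exists2 E, A E & interval_lt E G.
  move=> AG; apply: contrapT => nE; apply: Amin; exists G; split=> // E AE EG.
  by apply: nE; exists E.
have q_lo G x : A G -> q x -> pset (lo G) x.
  by move=> /down[E AE [+ _]] qx; apply; exact: qx.
have qP : is_prime q.
  split.
  - split; first by move=> E _; exact: prime0.
      by move=> x y qx qy E AE; apply: primeD; [exact: qx | exact: qy].
    by move=> a x qx E AE; apply: primeMl; exact: qx.
  - by case: A0 => E AE /(_ E AE)/prime1.
  - move=> x y qxy; apply: contrapT => h.
    have [D AD xD] : exists2 D, A D & ~ pset (hi D) x.
      apply: contrapT => nD; apply: h; left => D AD; apply: contrapT => Dx.
      by apply: nD; exists D.
    have [E AE yE] : exists2 E, A E & ~ pset (hi E) y.
      apply: contrapT => nE; apply: h; right => E AE; apply: contrapT => Ey.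
      by apply: nE; exists E.
    have [DE|ED] := prime_total (hi D) (hi E).
      by have [//|/DE] := primeM (qxy D AD).
    by have [/ED|] := primeM (qxy E AE).
set p := Prime qP.
have [||H [IH loH hiH _ _]] := @spec_prime (ext_ideal p) p (ext_idealP p).
- by move=> x; exact: ext_ideal_mem.
- move=> x [r [s [qr e]]] G AG; apply: lo_hi.
  apply/(loE (AI _ AG)); rewrite e; apply: ZMr; apply/(loE (AI _ AG)).
  exact: q_lo.
exists H => //; apply/seteqP; split; last exact: hiH.
move=> x Hx G AG; have [/interval_le_hi|[_ []]] := spec_cmp IH (AI _ AG); first exact.
by apply: subset_trans loH _ => y; exact.
Qed.

(** The union of the lower ends is the contraction of its extension to [S], because an element of
    the extension vanishes at some point of [A]; the point over it is [H]. *)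
Lemma spec_C2 : C2 spec.
Proof.
move=> A AI A0 Amax; pose p := Prime (union_prime (@lo R) A0).
have up G : A G -> exists2 E, A E & interval_lt G E.
  move=> AG; apply: contrapT => nE; apply: Amax; exists G; split=> // E AE GE.
  by apply: nE; exists E.
have [||H [IH loH hiH _ _]] := @spec_prime (ext_ideal p) p (ext_idealP p).
- by move=> x; exact: ext_ideal_mem.
- move=> x [r [s [[G AG Gr] e]]]; exists G => //.
  by apply/(loE (AI _ AG)); rewrite e; apply: ZMr; apply/(loE (AI _ AG)).
exists H => //; apply/seteqP; split; first exact: loH.
move=> x [G AG Gx]; have [HG|[+ _]] := spec_cmp IH (AI _ AG).
  have [E AE [_ []]] := up G AG; apply: subset_trans (interval_le_hi HG).
  by apply: subset_trans hiH => y Ey; exists E.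
by apply; exact: lo_hi.
Qed.

(** An element [x] that vanishes up to [D0] but is a unit at [D1] has a support starting at some [F]
    in between; the predecessor of [F] closes the gap. *)
Lemma spec_C3 : C3 spec.
Proof.
move=> D0 D1 ID0 ID1 lt01.
have [x [r [nx Zx nr rx]]] := separate_above ID0 ID1 lt01.
have x0 : x <> 0 by move=> x0; apply: nx; rewrite x0; exact: max0 (nn_max ID1).
have [F [IF annx nZ]] := support_start x0.
have D0F : interval_lt D0 F.
  have [FD|//] := spec_cmp IF ID0; case: nr; apply: (interval_le_hi FD).
  by apply: lo_hi; apply/annx.
have FD1 : interval_le F D1.
  have [//|/lt_witness[r' rF rD]] := spec_cmp IF ID1; case: nx.
  apply: (Z_nn ID1); have nr' : ~ nn D1 (f r') by move/(hiE ID1).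
  by apply: (Z_unit ID1 nr'); rewrite (proj1 (annx r')) //; exact: Z0.
have [||A [IA AF Amax]] := start_pred IF.
- by exists x.
- by exists D0.
exists A, F; split=> //; first exact: Amax.
split=> // -[E [IE AE EF]].
by case: (interval_le_lt (Amax _ IE EF) AE).
Qed.

Definition spec_good : goodChain R :=
  GoodChain spec_chain spec_C1 spec_C2 spec_C3.


(** [N] collects the elements that vanish on a block around [D], except perhaps at [D]. It generates
    the unit ideal together with [t]: points below and above [D] are cut off by gaps. In
    [1 = y + c * t] the term [y] drops out on the block. *)
Lemma unit_neighbourhood D t : spec D -> ~ nn D t -> exists F E,
  [/\ left_end spec F, right_end spec E, interval_le F D, interval_le D E &
      forall G, spec G -> interval_le F G -> interval_le G E -> ~ nn G t].
Proof.
move=> ID nt.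
pose N s := exists F E, [/\ left_end spec F, right_end spec E, interval_le F D,
  interval_le D E & forall G, spec G -> interval_le F G -> interval_le G E ->
    G <> D -> Z G s].
have [E0 [rE0 DE0 _]] := @right_end_approx R spec_good D 1 ID (@prime1 _ _).
have [F0 [lF0 FD0 _]] := @left_end_approx R spec_good D 0 ID (@prime0 _ _).
have NI : is_ideal N.
  split.
  - by exists F0, E0; split=> // G IG _ _ _; exact: Z0.
  - move=> x y [F [E [lF rE FD DE Zx]]] [F' [E' [lF' rE' FD' DE' Zy]]].
    have [F1 [lF1 FD1 FF1 FF1']] : exists F1, [/\ left_end spec F1, interval_le F1 D,
        interval_le F F1 & interval_le F' F1].
      have [h|h] := spec_chain lF.1 lF'.1.
        by exists F'; split=> //; exact: interval_lexx.
      by exists F; split=> //; exact: interval_lexx.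
    have [E1 [rE1 DE1 EE1 EE1']] : exists E1, [/\ right_end spec E1, interval_le D E1,
        interval_le E1 E & interval_le E1 E'].
      have [h|h] := spec_chain rE.1 rE'.1.
        by exists E; split=> //; exact: interval_lexx.
      by exists E'; split=> //; exact: interval_lexx.
    exists F1, E1; split=> // G IG FG GE GD; apply: (ZD IG).
      apply: Zx => //; [exact: interval_le_trans FG | exact: interval_le_trans EE1].
    apply: Zy => //; [exact: interval_le_trans FG | exact: interval_le_trans EE1'].
  - move=> a x [F [E [lF rE FD DE Zx]]]; exists F, E; split=> // G IG FG GE GD.
    by apply: ZMl; exact: Zx.
have N0 : N 0 by case: NI.
have : adjoin N t 1.
  apply: spec_all => [|H IH]; first exact: adjoin_ideal.
  have aN x : N x -> adjoin N t x by move=> Nx; exists x, 0; rewrite mul0r addr0.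
  have [[->|HD]|DH] := spec_cmp IH ID.
  - by exists t => //; exists 0, 1; rewrite mul1r add0r.
  - have [A [F [adj HA FD]]] := adjacent_between (C := spec_good) IH ID HD.
    have [_ IF AF _] := adj; have [r rF rH] := lt_witness (interval_le_lt_trans HA AF).
    exists (f r); last by move/(hiE IH).
    apply: aN; exists F, E0; split=> //; first exact: (adjacent_left adj).
    by move=> G IG FG _ _; apply/(loE IG); exact: interval_le_lo FG _ rF.
  have [A [F [adj DA FH]]] := adjacent_between (C := spec_good) ID IH DH.
  have [IA _ AF _] := adj.
  have [x [_ [nx Zx _ _]]] := separate_above IA IH (interval_lt_le_trans AF FH).
  exists x => //; apply: aN; exists F0, A; split=> //; first exact: (adjacent_right adj).
  by move=> G IG _ GA _; exact: Zx.
move=> [y [c [[F [E [lF rE FD DE Zy]]] e1]]]; exists F, E; split=> // G IG FG GE.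
have [->//|GD] := pselect (G = D); move=> tG; have nnG := nn_max IG.
apply: (max1 nnG); rewrite e1; apply: (maxD nnG); last exact: maxMl.
by apply: (Z_nn IG); exact: Zy.
Qed.

End Spectrum.

(** * The ring of a chain *)

Section DirectUnion.
Variables (R : idomainType) (B : bchain R).
Notation RB := (RI (bc_set B)).
Implicit Types (x y z : RB) (D : set_type (bc_set B)).

Definition dg (r : R) : RB := fun D => to_RQ (lo (\val D)) (hi (\val D)) r.

Lemma gmap_to_RQ r : gmap (to_RQ (lo (bc_min B)) (hi (bc_max B)) r) = dg r.
Proof. by apply: dprod_ext => D; exact: RQ_map_to_RQ. Qed.

Lemma RI_addE x y D : (x + y) D = x D + y D. Proof. by []. Qed.
Lemma RI_mulE x y D : (x * y) D = x D * y D. Proof. by []. Qed.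
Lemma RI_sumE (I : Type) (r : seq I) (F : I -> RB) D :
  (\sum_(i <- r) F i) D = \sum_(i <- r) F i D.
Proof. by elim/big_rec2: _ => // i u v _ <-. Qed.

Lemma mem_val D : bc_set B (\val D). Proof. exact: set_valP. Qed.
Definition idx E (BE : bc_set B E) : set_type (bc_set B) := SigSub (mem_set BE).

(** Clears denominators, so that later arguments use elements of [R] in place of [hullR C]. *)
Lemma restr_frac (C : bchain R) (CB : bc_set C `<=` bc_set B) z :
  (exists y : hullR C, RI_restr CB z = gmap y) <->
  exists a b, ~ pset (hi (bc_max C)) b /\
    forall D, bc_set C (\val D) -> to_RQ _ _ b * z D = to_RQ _ _ a.
Proof.
split=> [[y e]|[a [b [nb h]]]].
  have [a [b [nb ey]]] := RQ_fracE y; exists a, b; split=> // D CD.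
  pose D' : set_type (bc_set C) := SigSub (mem_set CD).
  have := congr1 (fun u : RI (bc_set C) => u D') e.
  have -> : RI_restr CB z D' = z D.
    rewrite /RI_restr /sub_index; case: D CD @D' => d hd CD D' /=.
    exact: RI_irr.
  move=> ->; rewrite /gmap -(RQ_map_to_RQ (@hull_lo _ C D') (@hull_hi _ C D') b).
  by rewrite -rmorphM ey RQ_map_to_RQ.
have [c hc] := to_RQ_invertible (lo (bc_min C)) nb.
exists (c * to_RQ _ _ a); apply: dprod_ext => D.
have iD : ~ pset (hi (\val D)) b by move=> /(@hull_hi _ C D).
apply: (invertible_inj (to_RQ_invertible (lo (\val D)) iD)).
rewrite [LHS](h (sub_index CB D)); last exact: (set_valP D).
rewrite /gmap -(RQ_map_to_RQ (@hull_lo _ C D) (@hull_hi _ C D) b) -rmorphM.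
by rewrite mulrA hc mul1r RQ_map_to_RQ.
Qed.

Lemma im_partitionP (P : chainPartition B) z : im_partition P z <->
  forall l, exists a b, ~ pset (hi (bc_max (pt_block P l))) b /\
    forall D, bc_set (pt_block P l) (\val D) -> to_RQ _ _ b * z D = to_RQ _ _ a.
Proof.
split=> [[y hy] l|h].
  by apply/(restr_frac (@pt_sub _ B P l)); exists (y l).
pose g l := cid (proj2 (restr_frac (@pt_sub _ B P l) z) (h l)).
by exists (fun l => projT1 (g l)) => l; exact: projT2 (g l).
Qed.

Lemma cut_dunion A b z : right_end (bc_set B) A -> ~ pset (hi A) b ->
  (forall D, interval_le (\val D) A -> to_RQ _ _ b * z D = 1) ->
  (forall D, interval_lt A (\val D) -> z D = 0) -> dunion z.
Proof.
move=> [BA [Amax|[F [_ BF AF cut]]]] nb zA zF.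
  (* Blocks are non-empty, so when [A] is the top no second block exists and the trivial partition
     is used. *)
  have eA : bc_max B = A.
    apply: interval_le_anti; last exact: bc_max_ge.
    by apply: Amax; case: (bc_maxP B).
  have [y hy] : exists y : hullR B, RI_restr (@subset_refl _ (bc_set B)) z = gmap y.
    apply/restr_frac; exists 1, b; rewrite eA; split=> // D BD.
    by rewrite rmorph1; apply/zA/Amax.
  have -> : z = gmap y; last exact: im_gmap.
  rewrite -hy; apply: dprod_ext => D; rewrite /RI_restr /sub_index.
  by case: D => d hd; exact: RI_irr.
have c1 : subchain (bc_set B `&` (fun G => interval_le G A)).
  by move=> D E [BD _] [BE _]; exact: (bc_chain BD BE).
have [Bm Bmin] := bc_minP B; have [BM Bmax] := bc_maxP B.
have m1 : minimal_in (bc_set B `&` (fun G => interval_le G A)) (bc_min B).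
  by split; [split=> //; exact: bc_min_le | move=> E [BE _]; exact: Bmin].
have M1 : maximal_in (bc_set B `&` (fun G => interval_le G A)) A.
  by split; [split=> //; left | move=> E [_ /interval_le_lt]].
have c2 : subchain (bc_set B `&` (fun G => interval_le F G)).
  by move=> D E [BD _] [BE _]; exact: (bc_chain BD BE).
have m2 : minimal_in (bc_set B `&` (fun G => interval_le F G)) F.
  by split; [split=> //; left | move=> E [_ /interval_le_lt]].
have M2 : maximal_in (bc_set B `&` (fun G => interval_le F G)) (bc_max B).
  by split; [split=> //; exact: bc_max_ge | move=> E [BE _]; exact: Bmax].
pose C1 := BChain c1 m1 M1; pose C2 := BChain c2 m2 M2.
pose blk (l : 'I_2) := if l == ord0 then C1 else C2.
have cov : bc_set B = \bigcup_l bc_set (blk l).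
  apply/seteqP; split=> [D BD|D [l _]].
    by have [DA|FD] := cut D BD; [exists ord0 | exists ord_max].
  by rewrite /blk; case: ifP => _ [].
have lt (j l : 'I_2) : (j < l)%N -> forall G H,
    bc_set (blk j) G -> bc_set (blk l) H -> interval_lt G H.
  case: j => [[|[|//]] hj]; case: l => [[|[|//]] hl] //= _ D E [_ DA] [_ FE].
  exact: interval_le_lt_trans DA (interval_lt_le_trans AF FE).
have dis : trivIset setT (fun l => bc_set (blk l)).
  move=> j l _ _ [D [jD lD]]; case: (ltngtP j l) => [jl|lj|/val_inj //].
    by case: (interval_ltxx (lt _ _ jl _ _ jD lD)).
  by case: (interval_ltxx (lt _ _ lj _ _ lD jD)).
exists (Partition cov dis lt); apply/im_partitionP => l /=; rewrite /blk.
case: ifP => _.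
  by exists 1, b; split=> // D [_ DA]; rewrite rmorph1; exact: zA.
exists 0, 1; split=> [|D [_ FD]]; first exact: prime1.
by rewrite rmorph0 zF ?mulr0 //; exact: interval_lt_le_trans FD.
Qed.

(** The inverse of [b] up to [A], and zero above. For [b = 1] it is the idempotent of the part up to
    [A]. *)
Definition cut_inv (A : admInterval R) (b : R) : RB := fun D =>
  if `[< interval_le (\val D) A >] then xget 0 [set w | to_RQ _ _ b * w = 1] else 0.

Lemma cut_inv_le A b D : ~ pset (hi A) b -> interval_le (\val D) A ->
  to_RQ _ _ b * cut_inv A b D = 1.
Proof.
move=> nb DA; rewrite /cut_inv; case: asboolP => // _.
have [w hw] : invertible (to_RQ (lo (\val D)) (hi (\val D)) b).
  by apply: to_RQ_invertible => /(interval_le_hi DA).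
exact: (@xgetPex _ 0 [set w | to_RQ _ _ b * w = 1] (ex_intro _ w hw)).
Qed.

Lemma cut_inv_gt A b D : interval_lt A (\val D) -> cut_inv A b D = 0.
Proof. by move=> AD; rewrite /cut_inv; case: asboolP => // /interval_le_lt. Qed.

Lemma dunion_cut_inv A b : right_end (bc_set B) A -> ~ pset (hi A) b ->
  dunion (cut_inv A b).
Proof.
move=> rA nb; apply: (cut_dunion rA nb) => D; first exact: cut_inv_le.
exact: cut_inv_gt.
Qed.

Definition start_idem (F : admInterval R) : RB := fun D =>
  if `[< interval_le F (\val D) >] then 1 else 0.

Lemma start_idem_ge F D : interval_le F (\val D) -> start_idem F D = 1.
Proof. by rewrite /start_idem; case: asboolP. Qed.

Lemma start_idem_lt F D : interval_lt (\val D) F -> start_idem F D = 0.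
Proof. by move=> DF; rewrite /start_idem; case: asboolP => // /interval_le_lt. Qed.

Lemma RI_cmp D (E : admInterval R) : bc_set B E ->
  interval_le (\val D) E \/ interval_lt E (\val D).
Proof. by apply: subchain_cmp; [exact: bc_chain | exact: mem_val]. Qed.

Lemma dgE r D : dg r D = to_RQ _ _ r. Proof. by []. Qed.

Section Induction.
Variable Q : RB -> Prop.
Hypothesis Qdg : forall r, Q (dg r).
Hypothesis QD : forall x y, Q x -> Q y -> Q (x + y).
Hypothesis QM : forall x y, Q x -> Q y -> Q (x * y).
Hypothesis Qinv : forall r z, dunion z ->
  dg r * dg r * z = dg r -> z * z * dg r = z -> Q z.

(** If [A] has a successor [F], choose [r] in [lo F] outside [hi A]. Then [r * b] is a unit up to
    [A] and zero from [F] on, so its quasi-inverse is [cut_inv A (r * b)], and multiplying by [r]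
    gives [cut_inv A b]. *)
Lemma Q_cut_inv A b : right_end (bc_set B) A -> ~ pset (hi A) b -> Q (cut_inv A b).
Proof.
move=> rA nb; have [BA [Amax|[F [_ BF AF cut]]]] := rA.
  have h : dg b * cut_inv A b = 1.
    by apply: dprod_ext => D; apply: cut_inv_le => //; apply: Amax; exact: mem_val.
  apply: (Qinv (r := b) (dunion_cut_inv rA nb)); first by rewrite -mulrA h mulr1.
  by rewrite mulrC mulrA h mul1r.
have [r rF rA'] := lt_witness AF.
have nrb := nprimeM rA' nb.
have above D : interval_lt A (\val D) -> dg (r * b) D = 0.
  move=> AD; have [DA|FD] := cut _ (mem_val D); first by case: (interval_le_lt DA AD).
  apply/(to_RQ_eq0 (@lo_hi _ _)); apply: primeMr; exact: (interval_le_lo FD).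
have -> : cut_inv A b = dg r * cut_inv A (r * b).
  apply: dprod_ext => D; rewrite RI_mulE; have [DA|AD] := RI_cmp D BA.
    have hb : ~ pset (hi (\val D)) b by move=> /(interval_le_hi DA).
    apply: (invertible_inj (to_RQ_invertible (lo (\val D)) hb)).
    by rewrite cut_inv_le // mulrA -rmorphM mulrC mulrC [b * r]mulrC cut_inv_le.
  by rewrite !cut_inv_gt // mulr0.
apply: QM => //; apply: (Qinv (r := r * b) (dunion_cut_inv rA nrb)); apply: dprod_ext => D;
  rewrite !RI_mulE; have [DA|AD] := RI_cmp D BA.
- by rewrite -mulrA dgE cut_inv_le // mulr1.
- by rewrite above // mul0r mul0r.
- by rewrite mulrC mulrA dgE cut_inv_le // mul1r.
- by rewrite cut_inv_gt // !mul0r.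
Qed.

Lemma Q_start_idem F : left_end (bc_set B) F -> Q (start_idem F).
Proof.
move=> [BF [Fmin|[A [BA _ AF cut]]]].
  have -> : start_idem F = dg 1; last exact: Qdg.
  apply: dprod_ext => D; rewrite start_idem_ge ?dgE ?rmorph1 //.
  by apply: Fmin; exact: mem_val.
have -> : start_idem F = dg 1 + dg (-1) * cut_inv A 1.
  apply: dprod_ext => D; rewrite RI_addE RI_mulE !dgE rmorphN rmorph1 mulN1r.
  have [DA|FD] := cut _ (mem_val D).
    rewrite start_idem_lt; last exact: interval_le_lt_trans DA AF.
    have := cut_inv_le (@prime1 _ (hi A)) DA; rewrite rmorph1 mul1r => ->.
    by rewrite subrr.
  by rewrite start_idem_ge // cut_inv_gt ?subr0 //; exact: interval_lt_le_trans FD.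
apply: QD => //; apply: QM => //; apply: Q_cut_inv; last exact: prime1.
by split=> //; right; exists F.
Qed.

(** Elements of [R_(I)] are generated from [R] by sums, products and quasi-inverses: on block [l]
    the element is [a l / b l], and [cut_inv] and [start_idem] confine this fraction to the
    block. *)
Lemma dunion_ind z : dunion z -> Q z.
Proof.
move=> [P /im_partitionP h].
have /choice[a /choice[b hab]] := h.
pose A l := bc_max (pt_block P l); pose F l := bc_min (pt_block P l).
have BA l : bc_set B (A l) by apply: (@pt_sub _ _ P l); case: (bc_maxP (pt_block P l)).
have BF l : bc_set B (F l) by apply: (@pt_sub _ _ P l); case: (bc_minP (pt_block P l)).
have AP l : bc_set (pt_block P l) (A l) by case: (bc_maxP (pt_block P l)).
have FP l : bc_set (pt_block P l) (F l) by case: (bc_minP (pt_block P l)).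
have blk E : bc_set B E -> exists l, bc_set (pt_block P l) E.
  by rewrite {1}(pt_cover P) => -[l _]; exists l.
have rA l : right_end (bc_set B) (A l).
  split=> //; have [lmax|lmax] := eqVneq (l : nat) (pt_n P).
    left=> E /blk[k kE]; have [kl|kl] := leqP l k; last by right; exact: pt_lt kl _ _ kE (AP l).
    have -> : l = k.
      by apply/val_inj/eqP; rewrite eqn_leq kl /= lmax -ltnS.
    exact: bc_max_ge.
  (* The successor of the last interval of a block is the first interval of the next block. *)
  have ln : (l.+1 < (pt_n P).+1)%N by rewrite ltnS ltn_neqAle lmax -ltnS /=.
  right; exists (F (Ordinal ln)); split=> //.
    by apply: (pt_lt (j := l) (l := Ordinal ln)) (AP l) (FP _) => /=.
  move=> E /blk[k kE]; have [kl|kl] := leqP k l.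
    left; move: kl; rewrite leq_eqVlt => /orP[/eqP/val_inj e|kl].
      by rewrite e in kE; exact: bc_max_ge.
    by right; exact: pt_lt kl _ _ kE (AP l).
  right; move: (kl); rewrite leq_eqVlt => /orP[/eqP e|kl'].
    by apply: bc_min_le; have -> : Ordinal ln = k by exact/val_inj.
  by right; apply: (pt_lt (j := Ordinal ln) (l := k)) (FP _) kE.
have lF l : left_end (bc_set B) (F l).
  split=> //; have [l0|l0] := eqVneq (l : nat) 0%N.
    left=> E /blk[k kE]; have [kl|kl] := leqP k l; last by right; exact: pt_lt kl _ _ (FP l) kE.
    have e : l = k by apply/val_inj; move: kl; rewrite /= l0 leqn0 => /eqP->.
    by rewrite e; exact: bc_min_le.
  have l1 : (l.-1 < l)%N by rewrite prednK // lt0n.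
  have ln := ltn_trans l1 (ltn_ord l).
  right; exists (A (Ordinal ln)); split=> //; first exact: pt_lt (AP _) (FP l).
  move=> E /blk[k kE]; have [kl|kl] := leqP l k.
    right; move: kl; rewrite leq_eqVlt => /orP[/eqP/val_inj e|kl].
      by rewrite -e in kE; exact: bc_min_le.
    by right; exact: pt_lt kl _ _ (FP l) kE.
  left; have : (k <= Ordinal ln)%N by rewrite /= -ltnS prednK // lt0n.
  rewrite leq_eqVlt => /orP[/eqP/val_inj e|kl'].
    by rewrite e in kE; exact: bc_max_ge.
  by right; exact: pt_lt kl' _ _ kE (AP _).
have -> : z = \sum_l dg (a l) * cut_inv (A l) (b l) * start_idem (F l).
  apply: dprod_ext => D; rewrite RI_sumE.
  have [l lD] := blk _ (mem_val D); have [nb hz] := hab l.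
  rewrite (bigD1_seq l) ?index_enum_uniq ?mem_index_enum //= big1 => [|k kl].
    rewrite addr0 !RI_mulE start_idem_ge ?mulr1; last exact: bc_min_le.
    have hb : ~ pset (hi (\val D)) (b l) by move=> /(interval_le_hi (bc_max_ge lD)).
    apply: (invertible_inj (to_RQ_invertible (lo (\val D)) hb)).
    by rewrite hz // mulrCA cut_inv_le ?mulr1 //; exact: bc_max_ge.
  rewrite !RI_mulE; move: kl; rewrite neq_ltn => /orP[kl|lk].
    by rewrite cut_inv_gt ?mulr0 ?mul0r //; exact: pt_lt kl _ _ (AP k) lD.
  by rewrite start_idem_lt ?mulr0 //; exact: pt_lt lk _ _ lD (FP k).
apply: (big_ind Q) => //; first by have -> : 0 = dg 0 by
  apply: dprod_ext => D; rewrite dgE rmorph0.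
move=> l _; apply: (QM); first by apply: (QM) => //; apply: Q_cut_inv => //; case: (hab l).
exact: Q_start_idem.
Qed.

End Induction.
End DirectUnion.
(** Both [u] and [v] equal [u * c * v]; each commutes with [c], but not necessarily with the
    other. *)
Lemma quasi_inverse_uniq (A : pzRingType) (c u v : A) :
  c * u = u * c -> c * v = v * c -> c * c * u = c -> u * u * c = u ->
  c * c * v = c -> v * v * c = v -> u = v.
Proof.
move=> cu cv ccu uuc ccv vvc; transitivity (u * c * v).
  by rewrite -[LHS]uuc -[X in _ = X * c * _]uuc -!mulrA [c * (c * v)]mulrA ccv.
rewrite -[RHS]vvc -[X in _ * X = _]vvc.
have -> : v * v * c = c * v * v by rewrite -mulrA -cv mulrA -cv.
by rewrite !mulrA -cu -[c * u * c]mulrA -cu !mulrA ccu.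
Qed.

(** * The map [f_(I)] is a homological epimorphism *)

Section DirectUnionRing.
Variables (R : idomainType) (hR : valuation_domain R) (B : bchain R).

Definition dmk (x : RI (bc_set B)) (hx : dunion x) : dlim B := DLim (asboolT hx).

Lemma dmkE x (hx : dunion x) : dlim_val (dmk hx) = x. Proof. by []. Qed.

Lemma dlim_ext (u v : dlim B) : (forall D, dlim_val u D = dlim_val v D) -> u = v.
Proof. by move=> e; apply/val_inj/dprod_ext. Qed.

Lemma dlim_dunion (u : dlim B) : dunion (dlim_val u).
Proof. by apply/asboolP/dlimP. Qed.

Lemma fIE r : dlim_val (fI B r) = @dg R B r.
Proof. exact: gmap_to_RQ. Qed.

Lemma dlimM (u v : dlim B) D : dlim_val (u * v) D = dlim_val u D * dlim_val v D.
Proof. by []. Qed.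
Lemma dlimB (u v : dlim B) D : dlim_val (u - v) D = dlim_val u D - dlim_val v D.
Proof. by []. Qed.
Lemma dlim1 D : dlim_val (1 : dlim B) D = 1. Proof. by []. Qed.
Lemma dlim0 D : dlim_val (0 : dlim B) D = 0. Proof. by []. Qed.

(** The set where [g] and [h] agree contains the image of [R], is a subring, and is closed under
    quasi-inverses by their uniqueness. [Q] carries a membership proof because [dunion_ind] speaks
    of elements of the product. *)
Lemma fI_epi : ring_epi (fI B).
Proof.
move=> T g h gh u.
pose Q x := exists hx : dunion x, g (dmk hx) = h (dmk hx).
have QE (v : dlim B) x : dlim_val v = x -> Q x <-> g v = h v.
  move=> e; split=> [[hx]|e'].
    by have -> : dmk hx = v by apply/val_inj; rewrite /= e.
  have hx : dunion x by rewrite -e; exact: dlim_dunion.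
  by exists hx; have -> : dmk hx = v by apply/val_inj; rewrite /= e.
apply/(QE u _ erefl); apply: dunion_ind (dlim_dunion u).
- by move=> r; apply/(QE (fI B r)); [exact: fIE | exact: gh].
- move=> x y [hx ex] [hy ey]; apply/(QE (dmk hx + dmk hy)) => //.
  by rewrite !rmorphD ex ey.
- move=> x y [hx ex] [hy ey]; apply/(QE (dmk hx * dmk hy)) => //.
  by rewrite !rmorphM ex ey.
- move=> r z hz ccz zzc; apply/(QE (dmk hz)) => //.
  have e1 : fI B r * fI B r * dmk hz = fI B r.
    by apply/val_inj; rewrite /= gmap_to_RQ.
  have e2 : dmk hz * dmk hz * fI B r = dmk hz.
    by apply/val_inj; rewrite /= gmap_to_RQ.
  have gr : g (fI B r) = h (fI B r) by exact: gh.
  apply: (@quasi_inverse_uniq _ (g (fI B r))).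
  + by rewrite -!(rmorphM g) mulrC.
  + by rewrite gr -!(rmorphM h) mulrC.
  + by rewrite -!(rmorphM g) e1.
  + by rewrite -!(rmorphM g) e2.
  + by rewrite gr -!(rmorphM h) e1.
  + by rewrite gr -!(rmorphM h) e2.
Qed.

(** Take the first block [l] whose numerator is nonzero at its least interval. Evaluation there puts
    [r] in the idempotent prime [lo (F l)]. Each element of that prime kills [u]: before block [l]
    the numerators vanish, from it on the element itself does. *)
Lemma fI_annihilators : idempotent_annihilators (fI B).
Proof.
move=> u r ru0; have [P /im_partitionP h] := dlim_dunion u.
have /choice[a /choice[b hab]] := h.
pose F l := bc_min (pt_block P l).
have FP l : bc_set (pt_block P l) (F l) by case: (bc_minP (pt_block P l)).
have BF l : bc_set B (F l) by exact: (@pt_sub _ _ P l).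
have vanish_at l c (D : set_type (bc_set B)) : bc_set (pt_block P l) (\val D) ->
    pset (lo (\val D)) (c * a l) -> dlim_val (fI B c * u) D = 0.
  move=> lD /(to_RQ_eq0 (@lo_hi _ (\val D))) e; have [nb hz] := hab l.
  have hb : ~ pset (hi (\val D)) (b l) by move=> /(interval_le_hi (bc_max_ge lD)).
  apply: (invertible_mul_eq0 (to_RQ_invertible (lo (\val D)) hb)).
  by rewrite dlimM fIE mulrCA hz // -rmorphM.
have [h0|/existsNP h1] := pselect (forall l, pset (lo (F l)) (a l)).
  have u0 : u = 0.
    rewrite -[u]mul1r -(rmorph1 (fI B)); apply: dlim_ext => D.
    have : bc_set B (\val D) by exact: mem_val.
    rewrite {1}(pt_cover P) => -[l _ lD]; apply: (vanish_at l) => //.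
    rewrite mul1r; apply: (interval_le_lo (bc_min_le lD)); exact: h0.
  by exists r, 1; rewrite mulr1 u0 !mulr0.
have [l lN lmin] : exists2 l, ~ pset (lo (F l)) (a l) &
    forall k : 'I_(pt_n P).+1, (k < l)%N -> pset (lo (F k)) (a k).
  have [l0 l0N] := h1.
  have [l /asboolP lN lmin] :=
    @arg_minnP _ l0 (fun l => `[< ~ pset (lo (F l)) (a l) >]) val (asboolT l0N).
  exists l => // k kl; apply: contrapT => kN.
  by have := lmin k (asboolT kN); rewrite leqNgt kl.
have rF : pset (lo (F l)) r.
  pose D := idx (BF l); have [nb hz] := hab l.
  have e : to_RQ _ _ (b l) * dlim_val u D = to_RQ _ _ (a l) by apply: hz; exact: FP.
  have [//|//] : pset (lo (F l)) r \/ pset (lo (F l)) (a l).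
  apply: primeM; apply/(to_RQ_eq0 (@lo_hi _ (F l))).
  have := congr1 (fun v : dlim B => dlim_val v D) ru0.
  rewrite dlimM fIE dgE dlim0 => e0.
  by rewrite rmorphM -[X in _ * X]e mulrCA [X in _ * X]e0 mulr0.
have loI : is_ideal (pset (lo (F l))) by case: (psetP (lo (F l))).
have [c [d [cF dF ->]]] := proj1 (ideal_mul_self hR loI) (lo_idem (F l)) r rF.
suff kill t : pset (lo (F l)) t -> fI B t * u = 0.
  by exists c, d; rewrite !kill.
move=> tF; apply: dlim_ext => D.
have : bc_set B (\val D) by exact: mem_val.
rewrite {1}(pt_cover P) => -[k _ kD]; apply: (vanish_at k) => //.
have [kl|lk] := ltnP k l.
  by apply: primeMl; apply: (interval_le_lo (bc_min_le kD)); exact: lmin.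
apply: primeMr; apply: interval_le_lo tF.
move: lk; rewrite leq_eqVlt => /orP[/eqP/val_inj e|lk].
  by rewrite -e in kD; exact: bc_min_le.
by right; exact: pt_lt lk _ _ (FP l) kD.
Qed.

Lemma fI_homological : homological_epi (fI B).
Proof. by apply/(homological_epiP hR); split; [exact: fI_epi | exact: fI_annihilators]. Qed.

Lemma start_idem_dunion F : left_end (bc_set B) F -> dunion (@start_idem R B F).
Proof.
move=> lF; apply: Q_start_idem (lF).
- by move=> r; rewrite -fIE; exact: dlim_dunion.
- by move=> x y hx hy; exact: (dlim_dunion (dmk hx + dmk hy)).
- by move=> x y hx hy; exact: (dlim_dunion (dmk hx * dmk hy)).
- by [].
Qed.

Lemma dunionM x y : dunion x -> dunion y -> dunion (x * y : RI (bc_set B)).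
Proof. by move=> hx hy; exact: (dlim_dunion (dmk hx * dmk hy)). Qed.

End DirectUnionRing.

Lemma to_zero_homological (R : idomainType) (hR : valuation_domain R) :
  homological_epi (@to_zero R).
Proof.
apply/(homological_epiP hR); split.
  by move=> T g h _ u; rewrite (zero_ringE u 1) !rmorph1.
by move=> s r _; exists r, 1; rewrite mulr1; split=> //; exact: zero_ringE.
Qed.
(** * The bijection *)

Lemma spec_transport (R : idomainType) (S S' : comPzRingType)
    (f : {rmorphism R -> S}) (f' : {rmorphism R -> S'}) (phi : {rmorphism S -> S'}) :
  bijective phi -> phi \o f =1 f' -> spec f `<=` spec f'.
Proof.
move=> [psi phiK psiK] e D [n [[nI nT nX] hiD loD]].
have pull J' : is_ideal J' -> is_ideal (phi @^-1` J').
  move=> [J0 JD JM]; split; rewrite /preimage /=; first by rewrite rmorph0.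
    by move=> x y hx hy; rewrite rmorphD; exact: JD.
  by move=> a x hx; rewrite rmorphM; exact: JM.
exists (psi @^-1` n); split.
- have [n0 nD nM] := nI; split.
  + split; rewrite /preimage /=; first by rewrite -(rmorph0 phi) phiK.
      by move=> x y; rewrite -{2}[x]psiK -{2}[y]psiK -rmorphD phiK; exact: nD.
    by move=> a x; rewrite -[a]psiK -{2}[x]psiK -rmorphM phiK; exact: nM.
  + move=> e1; apply: nT; apply/seteqP; split=> // s _.
    by have : (psi @^-1` n) (phi s) by [rewrite e1]; rewrite /preimage /= phiK.
  + move=> J' J'I nJ'; have [|e1|e1] := nX _ (pull J' J'I).
    * by move=> s ns; apply: nJ'; rewrite /preimage /= phiK.
    * by left; apply/seteqP; split=> s /=; rewrite /preimage /= -e1 /preimage /= psiK.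
    * right; apply/seteqP; split=> // s _; rewrite -[s]psiK.
      by have : (phi @^-1` J') (psi s) by rewrite e1.
- by move=> r; rewrite hiD -e /preimage /= phiK.
- move=> r; rewrite loD -e /=; split=> [[t nt te]|[t nt te]].
    by exists (phi t); rewrite /preimage /= ?phiK // -rmorphM te rmorph0.
  exists (psi t) => //; apply: (can_inj phiK).
  by rewrite rmorphM psiK te rmorph0.
Qed.

Lemma intervals_ofE (R : idomainType) (f : homEpi R) :
  intervals_of f = spec (he_map f : {rmorphism R -> cod f}).
Proof.
apply/seteqP; split=> D [n].
  move=> [nmax [hiD loD]]; exists n; split=> //; first by move=> r; rewrite hiD.
  by move=> r; rewrite loD; exact: to_loc_eq0.
move=> [nmax hiD loD]; exists n, nmax; split; apply/seteqP; split=> r.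
- by move/hiD.
- by move/hiD.
- by move/loD/(to_loc_eq0 nmax).
- by move/(to_loc_eq0 nmax)/loD.
Qed.

(** * Recovering the chain from [f_(I)] *)

Section SpectrumOfUnion.
Variables (R : idomainType) (hR : valuation_domain R).
Variables (C : goodChain R) (I0 : gc_set C !=set0).
Notation I := (gc_set C).
Notation B := (gc_bchain I0).
Notation f := (fI B).
Let fE : ring_epi f := @fI_epi R B.
Let fA : idempotent_annihilators f := fI_annihilators hR (B := B).

Let cmp D E := @subchain_cmp R I D E (@gc_chain R C).

(** The elements with non-unit component at [D] form an ideal; a maximal ideal over it gives [D'].
    The ends of [D'] are compared with those of [D] through idempotents starting at left ends and
    inverses cut at right ends. *)
Lemma chain_sub_spec : I `<=` spec f.
Proof.
move=> D ID; pose Di := idx (B := B) ID.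
pose m (x : dlim B) := ~ invertible (dlim_val x Di).
have mI : is_ideal m.
  split.
  - by move=> [y]; rewrite dlim0 mul0r => /esym/(RQ_1_neq0 (@lo_hi _ D)).
  - by move=> x y; exact: (RQ_nonunitD (@lo_hi _ D)).
  - by move=> a x mx; rewrite /m dlimM => /invertibleM[].
have m1 : ~ m 1 by apply; exact: invertible1.
have [n [nmax mn]] := maximal_over mI m1.
have [D' nD'] := point_exists hR fA nmax; have [_ hiD' loD'] := nD'.
suff -> : D = D' by exists n.
have zero_in (x : dlim B) : dlim_val x Di = 0 -> n x.
  by move=> e; apply: mn; rewrite /m e => -[y]; rewrite mul0r => /esym/(RQ_1_neq0 (@lo_hi _ D)).
have n1 := max1 nmax.
apply: interval_ext; apply/prime_ext/seteqP; split.
- move=> r rD; have [F [lF FD rF]] := left_end_approx ID rD.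
  apply/loD'; exists (dmk (start_idem_dunion (B := B) lF)).
    move=> ne; apply: n1; rewrite -[1](subrK (dmk (start_idem_dunion (B := B) lF))).
    apply: (maxD nmax) => //; apply: zero_in.
    by rewrite dlimB dlim1 dmkE start_idem_ge // subrr.
  apply: dlim_ext => E; rewrite dlimM fIE dlim0 dgE dmkE.
  have [FE|EF] := cmp lF.1 (mem_val E).
    by rewrite (proj2 (to_RQ_eq0 (@lo_hi _ _) r)) ?mulr0 //; exact: interval_le_lo FE _ rF.
  by rewrite start_idem_lt // mul0r.
- move=> r /loD'[t nt e]; apply/(to_RQ_eq0 (@lo_hi _ D)).
  have : invertible (dlim_val t Di) by apply: contrapT => /mn.
  move=> /invertible_mul_eq0; apply.
  have := congr1 (fun v : dlim B => dlim_val v Di) e.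
  by rewrite dlimM fIE dlim0.
- move=> r rD; apply/hiD'/mn; rewrite /m fIE dgE.
  by move=> /(to_RQ_invertibleE (@lo_hi _ D)); apply.
- move=> r /hiD' nr; apply: contrapT => rD.
  have [A [rA DA rA']] := right_end_approx ID rD.
  pose u := dmk (dunion_cut_inv (B := B) rA rA').
  apply: n1; rewrite -[1](subKr (f r * u)); apply: (maxB nmax); first exact: maxMr.
  apply: zero_in; rewrite dlimB dlim1 dlimM fIE dgE dmkE cut_inv_le ?subrr //.
Qed.

Lemma spec_sub_chain : spec f `<=` I.
Proof.
move=> D' sD'; apply: contrapT => nID'.
have nnD' := nn_max sD'; have n1 := max1 nnD'.
have side G : I G -> interval_lt G D' \/ interval_lt D' G.
  move=> IG; have [[e|//]|] := spec_cmp hR fE (chain_sub_spec IG) sD'.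
  - by case: nID'; rewrite -e.
  - by left.
  - by right.
pose L := [set G | I G /\ interval_lt G D'].
pose U := [set G | I G /\ interval_lt D' G].
(* If not, (C2) gives [H] in the chain: below [D'] it would be a maximum of [L], and above [D'] it
   would have too large a lower end. *)
have Lmax : L !=set0 -> exists A, maximal_in L A.
  move=> L0; apply: contrapT => nmax.
  have LI : L `<=` I by move=> G [].
  have [H IH loH] := gc_C2 LI L0 nmax.
  have [HD|DH] := side H IH.
    apply: nmax; exists H; split=> // G [IG GD] [_].
    by apply; apply: subset_trans (@lo_hi R H); rewrite loH => x Gx; exists G.
  case: DH => _; apply; rewrite loH => x [G [_ GD] Gx]; apply: lo_hi.
  by case: GD => + _; apply; exact: lo_hi.
have Umin : U !=set0 -> exists F, minimal_in U F.
  move=> U0; apply: contrapT => nmin.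
  have UI : U `<=` I by move=> G [].
  have [H IH hiH] := gc_C1 UI U0 nmin.
  have [HD|DH] := side H IH; last first.
    apply: nmin; exists H; split=> // G [IG DG] [_].
    by apply; apply: subset_trans (@lo_hi R H) _; rewrite hiH => x; apply.
  case: HD => _; apply; rewrite hiH => x Dx G [_ [+ _]]; move=> DG; apply: lo_hi.
  by apply: DG; exact: lo_hi.
have hiN r : ~ pset (hi D') r -> ~ nn f D' (f r) by move=> h /(hiE sD').
have [L0|nL] := pselect (L !=set0); have [U0|nU] := pselect (U !=set0).
- have [A [[IA AD] Amax]] := Lmax L0; have [F [[IF DF] Fmin]] := Umin U0.
  have AF := interval_lt_trans AD DF.
  have cut G : I G -> interval_le G A \/ interval_le F G.
    move=> IG; have [GD|DG] := side G IG.
      left; have [//|AG] := cmp IG IA; by case: (Amax G).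
    right; have [//|GF] := cmp IF IG; by case: (Fmin G).
  have rA : right_end I A by split=> //; right; exists F.
  have [r rD rA'] := lt_witness AD; have [r' rF rD'] := lt_witness DF.
  (* [1 - f r * u] vanishes up to [A] and [r'] vanishes from [F] on, so their product is zero. Yet
     neither factor lies in [nn f D']: [f r] does, while [r'] is outside [hi D']. *)
  pose u := dmk (dunion_cut_inv (B := B) rA rA').
  have e : f r' * (1 - f r * u) = 0.
    apply: dlim_ext => G; rewrite dlimM dlimB dlim1 dlimM !fIE !dgE dlim0 dmkE.
    have [GA|FG] := cut _ (mem_val G).
      by rewrite cut_inv_le // subrr mulr0.
    rewrite (proj2 (to_RQ_eq0 (@lo_hi _ _) r')) ?mul0r //.
    exact: interval_le_lo FG _ rF.
  have nu : ~ nn f D' (1 - f r * u).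
    move=> h; apply: n1; rewrite -[1](subrK (f r * u)); apply: (maxD nnD') => //.
    by apply: maxMr => //; exact: lo_nn.
  by apply: (nmaxM nnD' (hiN _ rD') nu); rewrite e; exact: max0 nnD'.
- have [A [[IA AD] Amax]] := Lmax L0; have [r rD rA'] := lt_witness AD.
  have top G : I G -> interval_le G A.
    move=> IG; have [GD|DG] := side G IG; last by case: nU; exists G.
    have [//|AG] := cmp IG IA; by case: (Amax G).
  have rA : right_end I A by split=> //; left.
  pose u := dmk (dunion_cut_inv (B := B) rA rA').
  have e : f r * u = 1.
    apply: dlim_ext => G; rewrite dlimM fIE dgE dlim1 dmkE cut_inv_le //.
    exact/top/mem_val.
  by apply: n1; rewrite -e; apply: maxMr => //; exact: lo_nn.
- have [F [[IF DF] Fmin]] := Umin U0; have [r rF rD'] := lt_witness DF.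
  have e : f r = 0.
    apply: dlim_ext => G; rewrite fIE dgE dlim0.
    apply/(to_RQ_eq0 (@lo_hi _ _)); have IG := mem_val G.
    have [GD|DG] := side _ IG; first by case: nL; exists (\val G).
    have [FG|GF] := cmp IF IG; first exact: interval_le_lo FG _ rF.
    by case: (Fmin (\val G)).
  by apply: (hiN _ rD'); rewrite e; exact: max0 nnD'.
- case: I0 => G IG; have [GD|DG] := side G IG.
    by apply: nL; exists G.
  by apply: nU; exists G.
Qed.

Lemma spec_fI : spec f = I.
Proof. by apply/seteqP; split; [exact: spec_sub_chain | exact: chain_sub_spec]. Qed.

End SpectrumOfUnion.

(** * Identification of [S] with the ring of its chain *)

Section SpectrumIso.
Variables (R : idomainType) (hR : valuation_domain R).
Variables (S : comPzRingType) (f : {rmorphism R -> S}).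
Hypothesis fE : ring_epi f.
Hypothesis fA : idempotent_annihilators f.
Variables (C : goodChain R) (C0 : gc_set C !=set0).
Hypothesis specE : gc_set C = spec f.
Notation B := (gc_bchain C0).
Implicit Types (D : set_type (bc_set B)) (s t : S).

Let specD D : spec f (\val D).
Proof. by rewrite -specE; exact: (mem_val D). Qed.

Definition comp D : {rmorphism S -> RQ (lo (\val D)) (hi (\val D))} :=
  projT1 (cid (point_map hR fE (nnP (specD D)))).

Lemma compP D : [/\ forall r, comp D (f r) = to_RQ _ _ r,
  forall s, comp D s = 0 <-> Z f (\val D) s &
  forall s, invertible (comp D s) <-> ~ nn f (\val D) s].
Proof. exact: projT2 (cid (point_map hR fE (nnP (specD D)))). Qed.

Definition comps (s : S) : RI (bc_set B) := fun D => comp D s.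

Lemma comps_zmod_morphism : zmod_morphism comps.
Proof. by move=> s t; apply: dprod_ext => D; exact: rmorphB. Qed.

Lemma comps_monoid_morphism : monoid_morphism comps.
Proof.
by split=> [|s t]; apply: dprod_ext => D; [exact: rmorph1 | exact: rmorphM].
Qed.

HB.instance Definition _ :=
  GRing.isZmodMorphism.Build S (RI (bc_set B)) comps comps_zmod_morphism.
HB.instance Definition _ :=
  GRing.isMonoidMorphism.Build S (RI (bc_set B)) comps comps_monoid_morphism.

Lemma comps_f r : comps (f r) = dg r.
Proof. by apply: dprod_ext => D; have [h _ _] := compP D; exact: h. Qed.

Lemma spec_idx (E : admInterval R) : spec f E -> exists D, \val D = E.
Proof. by rewrite -specE => IE; exists (idx (B := B) IE). Qed.

Lemma comps_inj : injective comps.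
Proof.
apply: raddf_inj => s s0; apply: (Z_all hR fE fA) => E /spec_idx[D <-].
by have [_ h _] := compP D; apply/h; exact: (congr1 (fun x : RI (bc_set B) => x D) s0).
Qed.

Lemma dunion_sub_comps x : dunion x -> exists s, comps s = x.
Proof.
apply: (dunion_ind (Q := fun x => exists s, comps s = x)) => [r|_ _ [s <-] [t <-]|_ _ [s <-] [t <-]|r z _ ccz zzc].
- by exists (f r); exact: comps_f.
- by exists (s + t); rewrite rmorphD.
- by exists (s * t); rewrite rmorphM.
(* The [t] with [t * f r] a multiple of [f r * f r] form an ideal. At each point either [f r]
   vanishes, and a [t] outside [nn] kills it, or [f r] is a unit and is itself such a [t]. *)
have [u hu] : exists u, 1 * f r = f r * f r * u.
  apply: (spec_all hR fE fA (a := fun t => exists u, t * f r = f r * f r * u)).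
    split; first by exists 0; rewrite mul0r mulr0.
      by move=> s t [v e] [w e']; exists (v + w); rewrite mulrDl mulrDr e e'.
    by move=> a s [v e]; exists (a * v); rewrite -mulrA e; ring.
  move=> E IE; have [D eD] := spec_idx IE; have [pf pZ pn] := compP D.
  have : (dg r * (dg r * z - 1) : RI (bc_set B)) D = 0.
    by rewrite mulrBr mulr1 mulrA ccz subrr.
  move=> /(RQ_mul_eq0 (@lo_hi _ _))[e|e].
    have : comp D (f r) = 0 by rewrite pf.
    rewrite pZ eD => -[t nt te]; exists t => //.
    by exists 0; rewrite te mulr0.
  exists (f r); first by exists 1; rewrite mulr1.
  rewrite -eD; apply/pn; rewrite pf; exists (z D).
  by apply/eqP; rewrite -subr_eq0; apply/eqP.
(* If [c = c * c * u], then [u * c * u] is a quasi-inverse of [c]; uniqueness identifies its image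
   with [z]. *)
rewrite mul1r in hu; exists (u * (f r * u)).
apply: (@quasi_inverse_uniq _ (dg r)).
- exact: mulrC.
- exact: mulrC.
- rewrite -comps_f -!(rmorphM comps); congr comps.
  transitivity (f r * f r * u * (f r * u)); first by ring.
  by rewrite -hu mulrA -hu.
- rewrite -comps_f -!(rmorphM comps); congr comps.
  transitivity (u * u * (f r * f r * u) * (f r * u)); first by ring.
  rewrite -hu; transitivity (u * u * (f r * f r * u)); first by ring.
  by rewrite -hu; ring.
- exact: ccz.
- exact: zzc.
Qed.

(** The elements fixed by some good idempotent form an ideal. A block around each point on which [s]
    is one fraction supplies such an idempotent outside [nn]. So some good idempotent fixes 1, hence
    is 1. *)
Lemma comps_dunion s : dunion (comps s).
Proof.
pose good e := [/\ e * e = e, dunion (comps e) & dunion (comps (e * s))].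
have dD x y : dunion x -> dunion y -> dunion (x + y : RI (bc_set B)).
  by move=> hx hy; exact: (dlim_dunion (dmk hx + dmk hy)).
have dB x y : dunion x -> dunion y -> dunion (x - y : RI (bc_set B)).
  by move=> hx hy; exact: (dlim_dunion (dmk hx - dmk hy)).
have ddg r : dunion (dg r : RI (bc_set B)) by rewrite -fIE; exact: dlim_dunion.
(* The idempotent whose support is the union of the two supports. *)
have good_join e e' : good e -> good e' -> good (e + e' - e * e').
  move=> [ee de des] [ee' de' des']; split.
  - transitivity (e * e + e' * e' + 2%:R * (e * e') - 2%:R * (e * e) * e' -
      2%:R * e * (e' * e') + (e * e) * (e' * e')); first by ring.
    by rewrite ee ee'; ring.
  - by rewrite rmorphB rmorphD rmorphM; apply: dB; [exact: dD | exact: dunionM].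
  - have -> : (e + e' - e * e') * s = e * s + e' * s - e * (e' * s) by ring.
    by rewrite rmorphB rmorphD (rmorphM comps e (e' * s));
      apply: dB; [exact: dD | exact: dunionM].
have [e [[_ _ es] e1]] : exists e, good e /\ (1 - e) * 1 = 0.
  apply: (spec_all hR fE fA (a := fun w => exists e, good e /\ (1 - e) * w = 0)).
    split.
    - exists 0; rewrite mulr0; split=> //; split; rewrite ?mul0r //.
        by rewrite rmorph0 -(subrr (dg 1)); exact: dB.
      by rewrite rmorph0 -(subrr (dg 1)); exact: dB.
    - move=> w w' [e [ge ew]] [e' [ge' ew']]; exists (e + e' - e * e').
      split; first exact: good_join.
      transitivity ((1 - e') * ((1 - e) * w) + (1 - e) * ((1 - e') * w')); first by ring.
      by rewrite ew ew' !mulr0 addr0.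
    - by move=> a w [e [ge ew]]; exists e; split=> //; rewrite mulrCA ew mulr0.
  move=> E IE; have [D eD] := spec_idx IE.
  have [a [b [nb [t nt te]]]] := nn_frac hR fE IE s.
  have nfb : ~ nn f E (f b) by move/(hiE IE).
  (* On this block [t] and [f b] are both units, so [t * (f b * s - f a) = 0] makes [s] equal to
     [a / b] throughout. *)
  have [F [A [lF rA FE EA ntb]]] :=
    unit_neighbourhood hR fE fA IE (nmaxM (nn_max IE) nt nfb).
  have [nA hbA] : ~ nn f A t /\ ~ pset (hi A) b.
    have := ntb A rA.1 (interval_le_trans FE EA) (interval_lexx A) => h.
    split=> [tA|/(hiE rA.1) bA]; apply: h.
      exact: maxMr (nn_max rA.1) _ _ tA.
    exact: maxMl (nn_max rA.1) _ _ bA.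
  rewrite -specE in lF rA.
  have dF := start_idem_dunion (B := B) lF.
  have dA1 := dunion_cut_inv (B := B) rA (@prime1 _ (hi A)).
  have dAb := dunion_cut_inv (B := B) rA hbA.
  have [e he] := dunion_sub_comps (dunionM dF dA1).
  have inside G : interval_le F (\val G) -> interval_le (\val G) A -> comp G e = 1.
    move=> FG GA; rewrite -[LHS]/(comps e G) he RI_mulE start_idem_ge // mul1r.
    by have := cut_inv_le (@prime1 _ (hi A)) GA; rewrite rmorph1 mul1r.
  have cases G : (interval_le F (\val G) /\ interval_le (\val G) A) \/ comp G e = 0.
    rewrite -[comp G e]/(comps e G) he RI_mulE.
    have [GA|AG] := RI_cmp G rA.1; last by right; rewrite cut_inv_gt ?mulr0.
    have [FG|GF] := subchain_cmp (@gc_chain _ C) lF.1 (mem_val G); first by left.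
    by right; rewrite start_idem_lt ?mul0r.
  have eeE : e * e = e.
    apply: comps_inj; apply: dprod_ext => G.
    rewrite -[LHS]/(comp G (e * e)) rmorphM -[RHS]/(comp G e).
    have [[FG GA]|->] := cases G; last by rewrite mul0r.
    by rewrite inside // mulr1.
  exists e; last first.
    rewrite -eD; have [_ _ pn] := compP D; apply/pn; rewrite inside ?eD //.
    exact: invertible1.
  exists e; split; last by rewrite mulrBl mul1r eeE subrr.
  split; [exact: eeE | by rewrite he; exact: dunionM |].
  have -> : comps (e * s) = comps e * (dg a * cut_inv A b).
    apply: dprod_ext => G; rewrite -[LHS]/(comp G (e * s)) rmorphM !RI_mulE.
    rewrite -[comps e G]/(comp G e).
    have [[FG GA]|->] := cases G; last by rewrite !mul0r.
    rewrite inside // !mul1r; have [pf pZ pn] := compP G.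
    have hbG : ~ pset (hi (\val G)) b by move=> /(interval_le_hi GA).
    apply: (invertible_inj (to_RQ_invertible (lo (\val G)) hbG)).
    rewrite mulrCA cut_inv_le // mulr1 dgE -!pf -rmorphM.
    apply/eqP; rewrite -subr_eq0 -rmorphB; apply/eqP/pZ; exists t => //.
    move=> tG; apply: (ntb _ (specD G) FG GA); exact: maxMr (nn_max (specD G)) _ _ tG.
  apply: dunionM; first by rewrite he; exact: dunionM.
  exact: dunionM.
suff -> : s = e * s by [].
move/eqP: e1; rewrite mulr1 subr_eq0 => /eqP <-; by rewrite mul1r.
Qed.

Definition comps_dlim (s : S) : dlim B := dmk (comps_dunion s).

Lemma comps_dlim_zmod_morphism : zmod_morphism comps_dlim.
Proof. by move=> s t; apply/val_inj; exact: (rmorphB comps). Qed.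

Lemma comps_dlim_monoid_morphism : monoid_morphism comps_dlim.
Proof.
split=> [|s t]; apply/val_inj; first exact: (rmorph1 comps).
exact: (rmorphM comps).
Qed.

HB.instance Definition _ :=
  GRing.isZmodMorphism.Build S (dlim B) comps_dlim comps_dlim_zmod_morphism.
HB.instance Definition _ :=
  GRing.isMonoidMorphism.Build S (dlim B) comps_dlim comps_dlim_monoid_morphism.

Lemma spec_iso : exists phi : {rmorphism S -> dlim B},
  bijective phi /\ phi \o f =1 fI B.
Proof.
exists comps_dlim; split.
  have /choice[g hg] : forall u : dlim B, exists s, comps_dlim s = u.
    move=> u; have [s hs] := dunion_sub_comps (dlim_dunion u).
    by exists s; apply/val_inj.
  exists g => // s; apply: comps_inj.
  exact: (congr1 (@dlim_val _ _) (hg (comps_dlim s))).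
by move=> r; apply/val_inj; rewrite /= comps_f -fIE.
Qed.

End SpectrumIso.

(** * Equivalence classes and the two inverse assignments *)

Lemma good_chain_ext (R : idomainType) (I J : goodChain R) :
  gc_set I = gc_set J -> I = J.
Proof.
case: I J => [I c1 c2 c3 c4] [J d1 d2 d3 d4] /= e; case: _ / e in d1 d2 d3 d4 *.
by congr GoodChain; exact: Prop_irrelevance.
Qed.

Section Classes.
Variable R : idomainType.
Implicit Types f g h : homEpi R.

Lemma he_equiv_sym f g : he_equiv f g -> he_equiv g f.
Proof.
move=> [phi [[psi phiK psiK] e]].
have psiB : zmod_morphism psi.
  by move=> x y; apply: (can_inj phiK); rewrite rmorphB !psiK.
have psiM : monoid_morphism psi.
  by split=> [|x y]; apply: (can_inj phiK); rewrite ?rmorph1 ?rmorphM !psiK.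
exists (HB.pack_for {rmorphism he_ring g -> he_ring f} psi
  (GRing.isZmodMorphism.Build _ _ psi psiB) (GRing.isMonoidMorphism.Build _ _ psi psiM)).
split; first by exists phi.
by move=> r; apply: (can_inj phiK); rewrite /= psiK; exact/esym/e.
Qed.

Lemma he_equiv_trans f g h : he_equiv f g -> he_equiv g h -> he_equiv f h.
Proof.
move=> [phi [bphi e]] [psi [bpsi e']]; exists (psi \o phi); split.
  exact: bij_comp.
by move=> r; exact: etrans (congr1 psi (e r)) (e' r).
Qed.

Lemma hec_ext (c d : homEpiClass R) : hec_pred c = hec_pred d -> c = d.
Proof.
case: c d => p hp [q hq] /= e; case: _ / e in hq *.
by congr HomEpiClass; exact: Prop_irrelevance.
Qed.

Lemma hec_eq f g : he_equiv f g -> hec f = hec g.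
Proof.
move=> fg; apply: hec_ext; apply/funext => h; apply/propext; split=> [|gh].
  by apply: he_equiv_trans; exact: he_equiv_sym.
exact: he_equiv_trans fg gh.
Qed.

Lemma hec_rep (c : homEpiClass R) : exists f, c = hec f.
Proof. by have [f e] := hecP c; exists f; exact: hec_ext. Qed.

Lemma he_equiv_refl f : he_equiv f f.
Proof. by exists idfun; split=> //; exists id. Qed.

Lemma hec_inj f g : hec f = hec g -> he_equiv f g.
Proof.
move=> e; have := congr1 (fun c : homEpiClass R => c g) e.
rewrite /= /he_class => ->; exact: he_equiv_refl.
Qed.

Lemma intervals_of_equiv f g : he_equiv f g -> intervals_of f = intervals_of g.
Proof.
suff half f' g' : he_equiv f' g' -> intervals_of f' `<=` intervals_of g'.
  by move=> fg; apply/seteqP; split; apply: half => //; exact: he_equiv_sym.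
move=> [phi [bphi e]]; rewrite !intervals_ofE.
exact: (@spec_transport R (cod f') (cod g') _ _ phi bphi e).
Qed.

End Classes.

Section Bijection.
Variables (R : idomainType) (hR : valuation_domain R).

Lemma he_annihilators (f : homEpi R) : idempotent_annihilators (he_map f).
Proof. by have [_] := proj1 (homological_epiP hR f) (heP f). Qed.

Definition chain_of (f : homEpi R) : goodChain R :=
  @spec_good R hR (cod f) (he_map f) (heP f).1 (he_annihilators (f := f)).

Lemma chain_ofE (f : homEpi R) : gc_set (chain_of f) = intervals_of f.
Proof. by rewrite intervals_ofE. Qed.

Lemma intervals_of_fI (C : goodChain R) (C0 : gc_set C !=set0)
    (h : homological_epi (fI (gc_bchain C0))) :
  intervals_of (HomEpi h) = gc_set C.
Proof.
rewrite intervals_ofE -(spec_fI hR C0); apply/seteqP; split.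
  by apply: (@spec_transport R (cod (HomEpi h)) (dlim (gc_bchain C0)) _ _ idfun
    (Bijective (fun=> erefl) (fun=> erefl)) (fun=> erefl)).
by apply: (@spec_transport R (dlim (gc_bchain C0)) (cod (HomEpi h)) _ _ idfun
  (Bijective (fun=> erefl) (fun=> erefl)) (fun=> erefl)).
Qed.

Lemma intervals_of_to_zero (h : homological_epi (@to_zero R)) :
  intervals_of (HomEpi h) = set0.
Proof.
apply/seteqP; split=> // D [n [[[n0 _ _] nT _] _]]; apply: nT.
by apply/seteqP; split=> // x _; rewrite (zero_ringE x 0).
Qed.

Lemma he_equiv_fI (f : homEpi R) (C : goodChain R) (C0 : gc_set C !=set0)
    (h : homological_epi (fI (gc_bchain C0))) :
  gc_set C = intervals_of f -> he_equiv f (HomEpi h).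
Proof.
rewrite intervals_ofE => e.
have [phi [bphi ephi]] :=
  @spec_iso R hR (cod f) (he_map f) (heP f).1 (he_annihilators (f := f)) C C0 e.
by exists phi.
Qed.

Lemma he_equiv_to_zero (f : homEpi R) (h : homological_epi (@to_zero R)) :
  intervals_of f = set0 -> he_equiv f (HomEpi h).
Proof.
rewrite intervals_ofE => e0.
have S0 (x y : cod f) : x = y.
  suff e1 : (1 : cod f) = 0 by rewrite -[x]mul1r -[y]mul1r e1 !mul0r.
  have fE : ring_epi (he_map f : {rmorphism R -> cod f}) := (heP f).1.
  have fA : idempotent_annihilators (he_map f : {rmorphism R -> cod f}).
    exact: he_annihilators.
  (* With no points at all, the zero ideal vacuously escapes every maximal ideal. *)
  apply: (spec_all hR fE fA (a := fun x => x = 0)); last first.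
    by move=> D; rewrite e0.
  by split=> [|a b -> ->|a b ->] //; rewrite ?addr0 ?mulr0.
pose phi (x : he_ring f) : zero_ring R := 0.
have phiB : zmod_morphism phi by move=> x y; exact: zero_ringE.
have phiM : monoid_morphism phi by split=> [|x y]; exact: zero_ringE.
exists (HB.pack_for {rmorphism he_ring f -> zero_ring R} phi
  (GRing.isZmodMorphism.Build _ _ phi phiB) (GRing.isMonoidMorphism.Build _ _ phi phiM)).
split; last by move=> r; exact: zero_ringE.
by exists (fun=> 0) => x; [exact: S0 | exact: zero_ringE].
Qed.

Definition epi_of (C : goodChain R) : homEpi R :=
  match pselect (gc_set C !=set0) with
  | left C0 => HomEpi (fI_homological hR (gc_bchain C0))
  | right _ => HomEpi (to_zero_homological hR)
  end.

Lemma intervals_of_epi_of C : intervals_of (epi_of C) = gc_set C.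
Proof.
rewrite /epi_of; case: pselect => [C0|nC]; first exact: intervals_of_fI.
rewrite intervals_of_to_zero; apply/esym/seteqP; split=> // D CD.
by case: nC; exists D.
Qed.

Lemma he_equiv_epi_of f C : gc_set C = intervals_of f -> he_equiv f (epi_of C).
Proof.
move=> e; rewrite /epi_of; case: pselect => [C0|nC]; first exact: he_equiv_fI.
apply: he_equiv_to_zero; rewrite -e; apply/seteqP; split=> // D CD.
by case: nC; exists D.
Qed.

End Bijection.

Theorem theorem5p23 (R : idomainType) (hR : valuation_domain R) :
  exists (Phi : goodChain R -> homEpiClass R)
         (Psi : homEpiClass R -> goodChain R),
    [/\ (forall I : goodChain R, Psi (Phi I) = I),
        (forall c : homEpiClass R, Phi (Psi c) = c),
        (forall (I : goodChain R) (I0 : gc_set I !=set0),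
           exists h : homological_epi (fI (gc_bchain I0)),
             Phi I = hec (HomEpi h)),
        (forall I : goodChain R, gc_set I = set0 ->
           exists h : homological_epi (@to_zero R), Phi I = hec (HomEpi h)) &
        (forall f : homEpi R, gc_set (Psi (hec f)) = intervals_of f)].
Proof.
(* The inverse is computed on a chosen representative; [intervals_of_equiv] makes the choice
   immaterial. *)
pose rep (c : homEpiClass R) := projT1 (cid (hec_rep c)).
have repE c : c = hec (rep c) := projT2 (cid (hec_rep c)).
have PsiE f : gc_set (chain_of hR (rep (hec f))) = intervals_of f.
  by rewrite chain_ofE; apply/esym/intervals_of_equiv/hec_inj/repE.
exists (fun I => hec (epi_of hR I)), (fun c => chain_of hR (rep c)); split=> //.
- by move=> I; apply: good_chain_ext; rewrite PsiE intervals_of_epi_of.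
- move=> c; rewrite [RHS]repE; apply/esym/hec_eq/he_equiv_epi_of.
  exact: chain_ofE.
- move=> I I0; exists (fI_homological hR (gc_bchain I0)); rewrite /epi_of.
  case: pselect => [I0'|//]; by rewrite (Prop_irrelevance I0' I0).
- move=> I I0; exists (to_zero_homological hR); rewrite /epi_of.
  by case: pselect => // I1; exfalso; case: I1 => D; rewrite I0.
Qed.
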